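(* Let $z_1,z_2\in\mathbb C\setminus\mathbb R$ be such that $z_1\ne z_2$ and $z_1\ne\bar z_2$, and let $\pi_1,\pi_2$ be Hermitian projections of $\mathbb C^n$. Let $u_0\in\mathcal M_{a,b,j}$ ($j=-1$ or $j\ge1$), and let $u_i=g_{z_i,\pi_i}*u_0=u_0+(z_i-\bar z_i)[\tilde\pi_i,a]$ for $i=1,2$, where $\tilde\pi_i(x,t)$ is the Hermitian projection onto $E(x,t,z_i)^*(\pi_i(\mathbb C^n))$ and $E$ is the trivialization of $u_0$. Set $$\phi=(z_2-z_1)I+(z_1-\bar z_1)\pi_1-(z_2-\bar z_2)\pi_2,\qquad\tilde\phi=(z_2-z_1)I+(z_1-\bar z_1)\tilde\pi_1-(z_2-\bar z_2)\tilde\pi_2,$$ $$\tau_i=\phi\pi_i\phi^{-1},\qquad\tilde\tau_i=\tilde\phi\tilde\pi_i\tilde\phi^{-1}.$$ Then $$u_3:=(g_{z_2,\tau_2}g_{z_1,\pi_1})*u_0=u_0+(z_1-\bar z_1)[\tilde\pi_1,a]+(z_2-\bar z_2)[\tilde\tau_2,a]$$ $$=(g_{z_1,\tau_1}g_{z_2,\pi_2})*u_0=u_0+(z_1-\bar z_1)[\tilde\tau_1,a]+(z_2-\bar z_2)[\tilde\pi_2,a].$$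
   Context: Fix a diagonal $a\in u(n)$ and $b\in u(n)$ a polynomial in $a$. $\mathcal U_a^\perp$ is the orthogonal complement in $u(n)$ (trace form) of the centralizer $\mathcal U_a=\{y\in u(n):[a,y]=0\}$. For $j\ge1$ and smooth $u$ with values in $\mathcal U_a^\perp$: $Q_{b,0}(u)=b$, and $Q_{b,k}(u)$, $k\ge1$, are the unique matrix-valued polynomials without constant term in the entries of $u$ and their $x$-derivatives such that $(Q_{b,k}(u))_x+[u,Q_{b,k}(u)]=[Q_{b,k+1}(u),a]$ for all $k\ge0$; $\mathcal M_{a,b,j}$ is the set of smooth $u:\mathbb R^2\to\mathcal U_a^\perp$ with $u(\cdot,t)$ Schwartz for every $t$ solving $u_t=(Q_{b,j}(u))_x+[u,Q_{b,j}(u)]$; the trivialization $E(x,t,\lambda)$ solves $E_x=E(a\lambda+u)$, $E_t=E(b\lambda^j+Q_{b,1}(u)\lambda^{j-1}+\dots+Q_{b,j}(u))$, $E(0,0,\lambda)=I$. For $j=-1$, $\mathcal M_{a,b,-1}$ is the set of such $u$ (Schwartz in $x$) solving $u_t=[a,g^{-1}bg]$ with $g^{-1}g_x=u$, $\lim_{x\to-\infty}g=I$, and $E$ solves $E_x=E(a\lambda+u)$, $E_t=E\lambda^{-1}g^{-1}bg$, $E(0,0,\lambda)=I$. $G_-^m$ is the group of rational $g:S^2\to GL(n,\mathbb C)$ with $g(\infty)=I$, $g(\bar\lambda)^*g(\lambda)=I$. It acts on $\mathcal M_{a,b,j}$: factor $gE(x,t)=\tilde E(x,t)\tilde g(x,t)$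 with $\tilde g(x,t)\in G_-^m$ and $\tilde E(x,t)$ holomorphic and invertible in $\lambda\in\mathbb C$ (in $\mathbb C\setminus\{0\}$ if $j=-1$) with $\tilde E(\bar\lambda)^*\tilde E(\lambda)=I$; then $g*u=\tilde u$ where $\tilde E^{-1}\tilde E_x=a\lambda+\tilde u$. For $z\in\mathbb C\setminus\mathbb R$ and a Hermitian projection $\pi$ ($\pi^*=\pi=\pi^2$), $g_{z,\pi}(\lambda)=\pi+\frac{\lambda-z}{\lambda-\bar z}(I-\pi)\in G_-^m$. *)

(* Defs.v *)
From HB Require Import structures.
From mathcomp Require Import all_boot all_order all_algebra.
From mathcomp Require Export all_classical all_reals all_analysis.
From mathcomp Require Export complex.
From mathcomp Require Import spectral.

Set Implicit Arguments.
Unset Strict Implicit.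
Unset Printing Implicit Defensive.

Import Order.TTheory GRing.Theory Num.Theory.
Import numFieldNormedType.Exports.

Local Open Scope classical_set_scope.
Local Open Scope ring_scope.
Local Open Scope complex_scope.
Local Open Scope sesquilinear_scope.

Definition lie (C : pzRingType) (n : nat) (A B : 'M[C]_n) : 'M[C]_n :=
  A *m B - B *m A.

Section Backlund.
Variables (R : realType) (n : nat).
Local Notation C := R[i].
Local Notation M := 'M[C]_n.
Implicit Types (a b y z P : M) (f v : R -> M) (u : R -> R -> M).

Definition u_n y : Prop := y^t* = - y.

Definition centralizer a y : Prop := u_n y /\ lie a y = 0.

Definition centralizer_perp a y : Prop :=
  u_n y /\ forall z, centralizer a z -> \tr (y *m z) = 0.

Definition polynomial_in a b : Prop :=
  exists p : {poly C}, b = \sum_(k < size p) p`_k *: a ^+ k.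

(* R[i] carries no canonical normed R-module structure, so derivatives in a real
   variable are taken on the real and imaginary parts of each entry. *)

Definition mderivable f (x : R) : Prop := forall i j,
  derivable (fun s => complex.Re (f s i j)) x 1 /\
  derivable (fun s => complex.Im (f s i j)) x 1.

Definition mderive f (x : R) : M := \matrix_(i, j)
  (derive1 (fun s => complex.Re (f s i j)) x +i*
   derive1 (fun s => complex.Im (f s i j)) x).

Definition mcontinuous2 u : Prop := forall i j,
  continuous (fun p : R * R => complex.Re (u p.1 p.2 i j)) /\
  continuous (fun p : R * R => complex.Im (u p.1 p.2 i j)).

Definition partial_x u : R -> R -> M := fun x t => mderive (u^~ t) x.
Definition partial_t u : R -> R -> M := fun x t => mderive (u x) t.

Definition smooth1 f : Prop :=
  forall (k : nat) (x : R), mderivable (iter k mderive f) x.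

(* All iterated partial derivatives, in any order, exist and are jointly
   continuous; a word in the two directions is coded by a list of booleans. *)
Definition smooth2 u : Prop := forall w : seq bool,
  let d := foldr (fun c : bool => if c then partial_x else partial_t) u w in
  [/\ mcontinuous2 d, forall x t, mderivable (d^~ t) x
    & forall x t, mderivable (d x) t].

Definition schwartz f : Prop := forall k m : nat, exists K : R,
  forall (x : R) i j, (`|x| ^+ m)%:C * `|iter k mderive f x i j| <= K%:C.

(* Differential polynomials are polynomials in countably many indeterminates:
   dpX i j k stands for the (i, j) entry of the k-th x-derivative. *)
Inductive dpoly : Type :=
| dpC of C
| dpX of 'I_n & 'I_n & nat
| dpD of dpoly & dpoly
| dpM of dpoly & dpoly.

Fixpoint dpeval (J : nat -> M) (p : dpoly) : C :=
  match p with
  | dpC c => c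
  | dpX i j k => J k i j
  | dpD p q => dpeval J p + dpeval J q
  | dpM p q => dpeval J p * dpeval J q
  end.

Definition dpconst_term (p : dpoly) : C := dpeval (fun=> 0) p.

Definition mxdpoly : Type := 'I_n -> 'I_n -> dpoly.

Definition mxdpapply (P : mxdpoly) v : R -> M := fun x =>
  \matrix_(i, j) dpeval (fun k => iter k mderive v x) (P i j).

(* Q k is Q_{b,k}. These conditions determine mxdpapply (Q k) v for every smooth
   v with values in centralizer_perp a, which is all that is used below. *)
Definition is_Qfamily a b (Q : nat -> mxdpoly) : Prop :=
  [/\ forall v x, mxdpapply (Q 0%N) v x = b,
      forall k i j, (0 < k)%N -> dpconst_term (Q k i j) = 0
    & forall v, smooth1 v -> (forall x, centralizer_perp a (v x)) ->
      forall (k : nat) (x : R),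
        mderive (mxdpapply (Q k) v) x + lie (v x) (mxdpapply (Q k) v x)
        = lie (mxdpapply (Q k.+1) v x) a].

Definition is_frame u (g : R -> R -> M) : Prop := forall x t,
  [/\ g x t \in unitmx, mderivable (g^~ t) x,
      invmx (g x t) *m partial_x g x t = u x t
    & forall i j,
      (complex.Re (g s t i j) @[s --> -oo%R] --> complex.Re ((1%:M : M) i j)) /\
      (complex.Im (g s t i j) @[s --> -oo%R] --> complex.Im ((1%:M : M) i j))].

(* Here and below j : int is positive or -1: the branch Negz _ means j = -1. *)
Definition solutions a b (Q : nat -> mxdpoly) (j : int) u : Prop :=
  [/\ smooth2 u,
      forall x t, centralizer_perp a (u x t),
      forall t, schwartz (u^~ t)
    & match j with
      | Posz k => forall x t,
          partial_t u x t =
          mderive (mxdpapply (Q k) (u^~ t)) x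
            + lie (u x t) (mxdpapply (Q k) (u^~ t) x)
      | Negz _ => exists g, is_frame u g /\ forall x t,
          partial_t u x t = lie a (invmx (g x t) *m b *m g x t)
      end].

Definition spectral_domain (j : int) : set C :=
  [set l | if (0 <= j) then True else l <> 0].

(* B is the right factor in E_t = E B, namely B = b l^j + ... + Q_{b,j}(u) for
   j > 0 and B = l^-1 g^-1 b g for j = -1. *)
Definition is_flow_part b (Q : nat -> mxdpoly) (j : int) u
    (B : R -> R -> C -> M) : Prop :=
  match j with
  | Posz k => forall x t l,
      B x t l = \sum_(i < k.+1) l ^+ (k - i) *: mxdpapply (Q i) (u^~ t) x
  | Negz _ => exists g, is_frame u g /\ forall x t l,
      B x t l = l^-1 *: (invmx (g x t) *m b *m g x t)
  end.

Definition is_trivialization a b Q (j : int) u (E : R -> R -> C -> M) : Prop :=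
  exists2 B, is_flow_part b Q j u B &
  forall l, spectral_domain j l ->
  E 0 0 l = 1%:M /\
  forall x t,
    [/\ mderivable (fun s => E s t l) x,
        mderive (fun s => E s t l) x = E x t l *m (l *: a + u x t),
        mderivable (fun s => E x s l) t
      & mderive (fun s => E x s l) t = E x t l *m B x t l].

(* A rational map on the sphere is represented by a function on C with arbitrary
   values at its poles, so identities between such maps hold off a finite set. *)

Definition almost_all (S : C -> Prop) : Prop := finite_set [set l | ~ S l].

Definition rational (g : C -> M) : Prop :=
  exists (p : {poly C}) (P : 'M[{poly C}]_n), p != 0 /\
  almost_all (fun l => g l = (p.[l])^-1 *: \matrix_(i, j) (P i j).[l]).

Definition limit_at_infinity_1 (g : C -> M) : Prop :=
  forall e : R, 0 < e -> exists r : R, forall l : C, r%:C < `|l| ->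
  forall i j, `|g l i j - (1%:M : M) i j| < e%:C.

Definition Gm (g : C -> M) : Prop :=
  [/\ rational g, limit_at_infinity_1 g
    & almost_all (fun l => (g (l^*)%R)^t* *m g l = 1%:M)].

Definition holomorphic_on (D : set C) (F : C -> M) : Prop :=
  forall l, D l -> forall i j, derivable (fun s : C^o => F s i j : C^o) l 1.

Definition is_factorization (j : int) (g : C -> M) (E Et : R -> R -> C -> M)
    (gt : R -> R -> C -> M) : Prop := forall x t,
  [/\ almost_all (fun l => g l *m E x t l = Et x t l *m gt x t l),
      Gm (gt x t),
      holomorphic_on (spectral_domain j) (Et x t),
      forall l, spectral_domain j l -> Et x t l \in unitmx
    & forall l, spectral_domain j l -> (Et x t (l^*)%R)^t* *m Et x t l = 1%:M].

Definition dresses a b Q (j : int) (g : C -> M) u ut : Prop :=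
  exists E Et gt,
  [/\ is_trivialization a b Q j u E, is_factorization j g E Et gt
    & forall l, spectral_domain j l -> forall x t,
      mderivable (fun s => Et s t l) x /\
      invmx (Et x t l) *m mderive (fun s => Et s t l) x = l *: a + ut x t].

(* g * u = ut: some factorization of g E yields ut, and every one does. *)
Definition acts_to a b Q (j : int) (g : C -> M) u ut : Prop :=
  [/\ Gm g, dresses a b Q j g u ut
    & forall ut', dresses a b Q j g u ut' -> ut' = ut].

Definition herm_projection P : Prop := P^t* = P /\ P *m P = P.

Definition simple_element (z : C) P : C -> M := fun l =>
  P + ((l - z) / (l - (z^*)%R)) *: (1%:M - P).

Definition mximage P : set 'cV[C]_n := range (fun v : 'cV[C]_n => P *m v).

Definition is_herm_projection_onto (V : set 'cV[C]_n) P : Prop :=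
  herm_projection P /\ mximage P = V.

Definition bianchi_phi (z1 z2 : C) P1 P2 : M :=
  (z2 - z1)%:M + (z1 - (z1^*)%R) *: P1 - (z2 - (z2^*)%R) *: P2.

End Backlund.

(* Main.v *)
Require Import Defs.
From mathcomp Require Import all_boot all_order all_algebra perm spectral.
From mathcomp Require Import ring lra.

Set Implicit Arguments.
Unset Strict Implicit.
Unset Printing Implicit Defensive.

Import Order.TTheory GRing.Theory Num.Theory.
Import numFieldNormedType.Exports.
Local Open Scope classical_set_scope.
Local Open Scope ring_scope.
Local Open Scope complex_scope.
Local Open Scope sesquilinear_scope.

(** Dressing by a simple element g_{z,p} multiplies the trivialization E by a rational loop on
    the left and removes the resulting poles by a rational loop on the right. For the right
    factor g_{z,q} the poles at z and conj z cancel exactly if q projects onto the image of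
    (adjoint of E(z)) p, and then the dressed frame solves the x-equation with potential
    u + (z - conj z) [q, a] (single_dressing; the equation of q is projection_mder).

    The permutability formula is an identity in the dressing group. With
    phi = z2 - z1 + c1 p1 - c2 p2 and tau_i = phi p_i phi^-1 one has
    g_{z2,tau2} g_{z1,p1} = g_{z1,tau1} g_{z2,p2} (simple_element_exchange), because phi commutes
    with c1 p1 - c2 p2; the tau_i are Hermitian projections because phi is normal and phi times
    its adjoint commutes with p1 and p2 (bianchi_norm, phi_unit). The same identity for the
    moving projections shows that the twice dressed frame is regular: dressed through z1 it is
    regular except at z2 and its conjugate, dressed through z2 except at z1 and its conjugate
    (double_dressing). Its potential is obtained from left_factor_ode, and the equality of the
    two formulas for it from tau_sum.

    Analysis enters in three places. First, E depends holomorphically on l, and so do its divided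
    differences in l (triv_jet). They solve variational equations, and the limits that define
    their values on the diagonal exist by Gronwall's inequality (limit_ode, param_ode); only
    boundedness of the coefficients is used, which for j = -1 follows from unitarity of the frame
    g. Second, E is unitary for real l (triv_pairing); for j >= 1 this requires that Q_{b,k}(u) is
    skew-Hermitian, which follows from the recursion, the absence of constant terms and the decay
    of u (Q_skew). Third, the factorization is unique (factorization_unique): the quotient of two
    of them is a rational function without poles, equal to 1 at infinity. *)

(** * Derivatives of complex matrices in a real variable *)

Section Calculus.
Variable R : realType.
Local Notation C := R[i].
Implicit Types (f g : R -> C) (x s : R) (d z w : C).

Lemma ReM z w : complex.Re (z * w) = complex.Re z * complex.Re w - complex.Im z * complex.Im w.
Proof. by case: z w => a b [c d]. Qed.

Lemma ImM z w : complex.Im (z * w) = complex.Re z * complex.Im w + complex.Im z * complex.Re w.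
Proof. by case: z w => a b [c d]. Qed.

Lemma ReD z w : complex.Re (z + w) = complex.Re z + complex.Re w.
Proof. by case: z w => a b [c d]. Qed.

Lemma ImD z w : complex.Im (z + w) = complex.Im z + complex.Im w.
Proof. by case: z w => a b [c d]. Qed.

Lemma ReN z : complex.Re (- z) = - complex.Re z.
Proof. by case: z. Qed.

Lemma ImN z : complex.Im (- z) = - complex.Im z.
Proof. by case: z. Qed.

Lemma ReC z : complex.Re ((z^*)%R) = complex.Re z.
Proof. by case: z. Qed.

Lemma ImC z : complex.Im ((z^*)%R) = - complex.Im z.
Proof. by case: z. Qed.

Definition cpartE := (ReM, ImM, ReD, ImD, ReN, ImN, ReC, ImC).

Lemma complex_ext z w :
  complex.Re z = complex.Re w -> complex.Im z = complex.Im w -> z = w.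
Proof. by case: z w => a b [c d] /= -> ->. Qed.

Lemma is_derive_eq_fun (f g : R -> R) x (d e : R) :
  is_derive x 1 f d -> f =1 g -> d = e -> is_derive x 1 g e.
Proof. by move=> h /funext <- <-. Qed.

Definition cder f x d : Prop :=
  is_derive x 1 (fun s => complex.Re (f s)) (complex.Re d) /\
  is_derive x 1 (fun s => complex.Im (f s)) (complex.Im d).

Lemma cder_unique f x d e : cder f x d -> cder f x e -> d = e.
Proof.
move=> [h1 h2] [k1 k2]; apply: complex_ext.
  by rewrite -(@derive_val _ _ _ _ _ _ _ h1) (@derive_val _ _ _ _ _ _ _ k1).
by rewrite -(@derive_val _ _ _ _ _ _ _ h2) (@derive_val _ _ _ _ _ _ _ k2).
Qed.

Lemma cder_ext f g x d e : cder f x d -> f =1 g -> d = e -> cder g x e.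
Proof. by move=> h /funext <- <-. Qed.

Lemma cder_cst z x : cder (fun=> z) x 0.
Proof. by split; apply: is_derive_cst. Qed.

Lemma cderD f g x d e : cder f x d -> cder g x e ->
  cder (fun s => f s + g s) x (d + e).
Proof.
move=> [f1 f2] [g1 g2]; split.
  by apply: (is_derive_eq_fun (is_deriveD f1 g1)) => [s|]; rewrite ReD.
by apply: (is_derive_eq_fun (is_deriveD f2 g2)) => [s|]; rewrite ImD.
Qed.

Lemma cderN f x d : cder f x d -> cder (fun s => - f s) x (- d).
Proof.
move=> [f1 f2]; split.
  by apply: (is_derive_eq_fun (is_deriveN f1)) => [s|]; rewrite ReN.
by apply: (is_derive_eq_fun (is_deriveN f2)) => [s|]; rewrite ImN.
Qed.

Lemma cderM f g x d e : cder f x d -> cder g x e ->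
  cder (fun s => f s * g s) x (d * g x + f x * e).
Proof.
move=> [f1 f2] [g1 g2]; split.
  apply: (is_derive_eq_fun (is_deriveB (is_deriveM f1 g1) (is_deriveM f2 g2))).
    by move=> s; rewrite ReM.
  by rewrite !cpartE /GRing.scale /=; ring.
apply: (is_derive_eq_fun (is_deriveD (is_deriveM f1 g2) (is_deriveM f2 g1))).
  by move=> s; rewrite ImM.
by rewrite !cpartE /GRing.scale /=; ring.
Qed.

Lemma cder_conj f x d : cder f x d -> cder (fun s => (f s)^*%R) x (d^*)%R.
Proof.
move=> [f1 f2]; split.
  by apply: (is_derive_eq_fun f1) => [s|]; rewrite ReC.
by apply: (is_derive_eq_fun (is_deriveN f2)) => [s|]; rewrite ImC.
Qed.

Lemma cder_sum (I : Type) (r : seq I) (f : I -> R -> C) x (d : I -> C) :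
  (forall i, cder (f i) x (d i)) ->
  cder (fun s => \sum_(i <- r) f i s) x (\sum_(i <- r) d i).
Proof.
move=> h; elim: r => [|i r IH].
  by apply: cder_ext (cder_cst 0 x) _ _ => [s|]; rewrite big_nil.
by apply: cder_ext (cderD (h i) IH) _ _ => [s|]; rewrite big_cons.
Qed.

Definition cderivable f x := exists d, cder f x d.

Lemma cderivable_prod (I : Type) (r : seq I) (f : I -> R -> C) x :
  (forall i, cderivable (f i) x) -> cderivable (fun s => \prod_(i <- r) f i s) x.
Proof.
move=> h; elim: r => [|i r [d IH]].
  by exists 0; apply: cder_ext (cder_cst 1 x) _ _ => [s|//]; rewrite big_nil.
have [e he] := h i; eexists.
by apply: cder_ext (cderM he IH) _ erefl => s; rewrite big_cons.
Qed.

Lemma cderivable_sum (I : Type) (r : seq I) (f : I -> R -> C) x :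
  (forall i, cderivable (f i) x) -> cderivable (fun s => \sum_(i <- r) f i s) x.
Proof.
move=> h; have [d hd] := choice h.
by exists (\sum_(i <- r) d i); apply: cder_sum.
Qed.

Lemma cderivableV f x : f x != 0 -> cderivable f x ->
  cderivable (fun s => (f s)^-1) x.
Proof.
move=> fx0 [d [f1 f2]].
pose N s := complex.Re (f s) * complex.Re (f s) + complex.Im (f s) * complex.Im (f s).
have N0 : N x != 0.
  apply: contraNneq fx0 => N0; rewrite eq_complex /=.
  move: N0; rewrite /N -!expr2 => /eqP.
  by rewrite paddr_eq0 ?sqr_ge0 // !sqrf_eq0.
have dN := is_deriveV N0 (is_deriveD (is_deriveM f1 f1) (is_deriveM f2 f2)).
have e1 := is_deriveM f1 dN; have e2 := is_deriveM (is_deriveN f2) dN.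
have fE s : (f s)^-1 = (complex.Re (f s) / N s) +i* (- complex.Im (f s) / N s).
  rewrite /N; case: (f s) => a b /=.
  by rewrite -!expr2 mulNr.
eexists (_ +i* _); split => /=.
  by apply: (is_derive_eq_fun e1) => [s|//]; rewrite fE.
by apply: (is_derive_eq_fun e2) => [s|//]; rewrite fE.
Qed.

Lemma cder_derive1 f x d : cder f x d ->
  d = derive1 (fun s => complex.Re (f s)) x +i* derive1 (fun s => complex.Im (f s)) x.
Proof.
move=> [h1 h2]; rewrite !derive1E.
by rewrite (@derive_val _ _ _ _ _ _ _ h1) (@derive_val _ _ _ _ _ _ _ h2); case: d {h1 h2}.
Qed.

Lemma cderivableP f x : cderivable f x <->
  derivable (fun s => complex.Re (f s)) x 1 /\ derivable (fun s => complex.Im (f s)) x 1.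
Proof.
split=> [[d [h1 h2]]|[h1 h2]].
  by split; [case: h1 | case: h2].
by exists ('D_1 (fun s => complex.Re (f s)) x +i* 'D_1 (fun s => complex.Im (f s)) x);
  split => /=; split.
Qed.

Section Mx.
Variable n : nat.
Local Notation M := 'M[C]_n.
Implicit Types (F G : R -> M) (D A B : M).

Definition mder F x D : Prop := forall i j, cder (fun s => F s i j) x (D i j).

Lemma mderP F x D : mder F x D <-> mderivable F x /\ mderive F x = D.
Proof.
split=> [h|[h <-]].
  split=> [i j|]; first by apply/cderivableP; exists (D i j).
  by apply/matrixP => i j; rewrite mxE -(cder_derive1 (h i j)).
move=> i j; have /cderivableP[d hd] := h i j.
by rewrite mxE -(cder_derive1 hd).
Qed.

Lemma mderivableP F x : mderivable F x <-> exists D, mder F x D.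
Proof.
split=> [h|[D] /mderP[]//].
by exists (mderive F x); apply/mderP.
Qed.

Lemma mder_unique F x D D' : mder F x D -> mder F x D' -> D = D'.
Proof. by move=> h k; apply/matrixP => i j; apply: cder_unique (h i j) (k i j). Qed.

Lemma mder_ext F G x D D' : mder F x D -> F =1 G -> D = D' -> mder G x D'.
Proof. by move=> h /funext <- <-. Qed.

Lemma mder_cst A x : mder (fun=> A) x 0.
Proof. by move=> i j; rewrite mxE; apply: cder_cst. Qed.

Lemma mderD F G x D D' : mder F x D -> mder G x D' ->
  mder (fun s => F s + G s) x (D + D').
Proof.
move=> h k i j; rewrite mxE.
by apply: cder_ext (cderD (h i j) (k i j)) _ erefl => s; rewrite mxE.
Qed.

Lemma mderN F x D : mder F x D -> mder (fun s => - F s) x (- D).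
Proof.
move=> h i j; rewrite mxE.
by apply: cder_ext (cderN (h i j)) _ erefl => s; rewrite mxE.
Qed.

Lemma mderB F G x D D' : mder F x D -> mder G x D' ->
  mder (fun s => F s - G s) x (D - D').
Proof. by move=> h k; apply: mderD => //; apply: mderN. Qed.

Lemma mderM F G x D D' : mder F x D -> mder G x D' ->
  mder (fun s => F s *m G s) x (D *m G x + F x *m D').
Proof.
move=> h k i j.
apply: cder_ext (cder_sum _ (fun l => cderM (h i l) (k l j))) _ _.
  by move=> s; rewrite mxE.
by rewrite !mxE big_split.
Qed.

Lemma mderZ (c : C) F x D : mder F x D -> mder (fun s => c *: F s) x (c *: D).
Proof.
move=> h i j; rewrite mxE.
apply: cder_ext (cderM (cder_cst c x) (h i j)) _ _ => [s|]; first by rewrite mxE.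
by rewrite mul0r add0r.
Qed.

Lemma mderMl A F x D : mder F x D -> mder (fun s => A *m F s) x (A *m D).
Proof.
move=> h; apply: mder_ext (mderM (mder_cst A x) h) _ _ => //.
by rewrite mul0mx add0r.
Qed.

Lemma mderMr A F x D : mder F x D -> mder (fun s => F s *m A) x (D *m A).
Proof.
move=> h; apply: mder_ext (mderM h (mder_cst A x)) _ _ => //.
by rewrite mulmx0 addr0.
Qed.

Lemma mder_adj F x D : mder F x D -> mder (fun s => (F s)^t*) x (D^t*).
Proof.
move=> h i j; rewrite !mxE.
by apply: cder_ext (cder_conj (h j i)) _ erefl => s; rewrite !mxE.
Qed.

(** By Cramer's rule the entries of the inverse are quotients of polynomials in the
    entries of F. *)
Lemma mderivable_invmx F x : mderivable F x -> (forall s, F s \in unitmx) ->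
  mderivable (fun s => invmx (F s)) x.
Proof.
move=> h u i j; apply/cderivableP.
have hc i' j' : cderivable (fun s => F s i' j') x by apply/cderivableP; apply: h.
have hdet m (G : R -> 'M[C]_m) : (forall i j, cderivable (fun s => G s i j) x) ->
    cderivable (fun s => \det (G s)) x.
  move=> hG; rewrite /determinant; apply: cderivable_sum => p.
  have [d hd] := cderivable_prod (index_enum 'I_m) (fun i => hG i (p i)).
  by eexists; apply: cderM (cder_cst _ x) hd.
have [d1 h1] : cderivable (fun s => (\det (F s))^-1) x.
  apply: cderivableV; last exact: hdet.
  by have := u x; rewrite unitmxE unitfE.
have [d2 h2] : cderivable (fun s => \adj (F s) i j) x.
  have hm k l : cderivable (fun s => row' j (col' i (F s)) k l) x.
    have [d hd] := hc (lift j k) (lift i l).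
    by exists d; apply: cder_ext hd _ erefl => s; rewrite !mxE.
  have [d hd] := hdet _ _ hm.
  eexists; apply: cder_ext (cderM (cder_cst ((-1) ^+ (j + i)) x) hd) _ erefl.
  by move=> s; rewrite mxE.
eexists; apply: cder_ext (cderM h1 h2) _ erefl => s.
by rewrite /invmx (u s) [RHS]mxE.
Qed.

Lemma mder_invmx F x D : mder F x D -> (forall s, F s \in unitmx) ->
  mder (fun s => invmx (F s)) x (- (invmx (F x) *m D *m invmx (F x))).
Proof.
move=> h u.
have /mderivableP[D' h'] : mderivable (fun s => invmx (F s)) x.
  by apply: mderivable_invmx => //; apply/mderivableP; exists D.
suff <- : D' = - (invmx (F x) *m D *m invmx (F x)) by [].
have e : D *m invmx (F x) + F x *m D' = 0.
  apply: mder_unique (mderM h h') _.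
  by apply: mder_ext (mder_cst 1%:M x) _ erefl => s; rewrite mulmxV.
have /eqP := congr1 (mulmx (invmx (F x))) e.
by rewrite mulmxDr mulmx0 mulKmx // mulmxA addrC addr_eq0 => /eqP.
Qed.

End Mx.
End Calculus.

(** * Expansion of matrix identities *)

Section MatrixExpansion.
Variables (K : comPzRingType) (m n p : nat).

Lemma mxD_ij (A B : 'M[K]_(m, n)) i j : (A + B) i j = A i j + B i j.
Proof. by rewrite mxE. Qed.

Lemma mxN_ij (A : 'M[K]_(m, n)) i j : (- A) i j = - A i j.
Proof. by rewrite mxE. Qed.

Lemma mxZ_ij k (A : 'M[K]_(m, n)) i j : (k *: A) i j = k * A i j.
Proof. by rewrite mxE. Qed.

Lemma mx0_ij i j : (0 : 'M[K]_(m, n)) i j = 0.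
Proof. by rewrite mxE. Qed.

Lemma scalemx_l k (A : 'M[K]_(m, n)) (B : 'M[K]_(n, p)) : (k *: A) *m B = k *: (A *m B).
Proof. by rewrite scalemxAl. Qed.

Lemma scalemx_r k (A : 'M[K]_(m, n)) (B : 'M[K]_(n, p)) : A *m (k *: B) = k *: (A *m B).
Proof. by rewrite scalemxAr. Qed.

End MatrixExpansion.

(** mx_ring decides identities between matrix expressions: both sides are expanded into
    linear combinations of words, and the coefficients are compared entry by entry, a
    word being an atom for ring. *)
Ltac mx_expand := rewrite ?(mulmxDl, mulmxDr, mulmxN, mulNmx, scalemx_l, scalemx_r,
  mulmxA, mulmx1, mul1mx, mulmx0, mul0mx).
Ltac mx_entries := apply/matrixP => ? ?; rewrite ?(mxD_ij, mxN_ij, mxZ_ij, mx0_ij).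
Ltac mx_ring := mx_expand; mx_entries; ring.

Section ProductIncrements.
Variables (K : comPzRingType) (n : nat).
Implicit Types (A B F G X : 'M[K]_n) (c h : K).

Lemma mulmx_sub_split A A0 B B0 : A *m B - A0 *m B0 = (A - A0) *m B0 + A *m (B - B0).
Proof. mx_ring. Qed.

Lemma mulmx_increment F0 F1 G0 G1 h :
  (F0 + h *: F1) *m (G0 + h *: G1) = F0 *m G0 + h *: (F1 *m (G0 + h *: G1) + F0 *m G1).
Proof. mx_ring. Qed.

Lemma mulmx_increment2 F0 F1 F2 G0 G1 G2 h :
  (F1 + h *: F2) *m (G0 + h *: (G1 + h *: G2)) + F0 *m (G1 + h *: G2) =
  F1 *m G0 + F0 *m G1 +
    h *: (F2 *m (G0 + h *: (G1 + h *: G2)) + F1 *m (G1 + h *: G2) + F0 *m G2).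
Proof. mx_ring. Qed.

Lemma lie_linear_comb X A B c h : lie X (c *: A + h *: B) = c *: lie X A + h *: lie X B.
Proof. rewrite /lie; mx_ring. Qed.

Lemma pairing_cancel A B F G c :
  A *m (c *: F + G) *m B + A *m ((c *: - F - G) *m B) = 0.
Proof. mx_ring. Qed.

End ProductIncrements.
(** * Real-valued algebra norms *)

Section Norm.
Variable R : realType.
Local Notation C := R[i].
Implicit Types (z w : C).

(** Equivalent to the modulus, but with values in R: estimates in R[i] would take place
    in a partially ordered field. *)
Definition cn z : R := `|complex.Re z| + `|complex.Im z|.

Lemma cn_ge0 z : 0 <= cn z.
Proof. by rewrite addr_ge0. Qed.

Lemma cn0 : cn 0 = 0.
Proof. by rewrite /cn normr0 addr0. Qed.

Lemma cn_eq0 z : (cn z == 0) = (z == 0).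
Proof. by rewrite /cn paddr_eq0 // !normr_eq0 eq_complex. Qed.

Lemma cn_gt0 z : (0 < cn z) = (z != 0).
Proof. by rewrite lt0r cn_eq0 cn_ge0 andbT. Qed.

Lemma cnN z : cn (- z) = cn z.
Proof. by rewrite /cn ReN ImN !normrN. Qed.

Lemma cnJ z : cn (z^*)%R = cn z.
Proof. by rewrite /cn ReC ImC normrN. Qed.

Lemma cnD z w : cn (z + w) <= cn z + cn w.
Proof. by rewrite /cn ReD ImD addrACA lerD // ler_normD. Qed.

Lemma cnB z w : cn (z - w) <= cn z + cn w.
Proof. by rewrite -(cnN w) cnD. Qed.

Lemma cnM z w : cn (z * w) <= cn z * cn w.
Proof.
rewrite /cn ReM ImM; apply: le_trans (lerD (ler_normB _ _) (ler_normD _ _)) _.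
by rewrite !normrM le_eqVlt; apply/orP; left; apply/eqP; ring.
Qed.

Lemma cn_sum (I : Type) (r : seq I) (f : I -> C) :
  cn (\sum_(i <- r) f i) <= \sum_(i <- r) cn (f i).
Proof.
elim: r => [|i r IH]; first by rewrite !big_nil cn0.
by rewrite !big_cons (le_trans (cnD _ _)) // lerD2l.
Qed.

Lemma Re_le_cn z : `|complex.Re z| <= cn z.
Proof. by rewrite lerDl. Qed.

Lemma Im_le_cn z : `|complex.Im z| <= cn z.
Proof. by rewrite lerDr. Qed.

Lemma norm_le_cn z : `|z| <= (cn z)%:C.
Proof.
case: z => a b; rewrite normc_def lecR /cn /= -(@ler_pXn2r _ 2) ?nnegrE ?sqrtr_ge0 ?addr_ge0 //.
rewrite sqr_sqrtr ?addr_ge0 ?sqr_ge0 // -(real_normK (num_real a)) -(real_normK (num_real b)).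
rewrite sqrrD -addrA lerD2l -[leLHS]add0r lerD2r mulrn_wge0 // mulr_ge0 //.
Qed.

Lemma cn_le_norm z : (cn z)%:C <= `|z| *+ 2.
Proof.
rewrite [(cn z)%:C]rmorphD mulr2n lerD ?normc_ge_Re //.
have := normc_ge_Re (z * 'i); rewrite ReiNIm normrN => /le_trans -> //.
by rewrite normrM -[leRHS]mulr1 ler_wpM2l ?normr_ge0 // normc_def /= expr0n /= add0r expr1n sqrtr1.
Qed.

Variable n : nat.
Local Notation M := 'M[C]_n.
Implicit Types (A B : M) (F : R -> M).

(** The entrywise 1-norm, which is submultiplicative. *)
Definition mn A : R := \sum_i \sum_j cn (A i j).

Lemma mn_ge0 A : 0 <= mn A.
Proof. by apply: sumr_ge0 => i _; apply: sumr_ge0 => j _; apply: cn_ge0. Qed.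

Lemma mn0 : mn 0 = 0.
Proof. by apply: big1 => i _; apply: big1 => j _; rewrite mxE cn0. Qed.

Lemma cn_le_mn A i j : cn (A i j) <= mn A.
Proof.
rewrite /mn (bigD1 i) //= (bigD1 j) //= -addrA lerDl addr_ge0 //.
  by apply: sumr_ge0 => ? _; apply: cn_ge0.
by apply: sumr_ge0 => ? _; apply: sumr_ge0 => ? _; apply: cn_ge0.
Qed.

Lemma mnN A : mn (- A) = mn A.
Proof. by apply: eq_bigr => i _; apply: eq_bigr => j _; rewrite mxE cnN. Qed.

Lemma mnD A B : mn (A + B) <= mn A + mn B.
Proof.
rewrite /mn -big_split /=; apply: ler_sum => i _.
by rewrite -big_split /=; apply: ler_sum => j _; rewrite mxE cnD.
Qed.

Lemma mnB A B : mn (A - B) <= mn A + mn B.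
Proof. by rewrite -(mnN B) mnD. Qed.

Lemma mnZ z A : mn (z *: A) <= cn z * mn A.
Proof.
rewrite /mn mulr_sumr; apply: ler_sum => i _.
by rewrite mulr_sumr; apply: ler_sum => j _; rewrite mxE cnM.
Qed.

Lemma mnJ A : mn (A^t*) = mn A.
Proof.
rewrite /mn exchange_big /=; apply: eq_bigr => i _; apply: eq_bigr => j _.
by rewrite !mxE; apply: cnJ.
Qed.

Lemma mnM A B : mn (A *m B) <= mn A * mn B.
Proof.
rewrite {1}/mn.
apply: (@le_trans _ _ (\sum_i \sum_j \sum_k cn (A i k) * cn (B k j))).
  apply: ler_sum => i _; apply: ler_sum => j _; rewrite mxE.
  by apply: le_trans (cn_sum _ _) _; apply: ler_sum => k _; apply: cnM.
rewrite {1}/mn mulr_suml; apply: ler_sum => i _.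
rewrite exchange_big mulr_suml; apply: ler_sum => k _.
rewrite -mulr_sumr ler_wpM2l ?cn_ge0 // /mn [leRHS](bigD1 k) //= lerDl.
by apply: sumr_ge0 => ? _; apply: sumr_ge0 => ? _; apply: cn_ge0.
Qed.

Lemma mn_le A (K : R) : (forall i j, cn (A i j) <= K) -> mn A <= (n * n)%:R * K.
Proof.
move=> h; have -> : (n * n)%:R * K = \sum_(i < n) \sum_(j < n) K.
  by rewrite !sumr_const !card_ord -mulrnA mulr_natl.
by apply: ler_sum => i _; apply: ler_sum => j _.
Qed.

(** Unlike mn, the Frobenius norm squared is differentiable, which Gronwall's argument
    needs. *)
Definition sqn A : R := \sum_i \sum_j (complex.Re (A i j) ^+ 2 + complex.Im (A i j) ^+ 2).

Lemma sqn_ge0 A : 0 <= sqn A.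
Proof.
by apply: sumr_ge0 => i _; apply: sumr_ge0 => j _; rewrite addr_ge0 ?sqr_ge0.
Qed.

Lemma sqr_cn_le z : cn z ^+ 2 <= 2 * (complex.Re z ^+ 2 + complex.Im z ^+ 2).
Proof.
rewrite /cn -(real_normK (num_real (complex.Re z))) -(real_normK (num_real (complex.Im z))).
have := sqr_ge0 (`|complex.Re z| - `|complex.Im z|); nra.
Qed.

Lemma cn_sqn A i j : cn (A i j) ^+ 2 <= 2 * sqn A.
Proof.
apply: le_trans (sqr_cn_le _) _; rewrite ler_pM2l //.
rewrite /sqn (bigD1 i) //= (bigD1 j) //= -addrA lerDl addr_ge0 //.
  by apply: sumr_ge0 => ? _; rewrite addr_ge0 ?sqr_ge0.
by apply: sumr_ge0 => ? _; apply: sumr_ge0 => ? _; rewrite addr_ge0 ?sqr_ge0.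
Qed.

Lemma mn_sqn A : mn A ^+ 2 <= ((n * n)%:R ^+ 2 * 2) * sqn A.
Proof.
have h : mn A <= (n * n)%:R * Num.sqrt (2 * sqn A).
  apply: mn_le => i j; rewrite -(@ler_pXn2r _ 2) ?nnegrE ?cn_ge0 ?sqrtr_ge0 //.
  by rewrite sqr_sqrtr ?cn_sqn // mulr_ge0 ?sqn_ge0.
have := h; rewrite -(@ler_pXn2r _ 2) ?nnegrE ?mn_ge0 ?mulr_ge0 ?sqrtr_ge0 //.
by rewrite exprMn sqr_sqrtr ?mulr_ge0 ?sqn_ge0 // mulrA.
Qed.

Lemma sqn_mn A : sqn A <= mn A ^+ 2.
Proof.
rewrite expr2 {2}/mn mulr_sumr; apply: ler_sum => i _.
rewrite mulr_sumr; apply: ler_sum => j _.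
apply: (@le_trans _ _ (cn (A i j) * cn (A i j))); last by rewrite ler_wpM2r ?cn_ge0 ?cn_le_mn.
rewrite /cn -(real_normK (num_real (complex.Re _))) -(real_normK (num_real (complex.Im _))).
have := normr_ge0 (complex.Re (A i j)); have := normr_ge0 (complex.Im (A i j)); nra.
Qed.

End Norm.

(** * Mean value inequality and Gronwall's inequality *)

Section Growth.
Variable R : realType.
Local Notation C := R[i].

Lemma is_derive_continuous (f df : R -> R) :
  (forall s : R, is_derive s 1 f (df s)) -> forall A : set R, {within A, continuous f}.
Proof.
move=> h A; apply: continuous_subspaceT => s.
by apply: differentiable_continuous; apply/derivable1_diffP; have [] := h s.
Qed.

Lemma real_mvt (f df : R -> R) (T K : R) :
  (forall s : R, is_derive s 1 f (df s)) -> (forall s, `|s| <= T -> `|df s| <= K) ->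
  forall s r, `|s| <= T -> `|r| <= T -> `|f s - f r| <= K * `|s - r|.
Proof.
move=> h b s r; wlog rs : s r / r <= s => [H sT rT|].
  have [|/ltW] := leP r s => rs; first exact: H.
  by rewrite distrC [X in K * X]distrC; apply: H.
move=> sT rT.
have [c] := MVT_segment rs (fun x _ => h x) (@is_derive_continuous _ _ h _).
rewrite in_itv /= => /andP[rc cs] ->.
rewrite normrM ler_wpM2r // b //.
by rewrite ler_norml; move: sT rT; rewrite !ler_norml => /andP[? ?] /andP[? ?]; apply/andP; split; lra.
Qed.

(** The function f(s) exp(- L s) is nonincreasing for s >= 0; negative s are reached by
    reflection. *)
Lemma real_gronwall (f df : R -> R) (T L : R) : 0 <= L ->
  (forall s : R, is_derive s 1 f (df s)) -> (forall s, 0 <= f s) ->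
  (forall s, `|s| <= T -> `|df s| <= L * f s) ->
  forall s, `|s| <= T -> f s <= f 0 * expR (L * T).
Proof.
move=> L0.
suff H (g dg : R -> R) : (forall s : R, is_derive s 1 g (dg s)) -> (forall s, 0 <= g s) ->
    (forall s, `|s| <= T -> `|dg s| <= L * g s) ->
    forall s, 0 <= s -> s <= T -> g s <= g 0 * expR (L * T).
  move=> h f0 b s sT; have [s0|s0] := leP 0 s.
    by apply: (H _ _ h f0 b) => //; rewrite (le_trans (ler_norm s)).
  have := H (fun s => f (- s)) (fun s => - df (- s)) _ _ _ (- s).
  rewrite opprK oppr0; apply.
  - move=> x; have hN := is_deriveN (is_derive_id x (1 : R)).
    by apply: (is_derive_eq_fun (is_derive1_comp (h (- x)) hN)) => // ; rewrite /GRing.scale /= mulrN1.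
  - by [].
  - by move=> x xT; rewrite normrN b ?normrN.
  - by rewrite oppr_ge0 ltW.
  - by rewrite (le_trans (ler_norm _)) ?normrN.
move=> h g0 b s s0 sT.
pose e (x : R) := expR (- L * x).
have de (x : R) : is_derive x 1 e (- L * e x).
  have := is_derive1_comp (is_derive_expR (- L * x)) (is_deriveZ (- L) (is_derive_id x (1 : R))).
  by move=> de; apply: (is_derive_eq_fun de) => //; rewrite /GRing.scale /= mulr1 mulrC.
have dp (x : R) := is_deriveM (h x) (de x).
have ps : (g * e) s <= (g * e) 0.
  have [c] := MVT_segment s0 (fun x _ => dp x) (@is_derive_continuous _ _ dp _).
  rewrite in_itv /= subr0 => /andP[c0 cs] E.
  rewrite -subr_le0 E mulr_le0_ge0 // /GRing.scale /=.
  have cT : `|c| <= T by rewrite ger0_norm // (le_trans cs).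
  have -> : g c * (- L * e c) + e c * dg c = e c * (dg c - L * g c) by ring.
  rewrite mulr_ge0_le0 ?expR_ge0 // subr_le0.
  exact: le_trans (ler_norm _) (b _ cT).
have {ps} : g s * expR (- L * s) <= g 0 by move: ps; rewrite /GRing.mul /= /e mulr0 expR0 mulr1.
rewrite mulNr expRN ler_pdivrMr ?expR_gt0 // => /le_trans; apply.
by rewrite ler_wpM2l // ler_expR ler_wpM2l.
Qed.

Variable n : nat.
Local Notation M := 'M[C]_n.
Implicit Types (F : R -> M).

Lemma mn_mvt F (dF : R -> M) (T K : R) :
  (forall s, mder F s (dF s)) -> (forall s, `|s| <= T -> mn (dF s) <= K) ->
  forall s r, `|s| <= T -> `|r| <= T ->
    mn (F s - F r) <= (n * n)%:R * (2 * K) * `|s - r|.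
Proof.
move=> h b s r sT rT; rewrite -mulrA; apply: mn_le => i j.
rewrite !mxE /cn !cpartE mulrDl mul1r mulrDl lerD //.
  apply: (@real_mvt (fun s => complex.Re (F s i j)) (fun s => complex.Re (dF s i j)) T) => // x.
    by have [] := h x i j.
  by move=> /b; apply: le_trans; apply: le_trans (Re_le_cn _) (cn_le_mn _ _ _).
apply: (@real_mvt (fun s => complex.Im (F s i j)) (fun s => complex.Im (dF s i j)) T) => // x.
  by have [] := h x i j.
by move=> /b; apply: le_trans; apply: le_trans (Im_le_cn _) (cn_le_mn _ _ _).
Qed.

Lemma mder0_cst F : (forall s, mder F s 0) -> forall s r, F s = F r.
Proof.
move=> h s r; apply/matrixP => i j; apply: complex_ext.
  apply: (is_derive_0_is_cst (f := fun s => complex.Re (F s i j))) => x.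
  by have [] := h x i j; rewrite mxE.
apply: (is_derive_0_is_cst (f := fun s => complex.Im (F s i j))) => x.
by have [] := h x i j; rewrite mxE.
Qed.

Lemma is_derive_sqn F x D : mder F x D ->
  is_derive x 1 (fun s => sqn (F s))
    (\sum_i \sum_j (2 * (complex.Re (F x i j) * complex.Re (D i j)
                        + complex.Im (F x i j) * complex.Im (D i j)))).
Proof.
move=> h; pose G i j s := complex.Re (F s i j) ^+ 2 + complex.Im (F s i j) ^+ 2.
have hG i j : is_derive x 1 (G i j) (2 * (complex.Re (F x i j) * complex.Re (D i j)
                        + complex.Im (F x i j) * complex.Im (D i j))).
  have [h1 h2] := h i j.
  apply: (is_derive_eq_fun (is_deriveD (is_deriveM h1 h1) (is_deriveM h2 h2))).
    by move=> s; rewrite /G !expr2.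
  by rewrite /GRing.scale /=; ring.
apply: (is_derive_eq_fun (is_derive_sum (fun i => is_derive_sum (hG i)))) => // s.
by rewrite fct_sumE; apply: eq_bigr => i _; rewrite fct_sumE.
Qed.

(** The constant G depends on T and K only, so that the bound is uniform over families of
    equations; it comes from the scalar inequality for the Frobenius norm squared plus
    b^2, whose derivative is at most L times itself. *)
Lemma mn_gronwall (T K : R) : 0 <= K -> exists2 G : R, 0 <= G &
  forall F (dF : R -> M) (b : R), 0 <= b -> (forall s, mder F s (dF s)) ->
    (forall s, `|s| <= T -> mn (dF s) <= K * mn (F s) + b) ->
    forall s, `|s| <= T -> mn (F s) <= G * (mn (F 0) + b).
Proof.
move=> K0; pose m : R := (n * n)%:R ^+ 2 * 2; pose L := (2 * K + 1) * m + 1.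
have m0 : 0 <= m by rewrite mulr_ge0 ?sqr_ge0.
have L1 : 1 <= L by rewrite lerDr mulr_ge0 // addr_ge0 // mulr_ge0.
have L0 : 0 <= L by exact: le_trans ler01 L1.
pose e := expR (L * T); have e0 : 0 <= e by exact: expR_ge0.
exists (m * e + e + 1) => [|F dF b b0 h bd s sT].
  by rewrite !addr_ge0 // mulr_ge0.
have key : sqn (F s) + b ^+ 2 <= (sqn (F 0) + b ^+ 2) * e.
  pose df x := \sum_i \sum_j (2 * (complex.Re (F x i j) * complex.Re (dF x i j)
                        + complex.Im (F x i j) * complex.Im (dF x i j))).
  apply: (@real_gronwall (fun s => sqn (F s) + b ^+ 2) df T L) => //.
  - move=> x; apply: (is_derive_eq_fun (is_deriveD (is_derive_sqn (h x)) (is_derive_cst (b ^+ 2) x 1))) => //.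
    by rewrite addr0.
  - by move=> x; rewrite addr_ge0 ?sqn_ge0 ?sqr_ge0.
  move=> x xT; apply: (@le_trans _ _ (2 * (mn (F x) * mn (dF x)))).
    rewrite {1}/mn mulr_suml mulr_sumr /df.
    apply: le_trans (ler_norm_sum _ _ _) _; apply: ler_sum => i _.
    rewrite mulr_suml mulr_sumr.
    apply: le_trans (ler_norm_sum _ _ _) _; apply: ler_sum => j _.
    rewrite normrM ger0_norm // ler_pM2l //.
    apply: (@le_trans _ _ (cn (F x i j) * cn (dF x i j))); last by rewrite ler_wpM2l ?cn_ge0 ?cn_le_mn.
    apply: le_trans (ler_normD _ _) _; rewrite !normrM /cn.
    have a1 := normr_ge0 (complex.Re (F x i j)); have a2 := normr_ge0 (complex.Im (F x i j)).
    have a3 := normr_ge0 (complex.Re (dF x i j)); have a4 := normr_ge0 (complex.Im (dF x i j)).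
    by nra.
  have f0 := mn_ge0 (F x); have g0 := mn_ge0 (dF x); have sq := mn_sqn (F x).
  have bx := bd x xT; rewrite -/m in sq.
  have s0 := sqn_ge0 (F x).
  apply: (@le_trans _ _ ((2 * K + 1) * mn (F x) ^+ 2 + b ^+ 2)).
    have := ler_wpM2l f0 bx; have := sqr_ge0 (mn (F x) - b); rewrite sqrrB !expr2.
    by move: (mn (F x)) (mn (dF x)) => u v; nra.
  apply: (@le_trans _ _ ((2 * K + 1) * (m * sqn (F x)) + b ^+ 2)).
    by rewrite lerD2r ler_wpM2l // addr_ge0 // mulr_ge0.
  rewrite mulrDr lerD //; last by rewrite ler_peMl ?sqr_ge0.
  by rewrite mulrA ler_wpM2r // lerDl.
have f0 := mn_ge0 (F 0); have le2 := sqn_mn (F 0).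
rewrite -(@ler_pXn2r _ 2) ?nnegrE ?mn_ge0 ?mulr_ge0 ?addr_ge0 ?(mulr_ge0 m0 e0) //.
apply: le_trans (mn_sqn _) _; rewrite -/m.
have le3 : sqn (F s) <= (mn (F 0) ^+ 2 + b ^+ 2) * e.
  apply: (@le_trans _ _ ((sqn (F 0) + b ^+ 2) * e)).
    by apply: le_trans key; rewrite lerDl sqr_ge0.
  by rewrite ler_wpM2r // lerD2r.
apply: (@le_trans _ _ (m * ((mn (F 0) ^+ 2 + b ^+ 2) * e))); first by rewrite ler_wpM2l.
rewrite mulrCA mulrC exprMn; apply: ler_pM.
- exact: mulr_ge0.
- by rewrite addr_ge0 ?sqr_ge0.
- have me := mulr_ge0 m0 e0; rewrite expr2; move: (m * e) me => y y0; nra.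
- by rewrite sqrrD -addrA lerD2l -[leLHS]add0r lerD2r mulrn_wge0 // mulr_ge0.
Qed.

End Growth.
(** * Limits of families of linear differential equations *)

Section Limits.
Variable R : realType.
Local Notation C := R[i].

(** A Cauchy family with explicit rate r has the limit sup (f i - r i), which lies below
    every f j + r j; no sequence or filter has to be extracted. *)
Lemma common_limit (I : Type) (f r : I -> R) (i0 : I) :
  (forall i j, `|f i - f j| <= r i + r j) -> exists L, forall i, `|f i - L| <= r i.
Proof.
move=> h; pose A := [set x | exists i, x = f i - r i].
have ub j : ubound A (f j + r j).
  by move=> _ [i ->]; have := h i j; rewrite ler_norml => /andP[_]; lra.
have hA : has_sup A by split; [exists (f i0 - r i0), i0 | exists (f i0 + r i0); apply: ub].
exists (sup A) => i; rewrite ler_norml.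
have : sup A <= f i + r i by apply: ge_sup (ub i); exists (f i0 - r i0), i0.
have : f i - r i <= sup A by apply: ub_le_sup; [case: hA | exists i].
lra.
Qed.

(** The bound is tested only for small e, where points of a punctured disc are available. *)
Lemma le_of_le_addeps (x y K d : R) : 0 < d ->
  (forall e, 0 < e -> e < d -> x <= y + K * e) -> x <= y.
Proof.
move=> d0 h; apply/ler_addgt0Pr => e e0; pose c := Num.min (d / 2) (e / (`|K| + 1)).
have K1 : 0 < `|K| + 1 by rewrite ltr_wpDl.
have c0 : 0 < c by rewrite lt_min !divr_gt0.
have cd : c < d by rewrite gt_min; apply/orP; left; lra.
apply: le_trans (h c c0 cd) _; rewrite lerD2l.
apply: (@le_trans _ _ ((`|K| + 1) * c)).
  by rewrite ler_pM2r // (le_trans (ler_norm _)) // lerDl.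
by rewrite mulrC -ler_pdivlMr // ge_min lexx orbT.
Qed.

Lemma cn_real (e : R) : 0 <= e -> cn e%:C = e.
Proof. by move=> e0; rewrite /cn /= normr0 addr0 ger0_norm. Qed.

Lemma is_derive_approx (f : R -> R) (x d : R) :
  (forall e, 0 < e -> exists2 r, 0 < r &
     forall h, `|h| < r -> `|f (x + h) - f x - h * d| <= e * `|h|) ->
  is_derive x 1 f d.
Proof.
move=> H.
have key : h^-1 *: ((f \o shift x) (h *: (1 : R)) - f x) @[h --> (0 : R)^'] --> d.
  apply/cvgrPdist_le => e e0; have [r r0 hr] := H e e0.
  near=> h.
  have h0 : h != 0 by near: h; exact: nbhs_dnbhs_neq.
  have hlt : `|h| < r by near: h; apply: dnbhs0_lt.
  have := hr h hlt; rewrite /= /GRing.scale /= mulr1 [h + x]addrC => le1.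
  rewrite -(@ler_pM2r _ `|h|) ?normr_gt0 // -normrM; apply: le_trans le1.
  rewrite le_eqVlt; apply/orP; left; apply/eqP; rewrite -normrN; congr `|_|.
  by field.
have [] // : derivable f x 1 /\ 'D_1 f x = d.
  split; first by apply/cvg_ex; exists d.
  exact/cvg_lim.
Unshelve. all: by end_near.
Qed.

Lemma derive_approx (f : R -> R) (x d e : R) : is_derive x 1 f d -> 0 < e ->
  exists2 r, 0 < r & forall h, `|h| < r -> `|f (x + h) - f x - h * d| <= e * `|h|.
Proof.
move=> [hc hd] e0.
have key : h^-1 *: ((f \o shift x) (h *: (1 : R)) - f x) @[h --> (0 : R)^'] --> d.
  by rewrite -hd; exact: hc.
have /cvgrPdist_le/(_ e e0) [r /= r0 hr] := key.
exists r => // h hlt; have [->|h0] := eqVneq h 0.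
  by rewrite addr0 subrr mul0r subrr normr0 mulr0.
have := hr h; rewrite /= sub0r normrN => /(_ hlt h0).
rewrite /GRing.scale /= mulr1 [h + x]addrC => le1.
rewrite -(@ler_pM2r _ `|h|) ?normr_gt0 // -normrM in le1; apply: le_trans le1.
rewrite le_eqVlt; apply/orP; left; apply/eqP; rewrite -normrN; congr `|_|.
by field.
Qed.

Variable n : nat.
Local Notation M := 'M[C]_n.
Lemma mder_approx (F : R -> M) x D :
  (forall e, 0 < e -> exists2 r, 0 < r & forall h, `|h| < r ->
     mn (F (x + h) - F x - (h%:C) *: D) <= e * `|h|) -> mder F x D.
Proof.
move=> H i j; split; apply: is_derive_approx => e /H[r r0 hr]; exists r => // h /hr;
  apply: le_trans; apply: le_trans (cn_le_mn _ i j).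
  by apply: le_trans (Re_le_cn _); rewrite !mxE !cpartE /= mul0r subr0.
by apply: le_trans (Im_le_cn _); rewrite !mxE !cpartE /= mul0r addr0.
Qed.

Lemma approx_mder (F : R -> M) x D e : mder F x D -> 0 < e ->
  exists2 r, 0 < r & forall h, `|h| < r ->
     mn (F (x + h) - F x - (h%:C) *: D) <= e * `|h|.
Proof.
move=> H e0.
pose m : R := (n * n)%:R * 2 + 1.
have m0 : 0 < m by rewrite ltr_wpDl // mulr_ge0.
pose e' := e / m; have e'0 : 0 < e' by rewrite divr_gt0.
have rP i j : exists r, 0 < r /\ forall h, `|h| < r ->
    cn ((F (x + h) - F x - (h%:C) *: D) i j) <= 2 * e' * `|h|.
  have [h1 h2] := H i j.
  have [r1 r10 hr1] := derive_approx h1 e'0; have [r2 r20 hr2] := derive_approx h2 e'0.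
  exists (Num.min r1 r2); split; first by rewrite lt_min r10.
  move=> h; rewrite lt_min => /andP[/hr1 k1 /hr2 k2].
  rewrite /cn mulrDl mul1r mulrDl; apply: lerD.
    by apply: le_trans k1; rewrite !mxE !cpartE /= mul0r subr0.
  by apply: le_trans k2; rewrite !mxE !cpartE /= mul0r addr0.
have [r hr] := choice (fun ij : 'I_n * 'I_n => rP ij.1 ij.2).
exists (\big[Num.min/1]_ij r ij).
  by apply: (big_ind (fun x : R => 0 < x)) => [|u v u0 v0|ij _]; [exact: ltr01 | rewrite lt_min u0 | have [] := hr ij].
move=> h hlt; apply: (@le_trans _ _ ((n * n)%:R * (2 * e' * `|h|))).
  apply: mn_le => i j; have [_] := hr (i, j); apply.
  by apply: lt_le_trans hlt _; apply: (bigmin_le_cond _ (j := (i, j))).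
rewrite !mulrA ler_wpM2r // /e' ?mulrA ler_pdivrMr // mulrC ler_pM2l //.
by rewrite lerDl.
Qed.

Variable l0 : C.
Implicit Types (F G : R -> C -> M) (d : R).

(** F is Lipschitz at the single parameter value l0, locally uniformly in s. *)
Definition ulip (d : R) (F : R -> C -> M) : Prop := forall T : R, exists2 K : R, 0 <= K &
  forall s l, `|s| <= T -> cn (l - l0) < d ->
    mn (F s l0) <= K /\ mn (F s l - F s l0) <= K * cn (l - l0).

Lemma cn_l00 : cn (l0 - l0) = 0. Proof. by rewrite subrr cn0. Qed.

Lemma ulip_bound d F : 0 < d -> ulip d F -> forall T : R, exists2 K : R, 0 <= K &
  forall s l, `|s| <= T -> cn (l - l0) < d -> mn (F s l) <= K.
Proof.
move=> d0 h T; have [K K0 hK] := h T; exists (K * d + K).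
  by rewrite addr_ge0 ?mulr_ge0 // ltW.
move=> s l sT ld; have [k1 k2] := hK s l sT ld.
rewrite -[F s l](subrK (F s l0)); apply: le_trans (mnD _ _) _.
by rewrite lerD // (le_trans k2) // ler_wpM2l // ltW.
Qed.

Lemma ulipW d d' F : d' <= d -> ulip d F -> ulip d' F.
Proof.
move=> dd h T; have [K K0 hK] := h T; exists K => // s l sT ld.
by apply: hK => //; apply: lt_le_trans ld dd.
Qed.

Lemma ulip_cst d (G : R -> M) : (forall T : R, exists K : R, forall s, `|s| <= T -> mn (G s) <= K) ->
  ulip d (fun s _ => G s).
Proof.
move=> h T; have [K hK] := h T; exists (Num.max 0 K); first by rewrite le_max lexx.
move=> s l sT _; split; first by rewrite le_max hK ?orbT.
by rewrite subrr mn0 mulr_ge0 ?cn_ge0 // le_max lexx.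
Qed.

Lemma ulip_at0 d F : 0 < d -> ulip d F -> ulip d (fun s _ => F s l0).
Proof.
move=> d0 h; apply: ulip_cst => T; have [K _ hK] := h T; exists K => s sT.
by have [] := hK s l0 sT; rewrite // cn_l00.
Qed.

Lemma ulipD d F G : ulip d F -> ulip d G -> ulip d (fun s l => F s l + G s l).
Proof.
move=> hF hG T; have [K K0 hK] := hF T; have [L L0 hL] := hG T.
exists (K + L); first exact: addr_ge0.
move=> s l sT ld; have [k1 k2] := hK s l sT ld; have [l1 l2] := hL s l sT ld.
split; first by apply: le_trans (mnD _ _) _; apply: lerD.
rewrite opprD addrACA mulrDl; apply: le_trans (mnD _ _) _; exact: lerD.
Qed.

Lemma ulipM d F G : 0 < d -> ulip d F -> ulip d G -> ulip d (fun s l => F s l *m G s l).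
Proof.
move=> d0 hF hG T; have [K K0 hK] := hF T; have [L L0 hL] := hG T.
have [B B0 hB] := ulip_bound d0 hG T.
exists (K * L + K * B + K * L); first by rewrite !addr_ge0 ?mulr_ge0.
move=> s l sT ld; have [k1 k2] := hK s l sT ld; have [l1 l2] := hL s l sT ld.
have b := hB s l sT ld; split.
  apply: le_trans (mnM _ _) _; apply: (@le_trans _ _ (K * L)).
    by apply: ler_pM => //; apply: mn_ge0.
  by rewrite lerDr addr_ge0 ?mulr_ge0.
have -> : F s l *m G s l - F s l0 *m G s l0 =
    (F s l - F s l0) *m G s l + F s l0 *m (G s l - G s l0).
  by rewrite mulmxBl mulmxBr addrA subrK.
apply: le_trans (mnD _ _) _; rewrite !mulrDl -addrA ler_wpDl //.
  by rewrite mulr_ge0 ?cn_ge0 ?mulr_ge0.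
apply: lerD.
  apply: le_trans (mnM _ _) _; rewrite mulrAC.
  by apply: ler_pM => //; apply: mn_ge0.
apply: le_trans (mnM _ _) _; rewrite -mulrA.
by apply: ler_pM => //; apply: mn_ge0.
Qed.

Lemma ulipZ d F : 0 < d -> ulip d F -> ulip d (fun s l => (l - l0) *: F s l).
Proof.
move=> d0 hF T; have [B B0 hB] := ulip_bound d0 hF T; exists B => // s l sT ld.
rewrite subrr scale0r mn0 subr0; split=> //.
apply: le_trans (mnZ _ _) _; rewrite mulrC ler_wpM2r ?cn_ge0 // hB //.
Qed.

Lemma ulip_ext d F G : (forall s l, cn (l - l0) < d -> F s l = G s l) -> 0 < d ->
  ulip d F -> ulip d G.
Proof.
move=> e d0 h T; have [K K0 hK] := h T; exists K => // s l sT ld.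
by rewrite -!e ?cn_l00 //; apply: hK.
Qed.

(** A family of solutions of D' = D A + N_l with l <> l0 extends to l = l0. By Gronwall's
    inequality it is a Cauchy family with rate O(|l - l0| + |m - l0|), locally uniformly in
    s, and the same holds for the s-derivatives; hence the pointwise limit is
    differentiable and solves the limiting equation. Only bounds for the coefficients
    enter, and no integral is taken. *)
Lemma limit_ode (d : R) (D : R -> C -> M) (A : R -> M) (N H : R -> C -> M) :
  0 < d ->
  (forall l s, l != l0 -> cn (l - l0) < d ->
     mder (D^~ l) s (D s l *m A s + N s l)) ->
  (forall T : R, exists K : R, forall s, `|s| <= T -> mn (A s) <= K) ->
  ulip d N -> ulip d H ->
  (forall l, l != l0 -> cn (l - l0) < d -> D 0 l = H 0 l) ->
  exists D' : R -> C -> M,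
  [/\ forall s l, l != l0 -> cn (l - l0) < d -> D' s l = D s l,
      forall l, cn (l - l0) < d -> D' 0 l = H 0 l,
      forall l s, cn (l - l0) < d -> mder (D'^~ l) s (D' s l *m A s + N s l)
    & ulip d D'].
Proof.
move=> d0 hD hA hN hH init.
pose I := {l : C | l != l0 /\ cn (l - l0) < d}.
pose r (i : I) := cn (sval i - l0).
have r_gt0 i : 0 < r i by rewrite cn_gt0 subr_eq0; case: (svalP i).
have r_lt i : r i < d by case: (svalP i).
(* the index set I has members at every small distance from l0 *)
have small e : 0 < e -> e < d -> exists i : I, r i = e.
  move=> e0 ed.
  have e1 : l0 + e%:C != l0.
    by rewrite -subr_eq0 addrC addKr; apply: contraTneq e0 => -[->]; rewrite ltxx.
  have e2 : cn (l0 + e%:C - l0) < d by rewrite addrC addKr cn_real // ltW.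
  by exists (exist _ (l0 + e%:C) (conj e1 e2)); rewrite /r /= addrC addKr cn_real // ltW.
have [i0 _] : exists i : I, r i = d / 2 by apply: small; lra.
pose DD (i : I) s := D s (sval i); pose NN (i : I) s := N s (sval i).
have hDD i s : mder (DD i) s (DD i s *m A s + NN i s).
  by apply: hD; case: (svalP i).
have cauchy T : exists2 K : R, 0 <= K & forall s i j, `|s| <= T ->
    mn (DD i s - DD j s) <= K * r i + K * r j.
  have [KA' hKA'] := hA T; pose KA := Num.max 0 KA'.
  have KA0 : 0 <= KA by rewrite le_max lexx.
  have hKA s : `|s| <= T -> mn (A s) <= KA by move=> sT; rewrite le_max hKA' ?orbT.
  have [KN KN0 hKN] := hN T; have [KH KH0 hKH] := hH 0.
  have [G G0 hG] := @mn_gronwall R n T KA KA0.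
  exists (G * (KH + KN)); first by rewrite mulr_ge0 ?addr_ge0.
  move=> s i j sT; have [il0 id] := svalP i; have [jl0 jd] := svalP j.
  pose b := KN * r i + KN * r j.
  have b0 : 0 <= b by rewrite addr_ge0 ?mulr_ge0 ?cn_ge0.
  have lipB (F : R -> C -> M) K' x : (forall l, cn (l - l0) < d -> mn (F x l - F x l0) <= K' * cn (l - l0)) ->
      mn (F x (sval i) - F x (sval j)) <= K' * r i + K' * r j.
    move=> hF; have -> : F x (sval i) - F x (sval j) =
        (F x (sval i) - F x l0) - (F x (sval j) - F x l0) by rewrite opprB addrA subrK.
    by apply: le_trans (mnB _ _) _; apply: lerD; apply: hF.
  apply: le_trans (hG (fun s => DD i s - DD j s) _ b b0 (fun x => mderB (hDD i x) (hDD j x)) _ s sT) _.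
    move=> x xT.
    have -> : DD i x *m A x + NN i x - (DD j x *m A x + NN j x) =
       (DD i x - DD j x) *m A x + (NN i x - NN j x) by rewrite mulmxBl opprD addrACA.
    apply: le_trans (mnD _ _) _; apply: lerD.
      by apply: le_trans (mnM _ _) _; rewrite mulrC ler_wpM2r ?mn_ge0 // hKA.
    by apply: lipB => l ld; have [] := hKN x l xT ld.
  have : mn (DD i 0 - DD j 0) <= KH * r i + KH * r j.
    rewrite /DD !init //; apply: (lipB H) => l ld.
    by have [] := hKH 0 l _ ld; rewrite ?normr0.
  move=> h0; rewrite -!mulrA -mulrDr ler_wpM2l // /b.
  by apply: le_trans (lerD h0 (lexx _)) _; rewrite le_eqVlt; apply/orP; left; apply/eqP; ring.
have limP s : exists L : M, forall T, `|s| <= T -> exists2 K : R, 0 <= K &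
    forall i, mn (DD i s - L) <= K * r i.
  have [K K0 hK] := cauchy `|s|.
  have ex k l : exists z : C, forall i, cn (DD i s k l - z) <= 2 * (K * r i).
    have [x hx] : exists x, forall i, `|complex.Re (DD i s k l) - x| <= K * r i.
      apply: (common_limit i0) => i j; apply: le_trans (hK s i j (lexx _)).
      apply: le_trans (cn_le_mn _ k l); apply: le_trans (Re_le_cn _).
      by rewrite !mxE !cpartE.
    have [y hy] : exists x, forall i, `|complex.Im (DD i s k l) - x| <= K * r i.
      apply: (common_limit i0) => i j; apply: le_trans (hK s i j (lexx _)).
      apply: le_trans (cn_le_mn _ k l); apply: le_trans (Im_le_cn _).
      by rewrite !mxE !cpartE.
    exists (x +i* y) => i; rewrite /cn !cpartE /= mulrDl mul1r lerD //.
  have [z hz] := choice (fun kl : 'I_n * 'I_n => ex kl.1 kl.2).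
  exists (\matrix_(k, l) z (k, l)) => T _; exists ((n * n)%:R * (2 * K)).
    by rewrite !mulr_ge0.
  move=> i; rewrite -!mulrA; apply: mn_le => k l.
  by rewrite !mxE; apply: (hz (k, l)).
have [L hL] := choice limP.
have close T : exists2 K : R, 0 <= K & forall s i, `|s| <= T -> mn (DD i s - L s) <= K * r i.
  have [K K0 hK] := cauchy T; exists K => // s i sT.
  have [K' K'0 hK'] := hL s `|s| (lexx _).
  apply: (@le_of_le_addeps _ _ (K + K') d) => // e e0 ed.
  have [j rj] := small e e0 ed.
  rewrite -(subrK (DD j s) (DD i s)) -addrA mulrDl [leRHS]addrA -rj.
  by apply: le_trans (mnD _ _) _; apply: lerD; [exact: hK | exact: hK'].
have derL s : mder L s (L s *m A s + N s l0).
  pose T := `|s| + 1.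
  have sT : `|s| <= T by rewrite lerDl.
  have [K K0 hK] := close T; have [Kc Kc0 hKc] := cauchy T.
  have [KA' hKA'] := hA T; pose KA := Num.max 0 KA'.
  have KA0 : 0 <= KA by rewrite le_max lexx.
  have hKA x : `|x| <= T -> mn (A x) <= KA by move=> xT; rewrite le_max hKA' ?orbT.
  have [KN KN0 hKN] := hN T.
  have hN' i x : `|x| <= T -> mn (NN i x - N x l0) <= KN * r i.
    by move=> xT; have [] := hKN x (sval i) xT (r_lt i).
  pose W := Kc * KA + KN; have W0 : 0 <= W by rewrite addr_ge0 ?mulr_ge0.
  pose m : R := (n * n)%:R; have m0 : 0 <= m by [].
  (* the increment of DD i - L is controlled through DD i - DD j as j tends to l0 *)
  have dif i x y : `|x| <= T -> `|y| <= T ->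
      mn ((DD i x - L x) - (DD i y - L y)) <= m * (2 * (W * r i)) * `|x - y|.
    move=> xT yT.
    apply: (@le_of_le_addeps _ _ (m * (2 * W) * `|x - y| + K + K) d) => // e e0 ed.
    have [j rj] := small e e0 ed.
    have -> : (DD i x - L x) - (DD i y - L y) =
        ((DD i x - DD j x) - (DD i y - DD j y)) + ((DD j x - L x) - (DD j y - L y)).
      apply/matrixP => k l; rewrite !mxE; ring.
    apply: le_trans (mnD _ _) _.
    have step1 : mn ((DD i x - DD j x) - (DD i y - DD j y)) <= m * (2 * (W * r i + W * r j)) * `|x - y|.
      apply: (mn_mvt (F := fun s => DD i s - DD j s) (fun x => mderB (hDD i x) (hDD j x))) xT yT.
      move=> u uT.
      have -> : DD i u *m A u + NN i u - (DD j u *m A u + NN j u) =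
       (DD i u - DD j u) *m A u + ((NN i u - N u l0) - (NN j u - N u l0)).
        rewrite mulmxBl; move: (DD i u *m A u) (DD j u *m A u) => P1 P2.
        by apply/matrixP => k l; rewrite !mxE; ring.
      apply: le_trans (mnD _ _) _; rewrite /W !mulrDl addrACA; apply: lerD.
        apply: le_trans (mnM _ _) _; rewrite ![Kc * KA * _]mulrAC -mulrDl.
        by apply: ler_pM; rewrite ?mn_ge0 ?hKc ?hKA.
      by apply: le_trans (mnB _ _) _; apply: lerD; apply: hN'.
    have step2 : mn ((DD j x - L x) - (DD j y - L y)) <= K * r j + K * r j.
      by apply: le_trans (mnB _ _) _; apply: lerD; apply: hK.
    apply: le_trans (lerD step1 step2) _; rewrite rj le_eqVlt; apply/orP; left; apply/eqP; ring.
  apply: mder_approx => e e0.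
  pose Q := m * (2 * W) + K * KA + KN + 1.
  have Q0 : 0 < Q by rewrite ltr_wpDl // !addr_ge0 // !mulr_ge0.
  pose rho := Num.min (d / 2) (e / 2 / Q).
  have rho0 : 0 < rho by rewrite lt_min !divr_gt0.
  have rhod : rho < d by rewrite gt_min; apply/orP; left; lra.
  have [i ri] := small rho rho0 rhod.
  have e2 : 0 < e / 2 by rewrite divr_gt0.
  have [r1 r10 hr1] := approx_mder (hDD i s) e2.
  exists (Num.min 1 r1); first by rewrite lt_min ltr01.
  move=> h; rewrite lt_min => /andP[h1 hr].
  have shT : `|s + h| <= T by rewrite (le_trans (ler_normD _ _)) // lerD2l ltW.
  have -> : L (s + h) - L s - h%:C *: (L s *m A s + N s l0) =
      (DD i (s + h) - DD i s - h%:C *: (DD i s *m A s + NN i s))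
      - ((DD i (s + h) - L (s + h)) - (DD i s - L s))
      + h%:C *: ((DD i s - L s) *m A s + (NN i s - N s l0)).
    rewrite mulmxBl; apply/matrixP => k l.
    move: (DD i s *m A s) (L s *m A s) => P1 P2; rewrite !mxE; ring.
  apply: le_trans (mnD _ _) _.
  have t1 := hr1 h hr.
  have t2 : mn ((DD i (s + h) - L (s + h)) - (DD i s - L s)) <= m * (2 * (W * r i)) * `|h|.
    by have := dif i (s + h) s shT sT; rewrite addrC [s + h - s]addrAC subrr add0r addrC.
  have t3 : mn (h%:C *: ((DD i s - L s) *m A s + (NN i s - N s l0))) <= `|h| * ((K * KA + KN) * r i).
    apply: le_trans (mnZ _ _) _.
    have -> : cn h%:C = `|h| by rewrite /cn /= normr0 addr0.
    rewrite ler_wpM2l // mulrDl; apply: le_trans (mnD _ _) _; apply: lerD; last exact: hN'.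
    by apply: le_trans (mnM _ _) _; rewrite mulrAC; apply: ler_pM; rewrite ?mn_ge0 ?hK ?hKA.
  apply: le_trans (lerD (mnB _ _) t3) _; apply: le_trans (lerD (lerD t1 t2) (lexx _)) _.
  have -> : e / 2 * `|h| + m * (2 * (W * r i)) * `|h| + `|h| * ((K * KA + KN) * r i) =
     (e / 2 + (m * (2 * W) + K * KA + KN) * r i) * `|h| by ring.
  rewrite ler_wpM2r //.
  suff : (m * (2 * W) + K * KA + KN) * r i <= e / 2 by lra.
  apply: (@le_trans _ _ (Q * rho)).
    by rewrite ri ler_wpM2r ?(ltW rho0) // /Q lerDl.
  by rewrite mulrC -ler_pdivlMr // ge_min lexx orbT.
exists (fun s l => if l == l0 then L s else D s l); split.
- by move=> s l /negPf ->.
- move=> l ld; case: eqVneq => [->|/init]; last exact.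
  have [K K0 hK] := close 0; have [KH KH0 hKH] := hH 0.
  suff : mn (L 0 - H 0 l0) <= 0.
    move=> h; apply/eqP; rewrite -subr_eq0; apply/eqP/matrixP => k j; rewrite [RHS]mxE.
    apply/eqP; rewrite -cn_eq0 eq_le cn_ge0 andbT.
    exact: le_trans (cn_le_mn _ k j) h.
  apply: (@le_of_le_addeps _ _ (K + KH) d) => // e e0 ed; have [i ri] := small e e0 ed.
  rewrite -(subrK (DD i 0) (L 0)) -addrA add0r mulrDl -ri.
  apply: le_trans (mnD _ _) _; apply: lerD.
    by rewrite -mnN opprB; apply: hK; rewrite normr0.
  rewrite /DD init; try by case: (svalP i).
  by have [] := hKH 0 (sval i) _ (r_lt i); rewrite ?normr0.
- move=> l s ld; case: eqVneq => [->|ll0]; first exact: derL.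
  exact: hD.
- move=> T; have [K K0 hK] := close T.
  have [BN BN0 hBN] := ulip_bound d0 hN T.
  have [b hb] : exists b, forall s, `|s| <= T -> mn (L s) <= b.
    have [KA' hKA'] := hA T; pose KA := Num.max 0 KA'.
    have KA0 : 0 <= KA by rewrite le_max lexx.
    have [G G0 hG] := @mn_gronwall R n T KA KA0.
    exists (G * (mn (L 0) + BN)); apply: hG derL _ => // s sT.
    apply: le_trans (mnD _ _) _; apply: lerD; last by apply: hBN; rewrite ?cn_l00.
    apply: le_trans (mnM _ _) _; rewrite mulrC ler_wpM2r ?mn_ge0 //.
    by rewrite le_max hKA' ?orbT.
  exists (Num.max K b); first by rewrite le_max K0.
  move=> s l sT ld; rewrite eqxx; split; first by rewrite le_max hb ?orbT.
  case: eqVneq => [->|ll0]; first by rewrite subrr mn0 cn_l00 mulr0.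
  have := hK s (exist _ l (conj ll0 ld)) sT; rewrite /DD /r /= => /le_trans; apply.
  by rewrite ler_wpM2r ?cn_ge0 // le_max lexx.
Qed.

End Limits.
(** * Divided differences in the spectral parameter *)

Section Jets.
Variable R : realType.
Local Notation C := R[i].
Variable n : nat.
Local Notation M := 'M[C]_n.
Variable l0 : C.
Implicit Types (F G : R -> C -> M) (d : R).

Definition quotient_of d F F1 :=
  forall s l, cn (l - l0) < d -> F s l = F s l0 + (l - l0) *: F1 s l.

(** F1 is the divided difference (F l - F l0) / (l - l0), F2 the divided difference of F1,
    both extended to l = l0. Dressing divides the frame by l - z once and the result has to
    be differentiable at z, so one divided difference beyond the derivative is carried. *)
Record jet d F F1 F2 : Prop := Jet {
  jet_quo1 : quotient_of d F F1;
  jet_quo2 : quotient_of d F1 F2;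
  jet_lip0 : ulip l0 d F;
  jet_lip1 : ulip l0 d F1;
  jet_lip2 : ulip l0 d F2 }.

Definition has_jet F := exists d F1 F2, 0 < d /\ jet d F F1 F2.

Lemma jetW d d' F F1 F2 : d' <= d -> jet d F F1 F2 -> jet d' F F1 F2.
Proof.
move=> dd [q1 q2 h0 h1 h2]; split; try exact: ulipW dd _.
  by move=> s l ld; apply: q1; apply: lt_le_trans dd.
by move=> s l ld; apply: q2; apply: lt_le_trans dd.
Qed.

Definition locally_bounded (G : R -> M) :=
  forall T : R, exists K : R, forall s, `|s| <= T -> mn (G s) <= K.

Lemma locally_bounded_cst (A : M) : locally_bounded (fun=> A).
Proof. by move=> T; exists (mn A). Qed.

Lemma jet_cst d (G : R -> M) : locally_bounded G -> jet d (fun s _ => G s) (fun _ _ => 0) (fun _ _ => 0).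
Proof.
have h0 : ulip l0 d (fun _ _ => (0 : M)) by exact: ulip_cst (locally_bounded_cst 0).
move=> h; split=> // [s l _|s l _|]; try by rewrite scaler0 addr0.
exact: ulip_cst.
Qed.

Lemma has_jet_cst (G : R -> M) : locally_bounded G -> has_jet (fun s _ => G s).
Proof. by move=> h; exists 1, (fun _ _ => 0), (fun _ _ => 0); split=> //; apply: jet_cst. Qed.

Lemma quotient_lip d F F1 : 0 < d -> quotient_of d F F1 -> locally_bounded (F^~ l0) ->
  ulip l0 d F1 -> ulip l0 d F.
Proof.
move=> d0 q b h.
have e s l : cn (l - l0) < d -> F s l0 + (l - l0) *: F1 s l = F s l by move=> ld; rewrite -q.
apply: (ulip_ext e d0); apply: ulipD; last exact: ulipZ.
exact: ulip_cst.
Qed.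

Lemma jetD d F F1 F2 G G1 G2 : jet d F F1 F2 -> jet d G G1 G2 ->
  jet d (fun s l => F s l + G s l) (fun s l => F1 s l + G1 s l) (fun s l => F2 s l + G2 s l).
Proof.
move=> [q1 q2 h0 h1 h2] [p1 p2 k0 k1 k2]; split; try exact: ulipD.
  by move=> s l ld; rewrite q1 // p1 // scalerDr addrACA.
by move=> s l ld; rewrite q2 // p2 // scalerDr addrACA.
Qed.

Lemma jetM d F F1 F2 G G1 G2 : 0 < d -> jet d F F1 F2 -> jet d G G1 G2 ->
  jet d (fun s l => F s l *m G s l)
    (fun s l => F1 s l *m G s l + F s l0 *m G1 s l)
    (fun s l => F2 s l *m G s l + F1 s l0 *m G1 s l + F s l0 *m G2 s l).
Proof.
move=> d0 [q1 q2 h0 h1 h2] [p1 p2 k0 k1 k2]; split.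
- move=> s l ld; rewrite (q1 s l ld) (p1 s l ld); exact: mulmx_increment.
- move=> s l ld; rewrite (q2 s l ld) (p1 s l ld) (p2 s l ld); exact: mulmx_increment2.
- exact: ulipM.
- apply: ulipD; apply: ulipM => //; exact: ulip_at0.
- by apply: ulipD; [apply: ulipD|]; apply: ulipM => //; apply: ulip_at0.
Qed.

Lemma has_jetD F G : has_jet F -> has_jet G -> has_jet (fun s l => F s l + G s l).
Proof.
move=> [d [F1 [F2 [d0 h]]]] [e [G1 [G2 [e0 k]]]]; exists (Num.min d e).
do 2!eexists; split; first by rewrite lt_min d0.
apply: jetD; [apply: jetW h | apply: jetW k]; by rewrite ge_min lexx ?orbT.
Qed.

Lemma has_jetM F G : has_jet F -> has_jet G -> has_jet (fun s l => F s l *m G s l).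
Proof.
move=> [d [F1 [F2 [d0 h]]]] [e [G1 [G2 [e0 k]]]]; exists (Num.min d e).
do 2!eexists; split; first by rewrite lt_min d0.
apply: jetM; [by rewrite lt_min d0 | apply: jetW h | apply: jetW k]; by rewrite ge_min lexx ?orbT.
Qed.

Lemma has_jet_ext F G : (forall s l, F s l = G s l) -> has_jet F -> has_jet G.
Proof. by move=> e; have -> // : F = G by apply/funext => s; apply/funext. Qed.

Lemma has_jet_sum (I : Type) (r : seq I) (F : I -> R -> C -> M) :
  (forall i, has_jet (F i)) -> has_jet (fun s l => \sum_(i <- r) F i s l).
Proof.
move=> h; elim: r => [|i r IH].
  by apply: has_jet_ext (has_jet_cst (locally_bounded_cst 0)) => s l; rewrite big_nil.
by apply: has_jet_ext (has_jetD (h i) IH) => s l; rewrite big_cons.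
Qed.

Lemma jet_id d : 0 < d -> jet d (fun _ l => l%:M) (fun _ _ => 1%:M) (fun _ _ => 0).
Proof.
move=> d0; have h1 : ulip l0 d (fun _ _ => (1%:M : M)) by exact: ulip_cst (locally_bounded_cst _).
have q : quotient_of d (fun _ l => (l%:M : M)) (fun _ _ => 1%:M).
  by move=> s l _; rewrite scalemx1 -raddfD /= addrC subrK.
split.
- exact: q.
- by move=> s l _; rewrite scaler0 addr0.
- exact: (quotient_lip d0 q (locally_bounded_cst _) h1).
- exact: h1.
- exact: ulip_cst (locally_bounded_cst 0).
Qed.

Lemma has_jet_id : has_jet (fun _ l => l%:M).
Proof. by do 3!eexists; split; last exact: (jet_id ltr01). Qed.

Lemma has_jet_exp k : has_jet (fun _ l => (l ^+ k)%:M).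
Proof.
elim: k => [|k IH]; first exact: (has_jet_cst (locally_bounded_cst (1%:M))).
by apply: has_jet_ext (has_jetM has_jet_id IH) => s l; rewrite exprS scalar_mxM.
Qed.

(** The norm cn is not multiplicative: the factor 2 is lost here. *)
Lemma cnV (z : C) : z != 0 -> cn z^-1 * cn z <= 2.
Proof.
case: z => a b z0; rewrite /cn /=.
have N0 : 0 < a ^+ 2 + b ^+ 2.
  rewrite lt0r addr_ge0 ?sqr_ge0 // andbT; apply: contraNneq z0 => /eqP.
  by rewrite paddr_eq0 ?sqr_ge0 // !sqrf_eq0 => h; rewrite eq_complex.
rewrite ?(normrM, normrN, normfV) [`|a ^+ 2 + _|]gtr0_norm // -mulrDl mulrAC ler_pdivrMr //.
rewrite -expr2 -(real_normK (num_real a)) -(real_normK (num_real b)).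
have := sqr_ge0 (`|a| - `|b|); nra.
Qed.

Lemma has_jet_inv : l0 != 0 -> has_jet (fun _ l => (l^-1)%:M).
Proof.
move=> l00; pose d := cn l0 / 2.
have c0 : 0 < cn l0 by rewrite cn_gt0.
have d0 : 0 < d by rewrite divr_gt0.
have far l : cn (l - l0) < d -> d <= cn l.
  move=> ld; have : cn l0 <= cn l + cn (l - l0).
    by rewrite [X in cn X <= _](_ : l0 = l - (l - l0)) ?cnB //; ring.
  rewrite /d in ld *; lra.
have nz l : cn (l - l0) < d -> l != 0 by move=> /far; rewrite -cn_gt0; apply: lt_le_trans.
pose F (_ : R) l : M := (l^-1)%:M.
have hF : ulip l0 d F.
  move=> T; exists (mn (F 0 l0) + mn (1%:M : M) * (cn l0^-1 * (2 / d))).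
    by rewrite addr_ge0 ?mn_ge0 // !mulr_ge0 ?mn_ge0 ?cn_ge0 // ltW // invr_gt0.
  move=> s l _ ld; have l0' := nz l ld; split.
    by rewrite lerDl !mulr_ge0 ?mn_ge0 ?cn_ge0 // ltW // invr_gt0.
  have -> : F s l - F s l0 = (- (l^-1 * l0^-1 * (l - l0))) *: 1%:M.
    by rewrite scalemx1 /F -raddfB /=; congr _%:M; field; rewrite l0' l00.
  rewrite mulrDl ler_wpDl ?mulr_ge0 ?mn_ge0 ?cn_ge0 //.
  apply: le_trans (mnZ _ _) _; rewrite cnN -[leRHS]mulrA [leRHS]mulrC.
  rewrite ler_wpM2r ?mn_ge0 //; apply: le_trans (cnM _ _) _; rewrite ler_wpM2r ?cn_ge0 //.
  apply: le_trans (cnM _ _) _; rewrite mulrC ler_wpM2l ?cn_ge0 // ler_pdivlMr //.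
  apply: le_trans (cnV l0'); rewrite ler_wpM2l ?cn_ge0 //; exact: far.
have hc z : ulip l0 d (fun _ _ => (z%:M : M)) by exact: ulip_cst (locally_bounded_cst _).
exists d, (fun s l => (- l0^-1)%:M *m F s l), (fun s l => (l0^-2)%:M *m F s l).
split=> //; split=> //; try exact: ulipM.
  move=> s l /nz l0'; rewrite /F -scalar_mxM scale_scalar_mx -raddfD /=; congr _%:M.
  by field; rewrite l0' l00.
move=> s l /nz l0'; rewrite /F -!scalar_mxM scale_scalar_mx -raddfD /=; congr _%:M.
by field; rewrite l0' l00.
Qed.

(** The divided difference (Y l - Y l0) / (l - l0) solves D' = D A(l0) + Y(l) A1(l), and the
    divided difference of the latter solves an equation with the same linear part A(l0).
    Both extend to l = l0 by limit_ode. *)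
Lemma param_ode d (A A1 A2 Y H1 H2 : R -> C -> M) : 0 < d ->
  jet d A A1 A2 -> jet d (fun _ l => Y 0 l) H1 H2 ->
  (forall l s, cn (l - l0) < d -> mder (Y^~ l) s (Y s l *m A s l)) ->
  exists Y1 Y2, jet d Y Y1 Y2 /\
    forall l s, cn (l - l0) < d -> mder (Y1^~ l) s (Y1 s l *m A s l0 + Y s l *m A1 s l).
Proof.
move=> d0 [q1 q2 h0 h1 h2] [p1 p2 k0 k1 k2] ode.
have c00 : cn (l0 - l0) < d by rewrite cn_l00.
have bA : locally_bounded (A^~ l0).
  move=> T; have [K K0 hK] := h0 T; exists K => s sT.
  by have [] := hK s l0 sT c00.
have Yb T : exists2 K : R, 0 <= K & forall s l, `|s| <= T -> cn (l - l0) < d -> mn (Y s l) <= K.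
  have [K K0 hK] := ulip_bound d0 h0 T; have [G G0 hG] := @mn_gronwall R n T K K0.
  have [B B0 hB] := ulip_bound d0 k0 0; exists (G * (B + 0)); first by rewrite addr0 mulr_ge0.
  move=> s l sT ld; apply: le_trans (hG (Y^~ l) _ 0 (lexx _) (fun s => ode l s ld) _ s sT) _.
    move=> x xT; rewrite addr0; apply: le_trans (mnM _ _) _.
    by rewrite mulrC ler_wpM2r ?mn_ge0 // hK.
  by rewrite ler_wpM2l // lerD2r; apply: (hB 0) => //; rewrite normr0.
have Yl : ulip l0 d Y.
  move=> T; have [K K0 hK] := Yb T; have [L L0 hL] := h0 T.
  have [G G0 hG] := @mn_gronwall R n T L L0; have [I I0 hI] := k0 0.
  exists (K + G * (I + K * L)); first by rewrite addr_ge0 ?mulr_ge0 ?addr_ge0 ?mulr_ge0.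
  move=> s l sT ld; split.
    by apply: le_trans (hK s l0 sT c00) _; rewrite lerDl mulr_ge0 ?addr_ge0 ?mulr_ge0.
  pose b := K * L * cn (l - l0).
  have b0 : 0 <= b by rewrite !mulr_ge0 ?cn_ge0.
  apply: le_trans (hG (fun s => Y s l - Y s l0) _ b b0
    (fun s => mderB (ode l s ld) (ode l0 s c00)) _ s sT) _.
    move=> x xT; have -> : Y x l *m A x l - Y x l0 *m A x l0 =
        (Y x l - Y x l0) *m A x l0 + Y x l *m (A x l - A x l0).
      exact: mulmx_sub_split.
    apply: le_trans (mnD _ _) _; have [a1 a2] := hL x l xT ld; apply: lerD.
      by apply: le_trans (mnM _ _) _; rewrite mulrC ler_wpM2r ?mn_ge0.
    apply: le_trans (mnM _ _) _; rewrite /b -mulrA.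
    by apply: ler_pM; rewrite ?mn_ge0 // hK.
  rewrite mulrDl ler_wpDl ?mulr_ge0 ?cn_ge0 // -mulrA ler_wpM2l // mulrDl lerD //.
  by have [] := hI 0 l _ ld; rewrite ?normr0.
pose N1 s l := Y s l *m A1 s l.
have N1l : ulip l0 d N1 by exact: ulipM.
have quoK l (X Z : M) : l != l0 -> X + (l - l0) *: ((l - l0)^-1 *: (Z - X)) = Z.
  by move=> ll0; rewrite scalerA mulfV ?subr_eq0 // scale1r addrC subrK.
have [Y1 [Y1e Y1i Y1d Y1l]] : exists D' : R -> C -> M,
  [/\ forall s l, l != l0 -> cn (l - l0) < d -> D' s l = (l - l0)^-1 *: (Y s l - Y s l0),
      forall l, cn (l - l0) < d -> D' 0 l = H1 0 l,
      forall l s, cn (l - l0) < d -> mder (D'^~ l) s (D' s l *m A s l0 + N1 s l)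
    & ulip l0 d D'].
  apply: limit_ode => // [l s ll0 ld|l ll0 ld].
    apply: mder_ext (mderZ _ (mderB (ode l s ld) (ode l0 s c00))) _ _ => //.
    rewrite {1}q1 // -scalemxAl mulmxBl mulmxDr -scalemxAr /N1 addrAC scalerDr.
    by rewrite [X in _ + X]scalerA mulVf ?subr_eq0 // scale1r.
  by rewrite (p1 0 l ld) [_ + _ - Y 0 l0]addrAC subrr add0r scalerA mulVf ?subr_eq0 // scale1r.
have Y1q : quotient_of d Y Y1.
  move=> s l ld; have [->|ll0] := eqVneq l l0; first by rewrite subrr scale0r addr0.
  by rewrite Y1e // quoK.
pose N2 s l := Y1 s l *m A1 s l + Y s l0 *m A2 s l.
have N2l : ulip l0 d N2 by apply: ulipD; apply: ulipM => //; exact: ulip_at0.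
have [Y2 [Y2e Y2i Y2d Y2l]] : exists D' : R -> C -> M,
  [/\ forall s l, l != l0 -> cn (l - l0) < d -> D' s l = (l - l0)^-1 *: (Y1 s l - Y1 s l0),
      forall l, cn (l - l0) < d -> D' 0 l = H2 0 l,
      forall l s, cn (l - l0) < d -> mder (D'^~ l) s (D' s l *m A s l0 + N2 s l)
    & ulip l0 d D'].
  apply: limit_ode => // [l s ll0 ld|l ll0 ld].
    apply: mder_ext (mderZ _ (mderB (Y1d l s ld) (Y1d l0 s c00))) _ _ => //.
    have -> : N1 s l = N1 s l0 + (l - l0) *: N2 s l.
      rewrite /N1 /N2 (Y1q s l ld) (q2 s l ld); exact: mulmx_increment.
    rewrite opprD addrACA [_ + _ - N1 s l0]addrAC subrr add0r.
    rewrite -scalemxAl mulmxBl scalerDr; congr (_ + _).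
    by rewrite scalerA mulVf ?subr_eq0 // scale1r.
  by rewrite !Y1i // (p2 0 l ld) [_ + _ - H1 0 l0]addrAC subrr add0r scalerA mulVf ?subr_eq0 // scale1r.
exists Y1, Y2; split=> //; split=> //.
move=> s l ld; have [->|ll0] := eqVneq l l0; first by rewrite subrr scale0r addr0.
by rewrite Y2e // quoK.
Qed.

End Jets.
(** * Complex derivatives and finite exceptional sets *)

Section JetDerivable.
Variable R : realType.
Local Notation C := R[i].
Variable n : nat.
Local Notation M := 'M[C]_n.

Lemma quotient_derivable (l0 : C) d (F F1 : R -> C -> M) : 0 < d ->
  quotient_of l0 d F F1 -> ulip l0 d F1 ->
  forall s i j, derivable (fun l : C^o => F s l i j : C^o) l0 1.
Proof.
move=> d0 q lip s i j; have [K K0 hK] := lip `|s|.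
apply/cvg_ex; exists (F1 s l0 i j : C^o).
apply/cvgrPdist_le => e e0.
have [eR Ee] : exists r : R, e = r%:C.
  by have /complex_realP[r ->] := gtr0_real e0; exists r.
have r0 : 0 < eR by rewrite Ee ltcR in e0.
pose rho := Num.min (d / 2) (eR / (2 * (K + 1))).
have K1 : 0 < 2 * (K + 1) by rewrite mulr_gt0 // ltr_wpDl.
have rho0 : 0 < rho by rewrite lt_min !divr_gt0.
near=> h.
have h0 : h != 0 by near: h; exact: nbhs_dnbhs_neq.
have hlt : `|h| < (rho / 2)%:C by near: h; apply: dnbhs0_lt; rewrite ltcR divr_gt0.
have chr : cn (h : C) < rho.
  rewrite -ltcR; apply: le_lt_trans (cn_le_norm _) _.
  by rewrite [X in _ < X%:C](splitr rho) rmorphD mulr2n ltrD.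
have hd : cn ((h + l0) - l0 : C) < d.
  by rewrite addrK (lt_trans chr) // gt_min; apply/orP; left; lra.
have -> : h^-1 *: (((fun l : C^o => F s l i j : C^o) \o shift l0) (h *: (1 : C^o)) - F s l0 i j)
    = F1 s (h + l0) i j.
  by rewrite /= /GRing.scale /= mulr1 (q s (h + l0) hd) mxD_ij mxZ_ij addrK [F s l0 i j + _]addrC addrK mulKf.
have [_ k2] := hK s (h + l0) (lexx _) hd.
rewrite Ee; apply: le_trans (norm_le_cn _) _; rewrite lecR.
rewrite -cnN opprB; have := cn_le_mn (F1 s (h + l0) - F1 s l0) i j; rewrite !mxE => /le_trans; apply.
apply: le_trans k2 _; rewrite addrK; apply: (@le_trans _ _ (2 * (K + 1) * rho)).
  apply: ler_pM; rewrite ?cn_ge0 //; last exact: ltW.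
  by lra.
by rewrite mulrC -ler_pdivlMr // ge_min lexx orbT.
Unshelve. all: by end_near.
Qed.

Lemma finite_isolated (S : set C) (l0 : C) : finite_set S ->
  exists2 r : R, 0 < r & forall l, l != l0 -> cn (l - l0) < r -> ~ S l.
Proof.
move=> /finite_seqP[s ->]; elim: s => [|x s [r r0 IH]]; first by exists 1.
have [->|xl] := eqVneq x l0.
  exists r => // l ll0 lr; rewrite /= inE => /orP[/eqP e|]; first by rewrite e eqxx in ll0.
  exact: IH.
exists (Num.min r (cn (x - l0))); first by rewrite lt_min r0 cn_gt0 subr_eq0.
move=> l ll0; rewrite lt_min => /andP[lr lx]; rewrite /= inE => /orP[/eqP e|]; last exact: IH.
by rewrite e ltxx in lx.
Qed.

(** Points avoiding S are found on the horizontal line through l0, which is the real axis if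
    l0 is real; there the values of a group element are unitary. *)
Lemma near_point (S : set C) (l0 : C) (e : R) : finite_set S -> 0 < e ->
  exists r : R, [/\ 0 < r, r < e & ~ S (l0 + r%:C)].
Proof.
move=> fS e0; have [r r0 hr] := finite_isolated l0 fS.
pose d := Num.min r e / 2.
have m0 : 0 < Num.min r e by rewrite lt_min r0.
have d0 : 0 < d by rewrite divr_gt0.
have dm : d < Num.min r e by rewrite /d; lra.
move: (dm); rewrite lt_min => /andP[dr de].
exists d; split=> //; apply: hr; last by rewrite addrC addKr cn_real // ltW.
by rewrite -subr_eq0 addrC addKr; apply: contraTneq d0 => -[->]; rewrite ltxx.
Qed.

Lemma derivable_cn_continuous (f : C -> C) (l0 : C) :
  derivable (f : C^o -> C^o) l0 1 -> forall e : R, 0 < e ->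
  exists2 r : R, 0 < r & forall l, cn (l - l0) < r -> cn (f l - f l0) < e.
Proof.
move=> hf e e0.
have /differentiable_continuous : differentiable (f : C^o -> C^o) (l0 : C^o) by apply/derivable1_diffP.
move=> /cvgrPdist_lt/(_ (e / 2)%:C); rewrite ltcR divr_gt0 // => /(_ isT)[r /= r0 hr].
have /complex_realP[r' rE] := gtr0_real r0; rewrite rE ltcR in r0.
exists r' => // l lr; rewrite -ltcR; apply: le_lt_trans (cn_le_norm _) _.
rewrite [X in _ < X%:C](splitr e) rmorphD mulr2n.
have h : `|f l - f l0| < (e / 2)%:C.
  rewrite distrC; apply: hr; rewrite /ball_ /= rE distrC.
  by apply: le_lt_trans (norm_le_cn _) _; rewrite ltcR.
exact: ltrD.
Qed.

End JetDerivable.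
(** * The potential and its differential polynomials *)

Section Differential.
Variable R : realType.
Local Notation C := R[i].
Variable n : nat.
Local Notation M := 'M[C]_n.
Implicit Types (a b y z P : M) (v f : R -> M) (u : R -> R -> M).

Lemma adjM (A B : M) : (A *m B)^t* = B^t* *m A^t*.
Proof. by rewrite trmx_mul map_mxM. Qed.

Lemma adjD (A B : M) : (A + B)^t* = A^t* + B^t*.
Proof. by apply/matrixP => i j; rewrite !mxE rmorphD. Qed.

Lemma adjN (A : M) : (- A)^t* = - A^t*.
Proof. by apply/matrixP => i j; rewrite !mxE rmorphN. Qed.

Lemma adjZ (c : C) (A : M) : (c *: A)^t* = (c^*)%R *: A^t*.
Proof. by apply/matrixP => i j; rewrite !mxE rmorphM. Qed.

Lemma adj1 : (1%:M : M)^t* = 1%:M.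
Proof. by apply/matrixP => i j; rewrite !mxE rmorph_nat eq_sym. Qed.

Lemma adj0 : (0 : M)^t* = 0.
Proof. by apply/matrixP => i j; rewrite !mxE rmorph0. Qed.

Lemma adjK (A : M) : (A^t*)^t* = A.
Proof. by apply/matrixP => i j; rewrite !mxE conjCK. Qed.

Lemma lie_adj (A B : M) : u_n A -> (lie A B)^t* = lie A (B^t*).
Proof. by rewrite /u_n /lie => h; rewrite adjD adjN !adjM h; mx_ring. Qed.

(** Test against c E_ji + d E_ij for (c, d) = (1, -1) and (i, i): if a_ii = a_jj these are
    skew-Hermitian and commute with a. *)
Lemma perp_entry a (v : M) i j : is_diag_mx a -> centralizer_perp a v ->
  a i i = a j j -> v i j = 0.
Proof.
move=> /is_diag_mxP da [_ hv] aij.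
have comm (c d : C) : lie a (c *: delta_mx j i + d *: delta_mx i j) = 0.
  suff h k l : a k k = a l l -> lie a (delta_mx k l) = 0.
    have -> : lie a (c *: delta_mx j i + d *: delta_mx i j) =
       c *: lie a (delta_mx j i) + d *: lie a (delta_mx i j) := lie_linear_comb _ _ _ _ _.
    by rewrite !h // !scaler0 addr0.
  move=> kl; apply/matrixP => p q; rewrite !mxE.
  rewrite (bigD1 k) //= big1 ?addr0 => [|r rk]; last by rewrite mxE (negPf rk) mulr0.
  rewrite (bigD1 l) //= big1 ?addr0 => [|r rl]; last by rewrite mxE (negPf rl) andbF mul0r.
  rewrite !mxE !eqxx /= andbT; have [->|pk] := eqVneq p k; last first.
    by rewrite da ?mul0r ?subrr // eq_sym.
  have [->|ql] := eqVneq q l; first by rewrite mulr1 mul1r kl subrr.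
  by rewrite mulr0 mul1r da ?subrr // eq_sym.
have tr (c d : C) : \tr (v *m (c *: delta_mx j i + d *: delta_mx i j)) = c * v i j + d * v j i.
  rewrite mulmxDr -!scalemxAr mxtraceD !mxtraceZ; congr (_ * _ + _ * _).
    rewrite /mxtrace (bigD1 i) //= big1 ?addr0 => [|r ri].
      by rewrite mxE (bigD1 j) //= big1 ?addr0 ?mxE ?eqxx ?mulr1 // => r rj; rewrite mxE (negPf rj) mulr0.
    by rewrite mxE big1 // => k _; rewrite mxE (negPf ri) andbF mulr0.
  rewrite /mxtrace (bigD1 j) //= big1 ?addr0 => [|r rj].
    by rewrite mxE (bigD1 i) //= big1 ?addr0 ?mxE ?eqxx ?mulr1 // => r ri; rewrite mxE (negPf ri) mulr0.
  by rewrite mxE big1 // => k _; rewrite mxE (negPf rj) andbF mulr0.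
have adjd (c d : C) : (d^*)%R = - c -> u_n (c *: delta_mx j i + d *: delta_mx i j : M).
  move=> h; have h' : (c^*)%R = - d by rewrite -[d]conjCK h rmorphN opprK.
  rewrite /u_n adjD !adjZ h h'; apply/matrixP => p q; rewrite !mxE !rmorph_nat.
  by rewrite ![(q == _) && _]andbC; ring.
have e1 : 1 * v i j + (-1) * v j i = 0.
  by rewrite -tr; apply: hv; split; [apply: adjd; rewrite rmorphN rmorph1 | exact: comm].
have e2 : 'i * v i j + 'i * v j i = 0.
  by rewrite -tr; apply: hv; split; [apply: adjd; apply: complex_ext; rewrite /= ?oppr0 | exact: comm].
have i0 : ('i : C) != 0 by rewrite eq_complex /= oner_eq0 andbF.
move: e2; rewrite -mulrDr => /eqP; rewrite mulf_eq0 (negPf i0) /= => /eqP e2.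
have : 2 * v i j = 0.
  have -> : 2 * v i j = (1 * v i j + (-1) * v j i) + (v i j + v j i) by ring.
  by rewrite e1 e2 addr0.
by move/eqP; rewrite mulf_eq0 pnatr_eq0 /= => /eqP.
Qed.

Lemma iter_mderive_partial u (k : nat) t :
  iter k (@mderive R n) (u^~ t) = (foldr (fun c : bool => if c then @partial_x R n else @partial_t R n) u (nseq k true))^~ t.
Proof. by elim: k => //= k ->. Qed.

Lemma smooth2_x u t : smooth2 u -> smooth1 (u^~ t).
Proof.
move=> h k x; rewrite iter_mderive_partial.
by have [_ hx _] := h (nseq k true); apply: hx.
Qed.

Lemma segment_bounded (f : R -> R) (T : R) : continuous f ->
  exists K, forall s, `|s| <= T -> `|f s| <= K.
Proof.
move=> cf; have [T0|T0] := leP 0 T; last first.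
  by exists 0 => s sT; have := le_lt_trans sT T0; rewrite ltNge normr_ge0.
have TT : - T <= T by lra.
have cw (g : R -> R) : continuous g -> {within `[- T, T], continuous g} by move=> ?; exact: continuous_subspaceT.
have [c _ hc] := EVT_max TT (cw f cf).
have [d _ hd] := EVT_min TT (cw f cf).
exists (`|f c| + `|f d|) => s; rewrite ler_norml => sT.
have k1 := hc s; have k2 := hd s; rewrite in_itv /= sT in k1 k2.
have := k1 isT; have := k2 isT; have := ler_norm (f c); have := lerNnormlW (lexx `|f d|).
have := normr_ge0 (f c); have := normr_ge0 (f d).
by rewrite ler_norml => *; apply/andP; split; lra.
Qed.

Lemma jet_x_bounded u (k : nat) t : smooth2 u ->
  locally_bounded (fun x => iter k (@mderive R n) (u^~ t) x).
Proof.
move=> h T; rewrite iter_mderive_partial.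
have [c _ _] := h (nseq k true).
set d := foldr _ _ _ in c *.
have b i j : exists K, forall s, `|s| <= T -> cn (d s t i j) <= K.
  have [c1 c2] := c i j.
  have cp (f : R * R -> R) : continuous f -> continuous (fun x => f (x, t)).
    move=> cf x; apply: (@continuous_comp _ _ _ (fun x => (x, t)) f); last exact: cf.
    by apply: (@cvg_pair _ _ _ _ (nbhs x) (nbhs t)); [exact: cvg_id | exact: cvg_cst].
  have [K1 h1] := segment_bounded T (cp _ c1).
  have [K2 h2] := segment_bounded T (cp _ c2).
  by exists (K1 + K2) => s sT; rewrite /cn lerD //; [exact: h1 | exact: h2].
have [K hK] := choice (fun ij : 'I_n * 'I_n => b ij.1 ij.2).
exists (\sum_i \sum_j K (i, j)) => s sT; apply: ler_sum => i _; apply: ler_sum => j _.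
exact: (hK (i, j)).
Qed.

Lemma jet_t_bounded u (k : nat) x : smooth2 u ->
  locally_bounded (fun t => iter k (@mderive R n) (u^~ t) x).
Proof.
move=> h T.
have [c _ _] := h (nseq k true).
have b i j : exists K, forall t, `|t| <= T -> cn (iter k (@mderive R n) (u^~ t) x i j) <= K.
  have [c1 c2] := c i j.
  have cp (f : R * R -> R) : continuous f -> continuous (fun t => f (x, t)).
    move=> cf t; apply: (@continuous_comp _ _ _ (fun t => (x, t)) f); last exact: cf.
    by apply: (@cvg_pair _ _ _ _ (nbhs x) (nbhs t)); [exact: cvg_cst | exact: cvg_id].
  have [K1 h1] := segment_bounded T (cp _ c1).
  have [K2 h2] := segment_bounded T (cp _ c2).
  exists (K1 + K2) => s sT; rewrite iter_mderive_partial /cn lerD //; [exact: h1 | exact: h2].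
have [K hK] := choice (fun ij : 'I_n * 'I_n => b ij.1 ij.2).
exists (\sum_i \sum_j K (i, j)) => s sT; apply: ler_sum => i _; apply: ler_sum => j _.
exact: (hK (i, j)).
Qed.

(** Bounds for the coefficients of the t-equation, from the joint continuity of the
    x-derivatives of u. *)
Lemma dpeval_t_bounded u x (p : dpoly R n) T : smooth2 u ->
  exists K, forall t, `|t| <= T ->
    cn (dpeval (fun k => iter k (@mderive R n) (u^~ t) x) p) <= K.
Proof.
move=> h; elim: p => [c|i j k|p [K1 h1] q [K2 h2]|p [K1 h1] q [K2 h2]] /=.
- by exists (cn c).
- have [K hK] := jet_t_bounded k x h T; exists K => t /hK; apply: le_trans.
  exact: cn_le_mn.
- by exists (K1 + K2) => t tT; apply: le_trans (cnD _ _) _; apply: lerD; [exact: h1 | exact: h2].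
- exists (K1 * K2) => t tT; apply: le_trans (cnM _ _) _.
  by apply: ler_pM; rewrite ?cn_ge0 //; [exact: h1 | exact: h2].
Qed.

Lemma mxdpapply_t_bounded u x (P : mxdpoly R n) : smooth2 u ->
  locally_bounded (fun t => mxdpapply P (u^~ t) x).
Proof.
move=> h T; have [K hK] := choice (fun ij : 'I_n * 'I_n => dpeval_t_bounded x (P ij.1 ij.2) T h).
exists (\sum_i \sum_j K (i, j)) => s sT; apply: ler_sum => i _; apply: ler_sum => j _.
by rewrite mxE; exact: (hK (i, j)).
Qed.

Lemma mderivable_mxdpapply v (P : mxdpoly R n) x : smooth1 v -> mderivable (mxdpapply P v) x.
Proof.
move=> h i j; apply/cderivableP.
suff [d hd] : cderivable (fun x => dpeval (fun k => iter k (@mderive R n) v x) (P i j)) x.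
  by exists d; apply: cder_ext hd _ erefl => s; rewrite mxE.
elim: (P i j) => [c|p q k|p [d hd] q [e he]|p [d hd] q [e he]] /=.
- by exists 0; apply: cder_cst.
- exact/cderivableP/h.
- by eexists; apply: cderD hd he.
- by eexists; apply: cderM hd he.
Qed.

(** The rate 1 / x is what the Schwartz seminorms of weight one give; it is stable under
    products because x >= 1. *)
Lemma dpeval_decay v (p : dpoly R n) : schwartz v ->
  exists2 K, 0 <= K & forall x, 1 <= x ->
    cn (dpeval (fun k => iter k (@mderive R n) v x) p - dpconst_term p) <= K / x.
Proof.
move=> h; rewrite /dpconst_term.
elim: p => [c|i j k|p [K1 K10 h1] q [K2 K20 h2]|p [K1 K10 h1] q [K2 K20 h2]] /=.
- by exists 0 => // x _; rewrite subrr cn0 mul0r.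
- have [K hK] := h k 1%N; exists (2 * `|K|); first by rewrite mulr_ge0.
  move=> x x1; have x0 : 0 < x by exact: lt_le_trans x1.
  rewrite mxE subr0 ler_pdivlMr //.
  have := hK x i j; rewrite expr1 gtr0_norm // => le1.
  rewrite -lecR rmorphM mulrC; have x0C : 0 <= x%:C by rewrite ler0c ltW.
  apply: le_trans (ler_wpM2l x0C (cn_le_norm _)) _.
  rewrite rmorphM rmorph_nat mulr_natl mulrnAr lerMn2r /=.
  by apply: le_trans le1 _; rewrite lecR ler_norm.
- exists (K1 + K2); first exact: addr_ge0.
  move=> x x1; rewrite opprD addrACA mulrDl; apply: le_trans (cnD _ _) _.
  by apply: lerD; [exact: h1 | exact: h2].
set p0 := dpeval _ p in h1 *; set q0 := dpeval _ q in h2 *.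
exists (K1 * K2 + cn p0 * K2 + K1 * cn q0); first by rewrite !addr_ge0 ?mulr_ge0 ?cn_ge0.
move=> x x1; have x0 : 0 < x by exact: lt_le_trans x1.
have := h1 x x1; have := h2 x x1.
set px := dpeval _ p; set qx := dpeval _ q => k2 k1.
rewrite (_ : px * qx - p0 * q0 = (px - p0) * (qx - q0) + p0 * (qx - q0) + (px - p0) * q0); last by ring.
rewrite [leRHS](_ : _ = K1 * K2 / x + cn p0 * (K2 / x) + K1 / x * cn q0); last by ring.
apply: le_trans (cnD _ _) _; apply: lerD; last first.
  by apply: le_trans (cnM _ _) _; apply: ler_wpM2r; rewrite ?cn_ge0.
apply: le_trans (cnD _ _) _; apply: lerD; last first.
  by apply: le_trans (cnM _ _) _; apply: ler_wpM2l; rewrite ?cn_ge0.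
apply: le_trans (cnM _ _) _; apply: (@le_trans _ _ ((K1 / x) * (K2 / x))).
  by apply: ler_pM; rewrite ?cn_ge0.
rewrite (_ : K1 / x * (K2 / x) = K1 * K2 / x * x^-1); last by ring.
by rewrite ler_piMr ?invf_le1 // !mulr_ge0 // ltW // invr_gt0.
Qed.

End Differential.
(** * Reality and regularity of the trivialization *)

Section Trivialization.
Variable R : realType.
Local Notation C := R[i].
Variable n : nat.
Local Notation M := 'M[C]_n.
Implicit Types (a b : M) (v f : R -> M) (u : R -> R -> M).

Lemma mul_diagr a (A : M) i j : is_diag_mx a -> (A *m a) i j = A i j * a j j.
Proof.
move=> /is_diag_mxP da; rewrite mxE (bigD1 j) //= big1 ?addr0 // => k kj.
by rewrite da ?mulr0.
Qed.

Lemma mul_diagl a (A : M) i j : is_diag_mx a -> (a *m A) i j = a i i * A i j.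
Proof.
move=> /is_diag_mxP da; rewrite mxE (bigD1 i) //= big1 ?addr0 // => k ki.
by rewrite da ?mul0r // eq_sym.
Qed.

Lemma cn_le0 (z : C) K : (forall x, 1 <= x -> cn z <= K / x) -> z = 0.
Proof.
move=> h; apply/eqP; rewrite -cn_eq0 eq_le cn_ge0 andbT.
apply: (@le_of_le_addeps _ _ _ K 1) => // e e0 e1; rewrite add0r -[e]invrK; apply: h.
by rewrite invf_ge1 // ltW.
Qed.

(** The adjoint of the recursion for A and B is the same recursion for their adjoints, hence
    the defects A + adjoint A and B + adjoint B satisfy it too. *)
Lemma skew_defect_rec a (v D A B : M) : u_n a -> u_n v -> D + lie v A = lie B a ->
  D + D^t* + lie v (A + A^t*) = lie (B + B^t*) a.
Proof.
move=> ua uv e.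
have e1 : (lie B a)^t* = lie (B^t*) a by rewrite /lie adjD adjN !adjM ua; mx_ring.
have e2 : D^t* + lie v (A^t*) = lie (B^t*) a by rewrite -(lie_adj A uv) -e1 -adjD e.
have addl (X Y : M) : lie (X + Y) a = lie X a + lie Y a by rewrite /lie; mx_ring.
have addr (X Y : M) : lie v (X + Y) = lie v X + lie v Y by rewrite /lie; mx_ring.
by rewrite addl addr -e -e2 addrACA.
Qed.

(** By induction the defect r of Q_k + its adjoint commutes with a. As v is orthogonal to the
    centralizer, the part of the recursion that commutes with a says that r has derivative
    zero. So r is constant in x, and it vanishes at infinity because Q_k has no constant
    term and v is a Schwartz function. *)
Lemma Q_skew a b (Q : nat -> mxdpoly R n) v : is_diag_mx a -> u_n a -> u_n b ->
  is_Qfamily a b Q -> smooth1 v -> (forall x, centralizer_perp a (v x)) -> schwartz v ->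
  forall k x, (mxdpapply (Q k) v x)^t* = - mxdpapply (Q k) v x.
Proof.
move=> da ua ub [Q0 Qc Qr] sv pv dv.
pose q k x := mxdpapply (Q k) v x; pose dq k x := mderive (q k) x.
have hq k x : mder (q k) x (dq k x) by apply/mderP; split=> //; apply: mderivable_mxdpapply.
have [r [dr [rE hr rec]]] : exists r dr : nat -> R -> M,
    [/\ forall k x, r k x = q k x + (q k x)^t*, forall k x, mder (r k) x (dr k x)
      & forall k x, dr k x + lie (v x) (r k x) = lie (r k.+1 x) a].
  exists (fun k x => q k x + (q k x)^t*), (fun k x => dq k x + (dq k x)^t*); split=> // k x.
    by apply: mderD => //; apply: mder_adj.
  by apply: skew_defect_rec => //; [case: (pv x) | exact: Qr].
suff r0 k x : r k x = 0 by move=> k x; apply/eqP; rewrite -addr_eq0 addrC; apply/eqP; rewrite -[RHS](r0 k x) rE.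
elim: k x => [|k IH] x.
  by rewrite rE /q Q0 ub subrr.
have dr0 y : dr k y = 0.
  by apply: mder_unique (hr k y) _; apply: mder_ext (mder_cst 0 y) _ erefl => s; rewrite IH.
have comm y : lie (r k.+1 y) a = 0.
  by rewrite -rec dr0 IH /lie mulmx0 mul0mx subrr addr0.
have off y i j : a i i != a j j -> r k.+1 y i j = 0.
  move=> aij; have := congr1 (fun A : M => A i j) (comm y).
  rewrite /lie mxD_ij mxN_ij mul_diagr // mul_diagl // mx0_ij [X in X - _]mulrC -mulrBl => /eqP.
  by rewrite mulf_eq0 subr_eq0 eq_sym (negPf aij) => /eqP.
have dr1 y : dr k.+1 y = 0.
  apply/matrixP => i j; rewrite [RHS]mxE; have [aij|aij] := eqVneq (a i i) (a j j); last first.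
    apply: cder_unique (hr k.+1 y i j) _.
    by apply: cder_ext (cder_cst 0 y) _ erefl => s; rewrite off.
  have := congr1 (fun A : M => A i j) (rec k.+1 y).
  rewrite /lie !mxD_ij !mxN_ij (mul_diagr _ i j da) (mul_diagl _ i j da) aij [a j j * _]mulrC subrr.
  rewrite ![(_ *m _) i j]mxE !big1 ?subr0 ?addr0 // => l _.
    have [ll|ll] := eqVneq (a l l) (a j j); last by rewrite off ?mul0r // aij eq_sym.
    by rewrite (perp_entry da (pv y) ll) mulr0.
  have [ll|ll] := eqVneq (a l l) (a j j); last by rewrite (off _ l) ?mulr0.
  by rewrite (perp_entry da (pv y)) ?mul0r // aij.
have cst y : r k.+1 x = r k.+1 y by apply: mder0_cst => s; rewrite -(dr1 s).
apply/matrixP => i j; rewrite [RHS]mxE.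
have [K1 K10 h1] := dpeval_decay (Q k.+1 i j) dv.
have [K2 K20 h2] := dpeval_decay (Q k.+1 j i) dv.
apply: (@cn_le0 _ (K1 + K2)) => y y1; rewrite (cst y) rE /q !mxE mulrDl.
apply: le_trans (cnD _ _) _; rewrite cnJ; apply: lerD.
  by have := h1 y y1; rewrite Qc // subr0.
by have := h2 y y1; rewrite Qc // subr0.
Qed.

(** The columns of a unitary matrix have length one. *)
Lemma unitary_cn (A : M) i j : A^t* *m A = 1%:M -> cn (A i j) <= 2.
Proof.
move=> h; have := congr1 (fun B : M => complex.Re (B j j)) h.
rewrite !mxE eqxx /= (bigD1 i) //= ReD => e.
have p k : complex.Re ((A^t* ) j k * A k j) = complex.Re (A k j) ^+ 2 + complex.Im (A k j) ^+ 2.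
  by rewrite !mxE !cpartE; ring.
have s0 : 0 <= complex.Re (\sum_(k < n | k != i) (A^t* ) j k * A k j).
  apply: (big_ind (fun z : C => 0 <= complex.Re z)) => // [z w z0 w0|k _].
    by rewrite ReD addr_ge0.
  by rewrite p addr_ge0 ?sqr_ge0.
have := sqr_cn_le (A i j); rewrite -p => le2.
have := cn_ge0 (A i j) => c0.
have : cn (A i j) ^+ 2 <= 2 by apply: le_trans le2 _; move: e s0; lra.
by move: (cn (A i j)) c0 => w w0; nra.
Qed.

Lemma frame_mder u g t : is_frame u g -> forall x, mder (g^~ t) x (g x t *m u x t).
Proof.
move=> h x; have [gu dg <- _] := h x t; apply/mderP; split=> //.
by rewrite mulKVmx.
Qed.

Lemma frame_limit u g t : is_frame u g ->
  forall e : R, 0 < e -> exists X : R, forall x, x < X -> mn (g x t - 1%:M) < e.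
Proof.
move=> h e e0; pose m : R := (n * n)%:R * 2 + 1.
have m0 : 0 < m by rewrite ltr_wpDl // mulr_ge0.
pose e' := e / m; have e'0 : 0 < e' by rewrite divr_gt0.
have nearX (f : R -> R) (l : R) : f s @[s --> -oo%R] --> l -> exists X : R, forall x, x < X -> `|f x - l| <= e'.
  move=> /cvgrPdist_le/(_ e' e'0)[X [_ hX]]; exists X => x xX.
  by rewrite distrC; apply: hX.
have ex i j : exists X : R, forall x, x < X -> cn ((g x t - 1%:M) i j) <= 2 * e'.
  have [_ _ _ lim] := h 0 t; have [l1 l2] := lim i j.
  have [X1 h1] := nearX _ _ l1; have [X2 h2] := nearX _ _ l2.
  exists (Num.min X1 X2) => x; rewrite lt_min => /andP[x1 x2].
  rewrite mxD_ij mxN_ij /cn !cpartE mulrDl mul1r lerD //; [exact: h1 | exact: h2].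
have [X hX] := choice (fun ij : 'I_n * 'I_n => ex ij.1 ij.2).
exists (\big[Num.min/0]_ij X ij) => x xX.
apply: (@le_lt_trans _ _ ((n * n)%:R * (2 * e'))).
  apply: mn_le => i j; apply: (hX (i, j)).
  by apply: lt_le_trans xX _; apply: (bigmin_le_cond _ (j := (i, j))).
rewrite mulrA /e' mulrCA -[ltRHS]mulr1 ltr_pM2l // ltr_pdivrMr // mul1r.
by rewrite ltrDl.
Qed.

(** The product of g and the adjoint of g' has x-derivative g (u + adjoint u) (adjoint g') = 0
    and tends to 1 at - oo. For g = g' this is unitarity; in general it is uniqueness. *)
Lemma frames_inv u g g' x t : is_frame u g -> is_frame u g' ->
  (forall x t, u_n (u x t)) -> g x t *m (g' x t)^t* = 1%:M.
Proof.
move=> h h' uu; pose W s := g s t *m (g' s t)^t*.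
have cst s r : W s = W r.
  apply: mder0_cst => y; apply: mder_ext (mderM (frame_mder t h y) (mder_adj (frame_mder t h' y))) _ _ => //.
  by rewrite adjM uu; mx_ring.
have small e : 0 < e -> e < 1 -> mn (W x - 1%:M) <= 0 + 3 * e.
  move=> e0 e1; have [X hX] := frame_limit t h e0; have [X' hX'] := frame_limit t h' e0.
  pose y := Num.min X X' - 1.
  have yX : y < X by rewrite /y ltrBlDr ltr_pwDr // ge_min lexx.
  have yX' : y < X' by rewrite /y ltrBlDr ltr_pwDr // ge_min lexx orbT.
  rewrite (cst x y) /W.
  have -> : g y t *m (g' y t)^t* - 1%:M = (g y t - 1%:M) *m (g' y t - 1%:M)^t* +
      (g y t - 1%:M) + (g' y t - 1%:M)^t* by rewrite adjD adjN adj1; mx_ring.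
  have k1 := ltW (hX y yX); have k2 := ltW (hX' y yX').
  have p1 := mn_ge0 (g y t - 1%:M); have p2 := mn_ge0 (g' y t - 1%:M).
  apply: le_trans (mnD _ _) _; apply: le_trans (lerD (mnD _ _) (lexx _)) _.
  apply: le_trans (lerD (lerD (mnM _ _) (lexx _)) (lexx _)) _; rewrite !mnJ.
  have : mn (g y t - 1%:M) * mn (g' y t - 1%:M) <= e * 1.
    by apply: ler_pM => //; apply: le_trans k2 (ltW e1).
  lra.
have := le_of_le_addeps ltr01 small.
move=> h0; apply/eqP; rewrite -subr_eq0; apply/eqP/matrixP => i j; rewrite [RHS]mxE.
apply/eqP; rewrite -cn_eq0 eq_le cn_ge0 andbT.
exact: le_trans (cn_le_mn _ i j) h0.
Qed.

Lemma frame_unitary u g x t : is_frame u g -> (forall x t, u_n (u x t)) ->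
  invmx (g x t) = (g x t)^t*.
Proof.
move=> h uu; have [gu _ _ _] := h x t; have e := frames_inv x t h h uu.
by rewrite -[LHS]mulmx1 -e mulKmx.
Qed.

Lemma frame_unique u g g' x t : is_frame u g -> is_frame u g' ->
  (forall x t, u_n (u x t)) -> g x t = g' x t.
Proof.
move=> h h' uu; have e := frames_inv x t h' h uu; have [gu _ _ _] := h x t.
by rewrite -[LHS]mul1mx -e -(frame_unitary x t h uu) mulmxKV.
Qed.

Variables (a b : M) (Q : nat -> mxdpoly R n) (j : int) (u0 : R -> R -> M).
Hypotheses (da : is_diag_mx a) (ua : u_n a) (ub : u_n b).
Hypothesis HQ : is_Qfamily a b Q.
Hypothesis Hsol : solutions a b Q j u0.

Lemma sol_smooth : smooth2 u0. Proof. by case: Hsol. Qed.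
Lemma sol_perp x t : centralizer_perp a (u0 x t). Proof. by case: Hsol. Qed.
Lemma sol_u_n x t : u_n (u0 x t). Proof. by case: (sol_perp x t). Qed.
Lemma sol_schwartz t : schwartz (u0^~ t). Proof. by case: Hsol. Qed.

Lemma sol_Q_skew k x t :
  (mxdpapply (Q k) (u0^~ t) x)^t* = - mxdpapply (Q k) (u0^~ t) x.
Proof.
apply: Q_skew HQ _ _ _ _ _ => //; [exact: smooth2_x sol_smooth | by move=> y; exact: sol_perp | exact: sol_schwartz].
Qed.

Lemma flow_part_skew B x t l : is_flow_part b Q j u0 B ->
  (B x t (l^*)%R)^t* = - B x t l.
Proof.
rewrite /is_flow_part; case: j => [k hB|m [g [fg hB]]].
  rewrite !hB (big_morph (fun A : M => A^t*) (@adjD R n) (@adj0 R n)) -sumrN.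
  by apply: eq_bigr => i _; rewrite adjZ sol_Q_skew rmorphXn /= conjCK scalerN.
rewrite !hB adjZ !adjM (frame_unitary x t fg sol_u_n) adjK ub fmorphV /= conjCK.
by mx_ring.
Qed.

Lemma flow_part_unique B B' : is_flow_part b Q j u0 B -> is_flow_part b Q j u0 B' ->
  forall x t l, B x t l = B' x t l.
Proof.
rewrite /is_flow_part; case: j => [k hB hB' x t l|m [g [fg hB]] [g' [fg' hB']] x t l].
  by rewrite hB hB'.
by rewrite hB hB' (frame_unique x t fg fg' sol_u_n).
Qed.

Lemma domain_conj l : spectral_domain (R := R) j l -> spectral_domain (R := R) j (l^*)%R.
Proof.
rewrite /spectral_domain /=; case: ifP => // _ h /eqP; rewrite conjC_eq0 => /eqP.
exact: h.
Qed.

Section OneE.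
Variables (E E' : R -> R -> C -> M).
Hypotheses (HE : is_trivialization a b Q j u0 E) (HE' : is_trivialization a b Q j u0 E').

(** The coefficients of both Lax equations at conj l are minus the adjoints of those at l, so
    the pairing is constant in x and in t. With E = E' this is the reality condition of the
    trivialization, and for two trivializations it is uniqueness. *)
Lemma triv_pairing x t l : spectral_domain j l -> E x t l *m (E' x t (l^*)%R)^t* = 1%:M.
Proof.
move=> dl; have dl' := domain_conj dl.
have [B fB hE] := HE; have [B' fB' hE'] := HE'.
have [e00 hl] := hE l dl; have [e00' hl'] := hE' _ dl'.
pose W y s := E y s l *m (E' y s (l^*)%R)^t*.
have xcst s y y' : W y s = W y' s.
  apply: (@mder0_cst R n (W^~ s)) => r.
  have [d1 d2 _ _] := hl r s; have [d1' d2' _ _] := hl' r s.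
  have m1 : mder (fun q => E q s l) r (E r s l *m (l *: a + u0 r s)) by apply/mderP.
  have m1' : mder (fun q => E' q s (l^*)%R) r (E' r s (l^*)%R *m ((l^*)%R *: a + u0 r s)).
    by apply/mderP.
  apply: mder_ext (mderM m1 (mder_adj m1')) _ _ => //.
  rewrite (adjM (E' r s _)) (adjD (_ *: a)) (adjZ _ a) ua sol_u_n conjCK.
  exact: pairing_cancel.
have tcst y s s' : W y s = W y s'.
  apply: (@mder0_cst R n (W y)) => r.
  have [_ _ d1 d2] := hl y r; have [_ _ d1' d2'] := hl' y r.
  have m1 : mder (fun q => E y q l) r (E y r l *m B y r l) by apply/mderP.
  have m1' : mder (fun q => E' y q (l^*)%R) r (E' y r (l^*)%R *m B' y r (l^*)%R) by apply/mderP.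
  apply: mder_ext (mderM m1 (mder_adj m1')) _ _ => //.
  by rewrite adjM -(flow_part_unique fB fB') (flow_part_skew _ _ _ fB); mx_ring.
by rewrite -[LHS]/(W x t) (xcst t x 0) (tcst 0 t 0) /W e00 e00' adj1 mul1mx.
Qed.
End OneE.

Lemma triv_unique E E' x t l : is_trivialization a b Q j u0 E ->
  is_trivialization a b Q j u0 E' -> spectral_domain j l -> E x t l = E' x t l.
Proof.
move=> h h' dl; have e := triv_pairing h h' x t dl; have e' := triv_pairing h' h' x t dl.
by rewrite -[LHS]mulmx1 -(mulmx1C e') mulmxA e mul1mx.
Qed.

Lemma domain_open l0 : spectral_domain j l0 -> exists2 d : R, 0 < d &
  forall l, cn (l - l0) < d -> spectral_domain (R := R) j l.
Proof.
rewrite /spectral_domain /=; case: ifP => _; first by exists 1.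
move=> l00; exists (cn l0); first by rewrite cn_gt0; apply/eqP.
by move=> l ll l0'; rewrite l0' sub0r cnN ltxx in ll.
Qed.

(** For j = -1 the frame g might depend on t in an irregular way, but it is unitary, hence
    bounded. *)
Lemma flow_part_jet B x l0 : is_flow_part b Q j u0 B -> spectral_domain j l0 ->
  has_jet l0 (fun t l => B x t l).
Proof.
rewrite /is_flow_part /spectral_domain; case: j => [k hB _|m [g [fg hB]] /= l00].
  apply: (@has_jet_ext _ _ _ (fun t l => \sum_(i < k.+1)
     (l ^+ (k - i))%:M *m mxdpapply (Q i) (u0^~ t) x)).
    by move=> t l; rewrite hB; apply: eq_bigr => i _; rewrite mul_scalar_mx.
  apply: has_jet_sum => i; apply: has_jetM; first exact: has_jet_exp.
  by apply: has_jet_cst; apply: mxdpapply_t_bounded sol_smooth.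
apply: (@has_jet_ext _ _ _ (fun t l => (l^-1)%:M *m (invmx (g x t) *m b *m g x t))).
  by move=> t l; rewrite hB mul_scalar_mx.
apply: has_jetM; first by apply: has_jet_inv; apply/eqP.
apply: has_jet_cst => T; exists ((n * n)%:R * 2 * mn b * ((n * n)%:R * 2)) => t _.
have gb : mn (g x t) <= (n * n)%:R * 2.
  by apply: mn_le => i k; apply: unitary_cn; apply: mulmx1C; exact: (frames_inv x t fg fg sol_u_n).
rewrite (frame_unitary x t fg sol_u_n).
apply: le_trans (mnM _ _) _; apply: ler_pM; rewrite ?mn_ge0 //.
apply: le_trans (mnM _ _) _; apply: ler_pM; rewrite ?mn_ge0 // mnJ //.
Qed.

Lemma triv_ode E x t l : is_trivialization a b Q j u0 E -> spectral_domain j l ->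
  mder (fun s => E s t l) x (E x t l *m (l *: a + u0 x t)).
Proof. by move=> [B _ h] dl; have [_ /(_ x t)[? ? _ _]] := h l dl; apply/mderP. Qed.

(** Follow the t-equation from (0, 0) to (0, t), then the x-equation from (0, t) to (x, t);
    param_ode applies to both. *)
Lemma triv_jet E l0 t : is_trivialization a b Q j u0 E -> spectral_domain j l0 ->
  exists d E1 E2, [/\ 0 < d, jet l0 d (fun x => E x t) E1 E2 &
    forall l s, cn (l - l0) < d ->
      mder (E1^~ l) s (E1 s l *m (l0 *: a + u0 s t) + E s t l *m a)].
Proof.
move=> HE dl0; have [B fB hE] := HE.
have [dA [A1 [A2 [dA0 jA]]]] := flow_part_jet 0 fB dl0.
have [dd dd0 hdd] := domain_open dl0.
pose d := Num.min dA dd.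
have d0 : 0 < d by rewrite lt_min dA0.
have ddom l : cn (l - l0) < d -> spectral_domain (R := R) j l.
  by rewrite lt_min => /andP[_]; exact: hdd.
have dA_le : d <= dA by rewrite ge_min lexx.
have init : jet l0 d (fun _ l => E 0 0 l) (fun _ _ => 0) (fun _ _ => 0).
  have k := jet_cst l0 d (locally_bounded_cst (1%:M : M)).
  have e l : cn (l - l0) < d -> E 0 0 l = 1%:M by move=> /ddom/hE[].
  have c00 : cn (l0 - l0) < d by rewrite cn_l00.
  case: k => [q1 q2 h0 h1 h2]; split=> //.
    by move=> s l ld; rewrite !e // scaler0 addr0.
  by apply: ulip_ext h0 => // s l ld; rewrite e.
have [Y1 [Y2 [jY _]]] : exists Y1 Y2, jet l0 d (fun s l => E 0 s l) Y1 Y2 /\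
    forall l s, cn (l - l0) < d -> mder (Y1^~ l) s (Y1 s l *m B 0 s l0 + E 0 s l *m A1 s l).
  apply: (param_ode d0 (jetW dA_le jA) init) => l s ld.
  by have [_ /(_ 0 s)[_ _ ? ?]] := hE l (ddom l ld); apply/mderP.
have jt : jet l0 d (fun _ l => E 0 t l) (fun _ l => Y1 t l) (fun _ l => Y2 t l).
  case: jY => [q1 q2 h0 h1 h2]; split.
  - by move=> _ l; exact: q1.
  - by move=> _ l; exact: q2.
  - by move=> T; have [K K0 hK] := h0 `|t|; exists K => // s l _; exact: hK.
  - by move=> T; have [K K0 hK] := h1 `|t|; exists K => // s l _; exact: hK.
  - by move=> T; have [K K0 hK] := h2 `|t|; exists K => // s l _; exact: hK.
have bx : locally_bounded (fun x => u0 x t) by exact: (jet_x_bounded 0 t sol_smooth).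
have jX : jet l0 d (fun x l => l *: a + u0 x t) (fun _ _ => a) (fun _ _ => 0).
  have k := jetD (jetM d0 (@jet_id R n l0 d d0) (jet_cst l0 d (locally_bounded_cst a))) (jet_cst l0 d bx).
  have la l : ulip l0 d (fun _ _ => l) by exact: ulip_cst (locally_bounded_cst _).
  case: k => [q1 q2 h0 h1 h2]; split.
  - by move=> s l _; mx_ring.
  - by move=> s l _; rewrite scaler0 addr0.
  - by apply: ulip_ext h0 => // s l _; rewrite mul_scalar_mx.
  - exact: la.
  - exact: la.
have [E1 [E2 [jE dE]]] := param_ode (Y := fun x l => E x t l) d0 jX jt
  (fun l s ld => triv_ode s t HE (ddom l ld)).
by exists d, E1, E2; split.
Qed.

End Trivialization.
(** * The algebra of two Hermitian projections *)

Section BianchiAlgebra.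
Variables (K : comPzRingType) (n : nat).
Variables (z1 y1 z2 y2 : K) (p1 p2 : 'M[K]_n).
Hypotheses (pp1 : p1 *m p1 = p1) (pp2 : p2 *m p2 = p2).

Let S := p1 + p2 - p1 *m p2 - p2 *m p1.

(** Here A is phi and, when y_i = conj z_i, B is its adjoint: phi is normal, and
    phi times its adjoint is a combination of 1 and S = (p1 - p2)^2, which commutes with both
    projections. *)
Lemma bianchi_norm (A B : 'M[K]_n) :
  A = (z2 - z1) *: 1%:M + (z1 - y1) *: p1 - (z2 - y2) *: p2 ->
  B = (y2 - y1) *: 1%:M - (z1 - y1) *: p1 + (z2 - y2) *: p2 ->
  A *m B = ((z2 - z1) * (y2 - y1)) *: 1%:M - ((z1 - y1) * (z2 - y2)) *: S /\
  B *m A = ((z2 - z1) * (y2 - y1)) *: 1%:M - ((z1 - y1) * (z2 - y2)) *: S.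
Proof.
move=> -> ->; rewrite /S; split; mx_expand; rewrite pp1 pp2; mx_entries; ring.
Qed.

Lemma bianchi_norm_squares (A B : 'M[K]_n) :
  A = (z2 - z1) *: 1%:M + (z1 - y1) *: p1 - (z2 - y2) *: p2 ->
  B = (y2 - y1) *: 1%:M - (z1 - y1) *: p1 + (z2 - y2) *: p2 ->
  A *m B = ((z1 - y2) * (y1 - z2)) *: ((p1 - p2) *m (p1 - p2))
    + ((z1 - z2) * (y1 - y2)) *: ((1%:M - p1 - p2) *m (1%:M - p1 - p2)).
Proof.
move=> hA hB; have [-> _] := bianchi_norm hA hB; rewrite /S.
by mx_expand; rewrite pp1 pp2; mx_entries; ring.
Qed.

Lemma sum_squares1 :
  (p1 - p2) *m (p1 - p2) + (1%:M - p1 - p2) *m (1%:M - p1 - p2) = 1%:M.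
Proof. by mx_expand; rewrite pp1 pp2; mx_entries; ring. Qed.

(** The difference of the two sides is z2 - y2 times t2 A - A p2. *)
Lemma bianchi_product (A t1 t2 : 'M[K]_n) (l : K) :
  A = (z2 - z1) *: 1%:M + (z1 - y1) *: p1 - (z2 - y2) *: p2 ->
  (z1 - y1) *: t1 = (z2 - y2) *: t2 + (z1 - y1) *: p1 - (z2 - y2) *: p2 ->
  t2 *m A = A *m p2 ->
  ((l - z2) *: 1%:M + (z2 - y2) *: t2) *m ((l - z1) *: 1%:M + (z1 - y1) *: p1) =
  ((l - z1) *: 1%:M + (z1 - y1) *: t1) *m ((l - z2) *: 1%:M + (z2 - y2) *: p2).
Proof.
move=> -> -> /eqP; rewrite -subr_eq0 => /eqP h.
rewrite -[LHS]addr0 -(scaler0 _ (- (z2 - y2))) -h.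
by mx_expand; rewrite pp2; mx_entries; ring.
Qed.

Lemma bianchi_comm1 (c d : K) : p1 *m (c *: 1%:M - d *: S) = (c *: 1%:M - d *: S) *m p1.
Proof.
by rewrite /S; mx_expand; rewrite -![_ *m p1 *m p1]mulmxA pp1; mx_entries; ring.
Qed.

Lemma bianchi_comm2 (c d : K) : p2 *m (c *: 1%:M - d *: S) = (c *: 1%:M - d *: S) *m p2.
Proof.
by rewrite /S; mx_expand; rewrite -![_ *m p2 *m p2]mulmxA pp2; mx_entries; ring.
Qed.

End BianchiAlgebra.

Lemma scaled_product_eq (K : comPzRingType) n (d e : K) (A B A' B' : 'M[K]_n) :
  A *m B = A' *m B' -> (d *: A) *m (e *: B) = (e *: A') *m (d *: B').
Proof. by move=> h; rewrite !scalemx_l !scalemx_r h !scalerA mulrC. Qed.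

Lemma quadratic_sum (K : comPzRingType) n (k k' : K) (v : 'rV[K]_n) A B (w : 'cV[K]_n) :
  (v *m (k *: A + k' *: B) *m w) 0 0 = k * (v *m A *m w) 0 0 + k' * (v *m B *m w) 0 0.
Proof. by rewrite mulmxDr mulmxDl !scalemx_r !scalemx_l mxD_ij !mxZ_ij. Qed.

Lemma two_nonneg (K : numDomainType) (k k' x y : K) :
  0 < k -> 0 < k' -> 0 <= x -> 0 <= y -> k * x + k' * y = 0 -> x = 0 /\ y = 0.
Proof.
move=> k0 k'0 x0 y0 /eqP; rewrite (paddr_eq0 (mulr_ge0 (ltW k0) x0) (mulr_ge0 (ltW k'0) y0)).
rewrite !mulf_eq0 (gt_eqF k0) (gt_eqF k'0) /=.
by move=> /andP[/eqP-> /eqP->].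
Qed.

Section Projections.
Variable R : realType.
Local Notation C := R[i].
Variable n : nat.
Local Notation M := 'M[C]_n.
Implicit Types (p q : M) (z l : C).

Lemma nonreal_neq z : z \isn't Num.real -> z != (z^*)%R.
Proof. by apply: contra => /eqP e; rewrite CrealE -e. Qed.

Lemma adj_hproj p : herm_projection p -> p^t* = p. Proof. by case. Qed.
Lemma mul_hproj p : herm_projection p -> p *m p = p. Proof. by case. Qed.

Lemma simple_element_lin z p l : l != (z^*)%R ->
  simple_element z p l = (l - (z^*)%R)^-1 *: ((l - z) *: 1%:M + (z - (z^*)%R) *: p).
Proof.
rewrite -subr_eq0 => lz; rewrite /simple_element.
by mx_entries; field.
Qed.

Lemma simple_elementV z p l : herm_projection p -> l != z -> l != (z^*)%R ->
  simple_element z p l *m simple_element (z^*)%R p l = 1%:M.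
Proof.
move=> [_ pp]; rewrite -subr_eq0 => lz; rewrite -subr_eq0 => lzb.
rewrite /simple_element conjCK; mx_expand; rewrite pp; mx_entries; field.
by rewrite lz lzb.
Qed.

Lemma simple_element_adj z p l : herm_projection p ->
  (simple_element z p (l^*)%R)^t* = simple_element (z^*)%R p l.
Proof.
move=> [pa _]; rewrite /simple_element adjD adjZ adjD adjN adj1 pa fmorph_div !rmorphB /=.
by rewrite !conjCK.
Qed.

(** The conjugate A p A^-1 is Hermitian if and only if p commutes with (adjoint A) A. *)
Lemma conj_hproj (A p : M) : A \in unitmx -> herm_projection p ->
  p *m (A^t* *m A) = (A^t* *m A) *m p -> herm_projection (A *m p *m invmx A).
Proof.
move=> u [pa pp] h; have ua : A^t* \in unitmx by rewrite map_unitmx unitmx_tr.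
have e : (invmx A)^t* *m A^t* = 1%:M.
  by rewrite -(adjM A (invmx A)) (mulmxV u) adj1.
split; last by rewrite !mulmxA (mulmxKV u) -(mulmxA A p p) pp.
rewrite (adjM (A *m p)) (adjM A) pa -[RHS]mul1mx -e.
have := congr1 (fun B : M => B *m invmx A) h; rewrite -!mulmxA (mulmxV u) mulmx1 => ->.
by rewrite !mulmxA.
Qed.

Variables (z1 z2 : C) (p1 p2 : M).
Hypotheses (hp1 : herm_projection p1) (hp2 : herm_projection p2).
Hypotheses (z12 : z1 != z2) (z12b : z1 != (z2^*)%R).
Let phi := bianchi_phi z1 z2 p1 p2.
Let c1 := z1 - (z1^*)%R.
Let c2 := z2 - (z2^*)%R.

Let hproj_entry p i j : herm_projection p -> ((p j i)^*)%R = p i j.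
Proof. by move=> [pa _]; rewrite -[in RHS]pa !mxE. Qed.

Let phiE : phi = (z2 - z1) *: 1%:M + c1 *: p1 - c2 *: p2.
Proof. by rewrite /phi /bianchi_phi scalemx1. Qed.

Let phi_adj : phi^t* = ((z2^*)%R - (z1^*)%R) *: 1%:M - c1 *: p1 + c2 *: p2.
Proof.
apply/matrixP => i j; rewrite phiE 2![in LHS]mxE.
rewrite !(mxD_ij, mxN_ij, mxZ_ij) !(rmorphD, rmorphN, rmorphM, rmorphB) /= !conjCK.
rewrite (hproj_entry _ _ hp1) (hproj_entry _ _ hp2) ![_%:M _ _]mxE [j == i]eq_sym rmorph_nat /c1 /c2.
ring.
Qed.

Let phi_norm : [/\ phi *m phi^t* = phi^t* *m phi,
  p1 *m (phi^t* *m phi) = (phi^t* *m phi) *m p1 &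
  p2 *m (phi^t* *m phi) = (phi^t* *m phi) *m p2].
Proof.
have pp1 := mul_hproj hp1; have pp2 := mul_hproj hp2.
have [e1 e2] := bianchi_norm pp1 pp2 phiE phi_adj; rewrite e1 e2; split=> //.
  exact: bianchi_comm1.
exact: bianchi_comm2.
Qed.

Lemma dot_ge0 (v : 'rV[C]_n) : 0 <= (v *m v^t*) 0 0.
Proof. by rewrite mxE; apply: sumr_ge0 => i _; rewrite !mxE -normCK exprn_ge0. Qed.

Lemma dot_eq0 (v : 'rV[C]_n) : (v *m v^t*) 0 0 = 0 -> v = 0.
Proof.
rewrite mxE => /eqP; rewrite psumr_eq0 => [/allP h|i _]; last by rewrite !mxE -normCK exprn_ge0.
apply/rowP => i; have := h i (mem_index_enum _); rewrite !mxE -normCK expf_eq0 /= normr_eq0.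
by move/eqP.
Qed.

(** By bianchi_norm_squares, phi times its adjoint is |z1 - conj z2|^2 (p1 - p2)^2 +
    |z1 - z2|^2 (1 - p1 - p2)^2. Both coefficients are positive, and the two squares of
    Hermitian matrices add up to 1, so a row vector killed by phi is zero. *)
Lemma phi_unit : phi \in unitmx.
Proof.
have pp1 := mul_hproj hp1; have pp2 := mul_hproj hp2.
rewrite -row_free_unit -kermx_eq0; apply/eqP/row_matrixP => i; rewrite row0.
set v := row i _; have vphi : v *m phi = 0 by rewrite -row_mul mulmx_ker row0.
pose D := p1 - p2; pose F := 1%:M - p1 - p2.
have Dh : D^t* = D by rewrite adjD adjN (adj_hproj hp1) (adj_hproj hp2).
have Fh : F^t* = F by rewrite adjD adjN adjD adjN adj1 (adj_hproj hp1) (adj_hproj hp2).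
have e : v *m (phi *m phi^t*) *m v^t* = 0 by rewrite mulmxA vphi !mul0mx.
have e2 := bianchi_norm_squares pp1 pp2 phiE phi_adj.
have sq (A : M) : A^t* = A -> v *m (A *m A) *m v^t* = (v *m A) *m (v *m A)^t*.
  by move=> hA; rewrite trmx_mul map_mxM hA !mulmxA.
pose k1 := (z1 - (z2^*)%R) * ((z1^*)%R - z2); pose k2 := (z1 - z2) * ((z1^*)%R - (z2^*)%R).
have normE (z w : C) : (z - w) * ((z^*)%R - (w^*)%R) = `|z - w| ^+ 2.
  by rewrite normCK rmorphB.
have k1p : 0 < k1 by rewrite /k1 -{2}(conjCK z2) normE exprn_gt0 // normr_gt0 subr_eq0.
have k2p : 0 < k2 by rewrite /k2 normE exprn_gt0 // normr_gt0 subr_eq0.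
have q := quadratic_sum k1 k2 v (D *m D) (F *m F) (v^t* ).
rewrite -e2 e mx0_ij (sq D Dh) (sq F Fh) in q.
have [/dot_eq0 vD /dot_eq0 vF] := two_nonneg k1p k2p (dot_ge0 _) (dot_ge0 _) (esym q).
by rewrite -[v]mulmx1 -(sum_squares1 pp1 pp2) -/D -/F mulmxDr !mulmxA vD vF !mul0mx addr0.
Qed.

Lemma tau1_hproj : herm_projection (phi *m p1 *m invmx phi).
Proof. by case: phi_norm => _ h _; apply: conj_hproj => //; exact: phi_unit. Qed.

Lemma tau2_hproj : herm_projection (phi *m p2 *m invmx phi).
Proof. by case: phi_norm => _ _ h; apply: conj_hproj => //; exact: phi_unit. Qed.

(** Since phi - (z2 - z1) = c1 p1 - c2 p2 commutes with phi, conjugation by phi fixes it. *)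
Lemma tau_sum : c1 *: (phi *m p1 *m invmx phi) =
  c2 *: (phi *m p2 *m invmx phi) + c1 *: p1 - c2 *: p2.
Proof.
have u := phi_unit.
have h : c1 *: p1 - c2 *: p2 = phi - (z2 - z1) *: 1%:M by rewrite phiE; mx_entries; ring.
have : phi *m (c1 *: p1 - c2 *: p2) *m invmx phi = c1 *: p1 - c2 *: p2.
  by rewrite h mulmxBr mulmxBl mulmxK // -scalemxAr mulmx1 -scalemxAl mulmxV.
rewrite mulmxBr mulmxBl -!scalemxAr -!scalemxAl => e.
by rewrite -addrA -e addrC subrK.
Qed.

Lemma tau_factor l : let t1 := phi *m p1 *m invmx phi in let t2 := phi *m p2 *m invmx phi in
  ((l - z2) *: 1%:M + c2 *: t2) *m ((l - z1) *: 1%:M + c1 *: p1) =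
  ((l - z1) *: 1%:M + c1 *: t1) *m ((l - z2) *: 1%:M + c2 *: p2).
Proof.
move=> t1 t2; have e : t2 *m phi = phi *m p2 by rewrite /t2 mulmxKV // phi_unit.
exact: (bianchi_product (mul_hproj hp2) _ phiE tau_sum e).
Qed.

(** Bianchi's permutability at the level of the dressing group. *)
Lemma simple_element_exchange l : l != (z1^*)%R -> l != (z2^*)%R ->
  simple_element z2 (phi *m p2 *m invmx phi) l *m simple_element z1 p1 l =
  simple_element z1 (phi *m p1 *m invmx phi) l *m simple_element z2 p2 l.
Proof.
move=> l1 l2; rewrite (simple_element_lin p1 l1) (simple_element_lin p2 l2).
rewrite (simple_element_lin _ l1) (simple_element_lin _ l2).
exact: scaled_product_eq (tau_factor l).
Qed.

End Projections.
(** * Dressing by one simple element *)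

Section SingleDressingAlgebra.
Variables (K : comPzRingType) (n : nat).
Variables (p q a X : 'M[K]_n) (l z y : K).

(** P q and T (1 - q) are the two column blocks of the dressed frame. The residues of their
    equations are expressed by one matrix N, computed in dressed_residue_algebra. *)
Lemma dressed_ode_algebra (P T N dP dT dq : 'M[K]_n) :
  q *m q = q ->
  N = (l - y) *: P - (l - z) *: T ->
  dP = P *m X - N *m (1%:M - q) *m a ->
  dT = T *m X + N *m q *m a ->
  dq = q *m (X - (l - z) *: a) *m (1%:M - q) - (1%:M - q) *m (X - (l - y) *: a) *m q ->
  (dP *m q + P *m dq) + (dT *m (1%:M - q) + T *m (- dq)) =
  (P *m q + T *m (1%:M - q)) *m (X + (z - y) *: (q *m a - a *m q)).
Proof.
move=> qq -> -> -> ->; have qqA (A : 'M[K]_n) : A *m q *m q = A *m q by rewrite -mulmxA qq.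
mx_expand; rewrite ?(qq, qqA); mx_entries; ring.
Qed.

Lemma dressed_residue_algebra (E Ez Ey Dz Dy : 'M[K]_n) :
  E = Ez + (l - z) *: Dz -> E = Ey + (l - y) *: Dy ->
  (l - y) *: (p *m E + (l - z) *: ((1%:M - p) *m Dy))
   - (l - z) *: ((l - y) *: (p *m Dz) + (1%:M - p) *m E)
  = (l - y) *: (p *m Ez) - (l - z) *: ((1%:M - p) *m Ey).
Proof.
move=> e1 e2; have -> : Ez = E - (l - z) *: Dz by rewrite e1; mx_ring.
have -> : Ey = E - (l - y) *: Dy by rewrite {1}e2; mx_ring.
mx_ring.
Qed.

End SingleDressingAlgebra.

(** The projection onto the moving subspace (adjoint of E) p C^n is V G^-1 (adjoint V) with
    V = (adjoint E) p and an explicitly invertible Gram matrix G = (adjoint V) V + (1 - p);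
    hence it is differentiable. Its equation follows from q V = V, adjoint q = q and q q = q. *)
Section Projection.
Variable R : realType.
Local Notation C := R[i].
Variable n : nat.
Local Notation M := 'M[C]_n.

Lemma colmxP (A B : M) : (forall v : 'cV[C]_n, A *m v = B *m v) -> A = B.
Proof.
move=> h; apply/matrixP => i j; have := h (delta_mx j 0); rewrite -!colE => /colP/(_ i).
by rewrite !mxE.
Qed.

Lemma projection_onto_rel (p q Ez Ey : M) : herm_projection p -> Ez *m Ey^t* = 1%:M ->
  is_herm_projection_onto [set Ez^t* *m v | v in mximage p] q ->
  p *m Ez *m q = p *m Ez /\ p *m Ey *m q = Ey *m q.
Proof.
move=> [pa pp] eE [[qa qq] im].
have yz : Ey *m Ez^t* = 1%:M by rewrite -{1}[Ey]adjK -(adjM Ez) eE adj1.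
split.
  have h : q *m (Ez^t* *m p) = Ez^t* *m p.
    apply: colmxP => v; have : mximage q (Ez^t* *m (p *m v)).
      by rewrite im; exists (p *m v) => //; exists v.
    by move=> [w _ e]; rewrite -!mulmxA -e !mulmxA qq.
  have := congr1 (fun A : M => A^t*) h.
  by rewrite (adjM q) (adjM (Ez^t*) p) adjK pa qa.
apply: colmxP => v; have : mximage q (q *m v) by exists v.
rewrite im => -[_ [w _ <-] e]; rewrite -!mulmxA -e !mulmxA.
by rewrite -(mulmxA p Ey) yz mulmx1 mul1mx pp.
Qed.

Variables (p : M) (Ez Ey X Xz Xy q : R -> M).
Hypothesis hp : herm_projection p.
Hypothesis hq : forall x, herm_projection (q x).
Hypothesis eE : forall x, Ez x *m (Ey x)^t* = 1%:M.
Hypothesis r1 : forall x, p *m Ez x *m q x = p *m Ez x.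
Hypothesis r2 : forall x, p *m Ey x *m q x = Ey x *m q x.
Hypothesis dEz : forall x, mder Ez x (Ez x *m Xz x).
Hypothesis XX : forall x, (Xz x)^t* = - Xy x.

Let V x := (Ez x)^t* *m p.
Let U x := Ey x *m q x.

Let yz x : Ey x *m (Ez x)^t* = 1%:M.
Proof. by rewrite -{1}[Ey x]adjK -(adjM (Ez x)) eE adj1. Qed.

Let VU x : V x *m U x = q x.
Proof. by rewrite /V /U !mulmxA -(mulmxA _ p) -(mulmxA _ _ (q x)) r2 mulmxA (mulmx1C (yz x)) mul1mx. Qed.

Let Va x : (V x)^t* = p *m Ez x.
Proof. by rewrite /V (adjM _ p) adjK (adj_hproj hp). Qed.

Let Ua x : (U x)^t* = q x *m (Ey x)^t*.
Proof. by rewrite /U (adjM (Ey x)) (adj_hproj (hq x)). Qed.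

Let qV x : q x *m V x = V x.
Proof. by rewrite -[LHS]adjK (adjM (q x)) Va (adj_hproj (hq x)) r1 -Va adjK. Qed.

Let G x := (V x)^t* *m V x + (1%:M - p).
Let H x := U x *m (U x)^t* + (1%:M - p).

Let GH x : G x *m H x = 1%:M.
Proof.
have pp := mul_hproj hp; have pV : V x *m (1%:M - p) = 0.
  by rewrite /V -mulmxA mulmxBr mulmx1 pp subrr mulmx0.
have pU : (1%:M - p) *m U x = 0.
  by rewrite mulmxBl mul1mx /U mulmxA r2 subrr.
have VUa : (V x)^t* *m (q x *m (U x)^t*) = p.
  by rewrite mulmxA Va r1 Ua mulmxA r1 -mulmxA eE mulmx1.
rewrite /G /H; have PP : (1%:M - p) *m (1%:M - p) = 1%:M - p.
  by rewrite mulmxBl mul1mx mulmxBr mulmx1 pp subrr subr0.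
have p1 : p + (1%:M - p) = 1%:M by rewrite addrC subrK.
move: (1%:M - p) pV pU PP p1 => P' pV pU PP p1.
rewrite mulmxDl !mulmxDr -(mulmxA _ _ P') pV mulmx0 addr0 -mulmxA (mulmxA (V x)) VU VUa.
by rewrite (mulmxA P') pU mul0mx add0r PP.
Qed.

Let qE x : q x = V x *m invmx (G x) *m (V x)^t*.
Proof.
have [u _] := mulmx1_unit (GH x).
have -> : invmx (G x) = H x by rewrite -[LHS]mulmx1 -(GH x) mulKmx.
have pV : V x *m (1%:M - p) = 0.
  by rewrite /V -mulmxA mulmxBr mulmx1 (mul_hproj hp) subrr mulmx0.
rewrite /H mulmxDr pV addr0 mulmxA VU -mulmxA.
have -> : (U x)^t* *m (V x)^t* = q x by rewrite -(adjM (V x)) VU (adj_hproj (hq x)).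
by rewrite (mul_hproj (hq x)).
Qed.

Let dV x : mder V x (- Xy x *m V x).
Proof.
apply: mder_ext (mderMr p (mder_adj (dEz x))) _ _ => //.
by rewrite (adjM (Ez x)) XX /V mulmxA.
Qed.

Let dq_ex x : exists D, mder q x D.
Proof.
have dVa := mder_adj (dV x).
have dG : exists D, mder G x D.
  by eexists; apply: mderD (mderM dVa (dV x)) (mder_cst _ x).
have [D hD] := dG.
have uG s : G s \in unitmx := proj1 (mulmx1_unit (GH s)).
have dI := mder_invmx hD uG.
by eexists; apply: mder_ext (mderM (mderM (dV x) dI) dVa) _ erefl => s; rewrite -qE.
Qed.

Lemma projection_mder x :
  mder q x (q x *m Xz x *m (1%:M - q x) - (1%:M - q x) *m Xy x *m q x).
Proof.
have [D hD] := dq_ex x; suff <- : D = q x *m Xz x *m (1%:M - q x) - (1%:M - q x) *m Xy x *m q x by [].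
have Da : D^t* = D.
  apply: mder_unique (mder_adj hD) _.
  by apply: mder_ext hD _ erefl => s; rewrite (adj_hproj (hq s)).
have Dqq : D *m q x + q x *m D = D.
  apply: mder_unique (mderM hD hD) _.
  by apply: mder_ext hD _ erefl => s; rewrite (mul_hproj (hq s)).
have DV : D *m V x + q x *m (- Xy x *m V x) = - Xy x *m V x.
  apply: mder_unique (mderM hD (dV x)) _.
  by apply: mder_ext (dV x) _ erefl => s; rewrite qV.
have Dq : D *m q x = - ((1%:M - q x) *m Xy x *m q x).
  have : D *m V x = - ((1%:M - q x) *m Xy x *m V x).
    have -> : D *m V x = - Xy x *m V x - q x *m (- Xy x *m V x) by rewrite -{1}DV addrK.
    by move: (V x) (Xy x) => A B; mx_ring.
  by move=> /(congr1 (mulmx^~ (U x))); rewrite mulNmx -(mulmxA D) -(mulmxA _ (V x)) !VU.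
have qD : q x *m D = q x *m Xz x *m (1%:M - q x).
  rewrite -[LHS]adjK (adjM (q x)) Da (adj_hproj (hq x)) Dq.
  have Xya : (Xy x)^t* = - Xz x.
    by rewrite -[Xy x]opprK -XX (adjN _) adjK.
  rewrite (adjN _) (adjM _ (q x)) (adjM _ (Xy x)) Xya (adj_hproj (hq x)).
  have -> : (1%:M - q x)^t* = 1%:M - q x by rewrite (adjD 1%:M) adjN adj1 (adj_hproj (hq x)).
  by rewrite mulNmx mulmxN opprK mulmxA.
by rewrite -Dqq Dq qD addrC.
Qed.

End Projection.
Lemma mulmx_sub_expand (K : comPzRingType) n (A B A0 B0 : 'M[K]_n) :
  A *m B - A0 *m B0 = (A - A0) *m (B - B0) + (A - A0) *m B0 + A0 *m (B - B0).
Proof. by mx_ring. Qed.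

Lemma first_column_ode (K : comPzRingType) n (p E D Ey X a : 'M[K]_n) (l z : K) :
  p *m (E *m X) + (l - z) *: ((1%:M - p) *m (D *m X + Ey *m a)) =
  (p *m E + (l - z) *: ((1%:M - p) *m D)) *m X - (- ((l - z) *: ((1%:M - p) *m Ey))) *m a.
Proof. by mx_ring. Qed.

Lemma second_column_ode (K : comPzRingType) n (p E D Ez X a : 'M[K]_n) (l y : K) :
  (l - y) *: (p *m (D *m X + Ez *m a)) + (1%:M - p) *m (E *m X) =
  ((l - y) *: (p *m D) + (1%:M - p) *m E) *m X + (l - y) *: (p *m Ez) *m a.
Proof. by mx_ring. Qed.

Lemma shifted_potential (K : comPzRingType) n (a w : 'M[K]_n) (l z : K) :
  l *: a + w - (l - z) *: a = z *: a + w.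
Proof. by mx_ring. Qed.

Lemma column_quotient (K : comPzRingType) n (A Z D B : 'M[K]_n) (c : K) :
  A *m Z *m B = 0 -> c *: (A *m D *m B) = A *m (Z + c *: D) *m B.
Proof. by move=> h; rewrite mulmxDr scalemx_r mulmxDl scalemx_l h add0r. Qed.

Lemma dressed_factor (K : comPzRingType) n (p q E Dy Dz : 'M[K]_n) (l z y k : K) :
  q *m q = q -> k * (l - y) = l - z ->
  (l - y) *: ((1%:M - p) *m Dy *m q) = (1%:M - p) *m E *m q ->
  (l - z) *: (p *m Dz *m (1%:M - q)) = p *m E *m (1%:M - q) ->
  ((p *m E + (l - z) *: ((1%:M - p) *m Dy)) *m q +
   ((l - y) *: (p *m Dz) + (1%:M - p) *m E) *m (1%:M - q)) *m (q + k *: (1%:M - q))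
  = (p + k *: (1%:M - p)) *m E.
Proof.
move=> qq kE; have q1 : q *m (1%:M - q) = 0 by rewrite mulmxBr mulmx1 qq subrr.
have q2 : (1%:M - q) *m q = 0 by rewrite mulmxBl mul1mx qq subrr.
have q3 : (1%:M - q) *m (1%:M - q) = 1%:M - q by rewrite mulmxBr q2 mulmx1 subr0.
have q4 : q + (1%:M - q) = 1%:M by rewrite addrC subrK.
move: (1%:M - q) (1%:M - p) q1 q2 q3 q4 => q' p' q1 q2 q3 q4 e1 e2.
have two (P T : 'M[K]_n) : (P *m q + T *m q') *m (q + k *: q') = P *m q + k *: (T *m q').
  by rewrite mulmxDl !mulmxDr !scalemx_r -!mulmxA qq q1 q2 q3 !mulmx0 scaler0 addr0 add0r.
have split_col (A : 'M[K]_n) : A = A *m q + A *m q' by rewrite -mulmxDr q4 mulmx1.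
rewrite two !mulmxDl !scalemx_l scalerDr scalerA kE e2 -kE -scalerA e1.
by rewrite [p *m E in RHS]split_col [p' *m E in RHS]split_col; mx_entries; ring.
Qed.

(** * Holomorphic matrix functions and identities off finite sets *)

Section Holomorphy.
Variable R : realType.
Local Notation C := R[i].
Variable n : nat.
Local Notation M := 'M[C]_n.
Implicit Types (F G : C -> M) (l z : C).

Definition hol_at F l := forall i j, derivable (fun s : C^o => F s i j : C^o) l 1.

Lemma hol_cst (A : M) l : hol_at (fun=> A) l.
Proof. by move=> i j; apply: derivable_cst. Qed.

Lemma holD F G l : hol_at F l -> hol_at G l -> hol_at (fun s => F s + G s) l.
Proof.
move=> h k i j.
have -> : (fun s : C^o => (F s + G s) i j : C^o) = (fun s : C^o => F s i j : C^o) + (fun s : C^o => G s i j : C^o).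
  by apply/funext => s; rewrite mxD_ij.
exact: derivableD.
Qed.

Lemma holM F G l : hol_at F l -> hol_at G l -> hol_at (fun s => F s *m G s) l.
Proof.
move=> h k i j.
have -> : (fun s : C^o => (F s *m G s) i j : C^o) =
    \sum_(m < n) ((fun s : C^o => F s i m : C^o) * (fun s : C^o => G s m j : C^o)).
  by apply/funext => s; rewrite mxE fct_sumE.
by apply: derivable_sum => m; apply: derivableM.
Qed.

Lemma holZ (f : C -> C) F l : derivable (f : C^o -> C^o) l 1 -> hol_at F l ->
  hol_at (fun s => f s *: F s) l.
Proof.
move=> hf h i j.
have -> : (fun s : C^o => (f s *: F s) i j : C^o) = (f : C^o -> C^o) * (fun s : C^o => F s i j : C^o).
  by apply/funext => s; rewrite mxZ_ij.
exact: (derivableM hf (h i j)).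
Qed.

Lemma derivable_sub z l : derivable (fun s : C^o => s - z : C^o) l 1.
Proof. exact: derivableB. Qed.

Lemma derivable_ratio z y l : l != y -> derivable (fun s : C^o => (s - z) / (s - y) : C^o) l 1.
Proof.
move=> ly.
have h : derivable (fun s : C^o => (s - y)^-1 : C^o) l 1.
  by apply: derivableV; [rewrite subr_eq0 | exact: derivable_sub].
have k := @derivable_sub z l.
have -> : (fun s : C^o => (s - z) / (s - y) : C^o) =
  (fun s : C^o => s - z : C^o) * (fun s : C^o => (s - y)^-1 : C^o) by [].
exact: (derivableM k h).
Qed.

Lemma hol_simple z P l : l != (z^*)%R -> hol_at (simple_element z P) l.
Proof.
move=> lz; apply: holD; first exact: hol_cst.
by apply: holZ; [exact: derivable_ratio | exact: hol_cst].
Qed.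

Lemma hol_near F G l : (exists2 r : R, 0 < r & forall s, cn (s - l) < r -> F s = G s) ->
  hol_at F l -> hol_at G l.
Proof.
move=> [r r0 e] h i j; apply: near_eq_derivable (h i j).
exists (r / 2)%:C; first by rewrite /= ltcR divr_gt0.
move=> s; rewrite /ball_ /= distrC => sr; rewrite e //.
rewrite -ltcR; apply: le_lt_trans (cn_le_norm _) _.
by rewrite [X in _ < X%:C](splitr r) rmorphD mulr2n ltrD.
Qed.

(** Continuity at l in the form needed to extend an identity over finitely many points. *)
Definition mcont F l := forall e : R, 0 < e -> exists2 r : R, 0 < r &
  forall s, cn (s - l) < r -> mn (F s - F l) < e.

Lemma hol_mcont F l : hol_at F l -> mcont F l.
Proof.
move=> h e e0; pose m : R := (n * n)%:R + 1.
have m0 : 0 < m by rewrite ltr_wpDl.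
have e'0 : 0 < e / m by rewrite divr_gt0.
have ex ij : exists r : R, 0 < r /\ forall s, cn (s - l) < r -> cn (F s ij.1 ij.2 - F l ij.1 ij.2) < e / m.
  by have [r r0 hr] := derivable_cn_continuous (h ij.1 ij.2) e'0; exists r.
have [r hr] := choice ex.
exists (\big[Num.min/1]_ij r ij).
  by apply: (big_ind (fun x : R => 0 < x)) => [|u v u0 v0|ij _]; [exact: ltr01 | rewrite lt_min u0 | have [] := hr ij].
move=> s sr; apply: (@le_lt_trans _ _ ((n * n)%:R * (e / m))).
  apply: mn_le => i j; rewrite mxD_ij mxN_ij; apply: ltW; have [_] := hr (i, j); apply.
  by apply: lt_le_trans sr _; apply: (bigmin_le_cond _ (j := (i, j))).
rewrite mulrCA -[ltRHS]mulr1 ltr_pM2l // ltr_pdivrMr // mul1r.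
by rewrite ltrDl.
Qed.

Lemma mcont_cst (A : M) l : mcont (fun=> A) l.
Proof. by move=> e e0; exists 1 => // s _; rewrite subrr mn0. Qed.

Lemma mcont_adj F l : mcont F (l^*)%R -> mcont (fun s => (F (s^*)%R)^t*) l.
Proof.
move=> h e e0; have [r r0 hr] := h e e0; exists r => // s sr.
have -> : (F (s^*)%R)^t* - (F (l^*)%R)^t* = (F (s^*)%R - F (l^*)%R)^t*.
  by rewrite (adjD (F (s^*)%R)) adjN.
by rewrite mnJ; apply: hr; rewrite -rmorphB cnJ.
Qed.

Lemma mcontM F G l : mcont F l -> mcont G l -> mcont (fun s => F s *m G s) l.
Proof.
move=> h k e e0.
pose K := mn (F l) + mn (G l) + 1.
have K0 : 0 < K by rewrite ltr_wpDl // addr_ge0 ?mn_ge0.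
pose e' := Num.min 1 (e / 2 / K).
have e'0 : 0 < e' by rewrite lt_min ltr01 !divr_gt0.
have [r1 r10 h1] := h e' e'0; have [r2 r20 h2] := k e' e'0.
exists (Num.min r1 r2); first by rewrite lt_min r10.
move=> s; rewrite lt_min => /andP[/h1 f /h2 g].
have -> : F s *m G s - F l *m G l = (F s - F l) *m (G s - G l) + (F s - F l) *m G l + F l *m (G s - G l).
  exact: mulmx_sub_expand.
apply: (@le_lt_trans _ _ (e' * K)).
  apply: le_trans (mnD _ _) _; apply: le_trans (lerD (mnD _ _) (lexx _)) _.
  apply: le_trans (lerD (lerD (mnM _ _) (mnM _ _)) (mnM _ _)) _.
  have f0 := mn_ge0 (F s - F l); have g0 := mn_ge0 (G s - G l).
  have a0 := mn_ge0 (F l); have b0 := mn_ge0 (G l).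
  have g1 : mn (G s - G l) <= 1 by rewrite (le_trans (ltW g)) // ge_min lexx.
  apply: (@le_trans _ _ (e' * 1 + e' * mn (G l) + mn (F l) * e')); last by rewrite /K; lra.
  apply: lerD; first by apply: lerD; apply: ler_pM => //; exact: ltW.
  by apply: ler_pM => //; exact: ltW.
apply: (@le_lt_trans _ _ (e / 2)); last by lra.
by rewrite -ler_pdivlMr // ge_min lexx orbT.
Qed.

Lemma mcont_eq F G l : mcont F l -> mcont G l ->
  almost_all (fun s => F s = G s) -> F l = G l.
Proof.
move=> h k fS.
have : mn (F l - G l) <= 0.
  apply: (@le_of_le_addeps _ _ _ 2 1) => // e e0 _.
  have [r1 r10 h1] := h e e0; have [r2 r20 h2] := k e e0.
  have rm : 0 < Num.min r1 r2 by rewrite lt_min r10.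
  have [r [r0 rlt hS]] := near_point l fS rm.
  have fg : F (l + r%:C) = G (l + r%:C) by apply: contrapT.
  have cl : cn (l + r%:C - l) = r by rewrite addrC addKr cn_real // ltW.
  move: rlt; rewrite lt_min => /andP[rr1 rr2].
  have := h1 (l + r%:C); have := h2 (l + r%:C); rewrite cl => /(_ rr2) k2 /(_ rr1) k1.
  have -> : F l - G l = (G (l + r%:C) - G l) - (F (l + r%:C) - F l) by rewrite fg; mx_ring.
  by apply: le_trans (mnB _ _) _; lra.
move=> h0; apply/eqP; rewrite -subr_eq0; apply/eqP/matrixP => i j; rewrite [RHS]mxE.
apply/eqP; rewrite -cn_eq0 eq_le cn_ge0 andbT.
exact: le_trans (cn_le_mn _ i j) h0.
Qed.

Lemma aa_and (P Q : C -> Prop) : almost_all P -> almost_all Q ->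
  almost_all (fun l => P l /\ Q l).
Proof.
rewrite /almost_all => h k; apply: (@sub_finite_set _ _ ([set l | ~ P l] `|` [set l | ~ Q l])).
  by move=> l /=; have [?|?] := pselect (P l); have [?|?] := pselect (Q l); tauto.
by rewrite finite_setU.
Qed.

Lemma aaW (P Q : C -> Prop) : (forall l, P l -> Q l) -> almost_all P -> almost_all Q.
Proof. by move=> PQ; apply: sub_finite_set => l /= nq /PQ. Qed.

Lemma aa_conj (P : C -> Prop) : almost_all P -> almost_all (fun l => P (l^*)%R).
Proof.
rewrite /almost_all => h.
apply: (@sub_finite_set _ _ ((fun l : C => (l^*)%R) @` [set l | ~ P l])).
  by move=> l /= nP; exists (l^*)%R => //; rewrite conjCK.
exact: finite_image.
Qed.

Lemma aa_neq (z : C) : almost_all (fun l => l != z).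
Proof.
apply: (@sub_finite_set _ _ [set z]); last exact: finite_set1.
by move=> l /= /negP; rewrite negbK => /eqP.
Qed.

End Holomorphy.

(** * Dressing of an extended frame *)

Section SingleDressing.
Variable R : realType.
Local Notation C := R[i].
Variable n : nat.
Local Notation M := 'M[C]_n.

(** What the dressing construction uses of a trivialization: its x-equation, its reality
    condition and its divided differences in the spectral parameter. *)
Record extended_frame (dom : C -> Prop) (a : M) (u : R -> R -> M) (E : R -> R -> C -> M) : Prop := ExtendedFrame {
  frame_aa : almost_all dom;
  frame_conj : forall l, dom l -> dom (l^*)%R;
  frame_nonreal : forall l, l \isn't Num.real -> dom l;
  frame_a : u_n a;
  frame_u : forall x t, u_n (u x t);
  frame_ode : forall x t l, dom l -> mder (fun s => E s t l) x (E x t l *m (l *: a + u x t));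
  frame_unit : forall x t l, dom l -> E x t l *m (E x t (l^*)%R)^t* = 1%:M;
  frame_jet : forall l0 t, dom l0 ->
    exists d E1 E2, [/\ 0 < d, jet l0 d (fun x => E x t) E1 E2 &
    forall l s, cn (l - l0) < d ->
      mder (E1^~ l) s (E1 s l *m (l0 *: a + u s t) + E s t l *m a)] }.

Variables (dom : C -> Prop) (a : M) (u : R -> R -> M) (E : R -> R -> C -> M).
Hypothesis fr : extended_frame dom a u E.

Lemma frame_hol x t l : dom l -> hol_at (E x t) l.
Proof.
move=> /(frame_jet fr t)[d [E1 [E2 [d0 [q1 _ _ h1 _] _]]]] i j.
exact: (quotient_derivable d0 q1 h1).
Qed.

(** At l = z this is the parameter derivative of E; the equation in x holds there as well. *)
Lemma divided_difference z : dom z -> exists D : R -> R -> C -> M,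
  [/\ forall x t l, E x t l = E x t z + (l - z) *: D x t l,
      forall x t l, dom l -> hol_at (D x t) l &
      forall x t l, dom l -> mder (fun s => D s t l) x (D x t l *m (l *: a + u x t) + E x t z *m a)].
Proof.
move=> dz; pose good t (E1 : R -> C -> M) := exists d E2, [/\ 0 < d, jet z d (fun x => E x t) E1 E2 &
    forall l s, cn (l - z) < d ->
      mder (E1^~ l) s (E1 s l *m (z *: a + u s t) + E s t l *m a)].
have ex t : exists E1, good t E1.
  by have [d [E1 [E2 h]]] := frame_jet fr t dz; exists E1, d, E2.
have [E1 hE1] := choice ex.
pose D x t l := if l == z then E1 t x z else (l - z)^-1 *: (E x t l - E x t z).
have DE x t l : E x t l = E x t z + (l - z) *: D x t l.
  rewrite /D; case: eqVneq => [->|lz]; first by rewrite subrr scale0r addr0.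
  by rewrite scalerA mulfV ?subr_eq0 // scale1r addrC subrK.
exists D; split=> // x t l dl.
  have [->|lz] := eqVneq l z.
    have [d [E2 [d0 [q1 q2 _ _ h2] _]]] := hE1 t.
    apply: (@hol_near _ _ (E1 t x)).
      exists d => // s sd; rewrite /D; case: eqVneq => [->//|sz].
      have -> : E x t s - E x t z = (s - z) *: E1 t x s by rewrite (q1 x s sd) addrC addKr.
      by rewrite scalerA mulVf ?subr_eq0 // scale1r.
    by move=> i j; apply: (quotient_derivable d0 q2 h2).
  apply: (@hol_near _ _ (fun s => (s - z)^-1 *: (E x t s - E x t z))).
    exists (cn (l - z)); first by rewrite cn_gt0 subr_eq0.
    move=> s sl; rewrite /D ifN_eq //; apply: contraTneq sl => ->.
    by rewrite -cnN opprB ltxx.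
  apply: holZ.
    by apply: derivableV; [rewrite subr_eq0 | exact: derivable_sub].
  by apply: holD; [exact: frame_hol | exact: hol_cst].
have [->|lz] := eqVneq l z.
  have [d [E2 [d0 [q1 _ _ _ _] dE]]] := hE1 t.
  have e0 : cn (z - z) < d by rewrite cn_l00.
  by apply: mder_ext (dE z x e0) _ _; rewrite /D eqxx.
have dD := mderZ (l - z)^-1 (mderB (frame_ode fr x t dl) (frame_ode fr x t dz)).
apply: mder_ext dD _ _ => [s|]; first by rewrite /D (negPf lz).
rewrite /D (negPf lz) scalemx_l.
have -> : E x t l *m (l *: a + u x t) - E x t z *m (z *: a + u x t) =
   (E x t l - E x t z) *m (l *: a + u x t) + (l - z) *: (E x t z *m a).
  by move: (E x t l) (E x t z) (u x t) => A B W; mx_ring.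
by rewrite scalerDr scalerA mulVf ?subr_eq0 // scale1r.
Qed.

Variables (z : C) (p : M) (q : R -> R -> M).
Hypothesis nz : z \isn't Num.real.
Hypothesis hp : herm_projection p.
Hypothesis hq : forall x t,
  is_herm_projection_onto [set (E x t z)^t* *m v | v in mximage p] (q x t).

Let zb := (z^*)%R.

Let dz : dom z. Proof. exact: (frame_nonreal fr). Qed.
Let dzb : dom zb. Proof. exact: (frame_conj fr dz). Qed.

Lemma frame_proj x t : herm_projection (q x t). Proof. by have [] := hq x t. Qed.

(** These relations cancel the poles of the dressed frame at z and at conj z. *)
Lemma frame_proj_rel x t : p *m E x t z *m q x t = p *m E x t z /\
  p *m E x t zb *m q x t = E x t zb *m q x t.
Proof. exact: (projection_onto_rel hp (frame_unit fr x t dz) (hq x t)). Qed.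

Lemma frame_proj_mder x t : mder (q^~ t) x
  (q x t *m (z *: a + u x t) *m (1%:M - q x t) - (1%:M - q x t) *m (zb *: a + u x t) *m q x t).
Proof.
have XX s : (z *: a + u s t)^t* = - (zb *: a + u s t).
  by rewrite (adjD (z *: a)) (adjZ z) (frame_a fr) (frame_u fr) /zb scalerN opprD.
exact: (projection_mder hp (fun x => frame_proj x t) (fun x => frame_unit fr x t dz)
   (fun x => proj1 (frame_proj_rel x t)) (fun x => proj2 (frame_proj_rel x t))
   (fun x => frame_ode fr x t dz) XX).
Qed.

(** With P = p E + (l - z) (1 - p) Dy and T = (l - conj z) p Dz + (1 - p) E, where Dz and Dy
    are the divided differences of E at z and conj z, the matrix P q + T (1 - q) equals
    g_{z,p} E g_{z,q}^-1 away from z and conj z, and it has no pole there. *)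
Lemma single_dressing : exists F : R -> R -> C -> M,
  [/\ forall x t l, dom l -> hol_at (F x t) l,
      forall x t l, dom l -> mder (fun s => F s t l) x
        (F x t l *m (l *: a + (u x t + (z - zb) *: lie (q x t) a)))
    & forall x t l, l != z -> l != zb ->
        F x t l *m simple_element z (q x t) l = simple_element z p l *m E x t l].
Proof.
have [Dz [Dz1 Dz2 Dz3]] := divided_difference dz.
have [Dy [Dy1 Dy2 Dy3]] := divided_difference dzb.
pose P x t l := p *m E x t l + (l - z) *: ((1%:M - p) *m Dy x t l).
pose T x t l := (l - zb) *: (p *m Dz x t l) + (1%:M - p) *m E x t l.
have pp := mul_hproj hp.
exists (fun x t l => P x t l *m q x t + T x t l *m (1%:M - q x t)); split.
- move=> x t l dl; have hE := frame_hol (x := x) (t := t) dl.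
  have hP : hol_at (P x t) l.
    have k1 := holM (@hol_cst R n p l) hE; have k2 := holM (@hol_cst R n (1%:M - p) l) (Dy2 x t l dl).
    exact: (holD k1 (holZ (@derivable_sub R z l) k2)).
  have hT : hol_at (T x t) l.
    have k1 := holM (@hol_cst R n (1%:M - p) l) hE; have k2 := holM (@hol_cst R n p l) (Dz2 x t l dl).
    exact: (holD (holZ (@derivable_sub R zb l) k2) k1).
  exact: (holD (holM hP (@hol_cst R n _ l)) (holM hT (@hol_cst R n _ l))).
- move=> x t l dl; have dE := frame_ode fr x t dl.
  have dP : mder (fun s => P s t l) x _ := mderD (mderMl p dE) (mderZ (l - z) (mderMl (1%:M - p) (Dy3 x t l dl))).
  have dT : mder (fun s => T s t l) x _ := mderD (mderZ (l - zb) (mderMl p (Dz3 x t l dl))) (mderMl (1%:M - p) dE).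
  have dq := frame_proj_mder x t.
  have dq1 := mderB (mder_cst 1%:M x) dq.
  apply: mder_ext (mderD (mderM dP dq) (mderM dT dq1)) _ _ => //.
  have [r1 r2] := frame_proj_rel x t.
  pose N := (l - zb) *: P x t l - (l - z) *: T x t l.
  have NE : N = (l - zb) *: (p *m E x t z) - (l - z) *: ((1%:M - p) *m E x t zb).
    by apply: dressed_residue_algebra.
  have N0 : N = (l - zb) *: P x t l - (l - z) *: T x t l := erefl N.
  have qq := mul_hproj (frame_proj x t).
  have Nq : N *m q x t = (l - zb) *: (p *m E x t z).
    rewrite NE mulmxBl !scalemx_l r1 mulmxBl mul1mx mulmxBl r2 subrr scaler0 subr0 //.
  have Nq1 : N *m (1%:M - q x t) = - ((l - z) *: ((1%:M - p) *m E x t zb)).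
    by rewrite mulmxBr mulmx1 Nq NE addrC addKr.
  rewrite sub0r [l *: a + (_ + _)]addrA /lie.
  set X := l *: a + u x t in dE *.
  have h1 : p *m (E x t l *m X) + (l - z) *: ((1%:M - p) *m (Dy x t l *m X + E x t zb *m a)) =
      P x t l *m X - N *m (1%:M - q x t) *m a.
    rewrite Nq1 /P; exact: first_column_ode.
  have h2 : (l - zb) *: (p *m (Dz x t l *m X + E x t z *m a)) + (1%:M - p) *m (E x t l *m X) =
      T x t l *m X + N *m q x t *m a.
    rewrite Nq /T; exact: second_column_ode.
  have h3 : q x t *m (z *: a + u x t) *m (1%:M - q x t) - (1%:M - q x t) *m (zb *: a + u x t) *m q x t =
      q x t *m (X - (l - z) *: a) *m (1%:M - q x t) - (1%:M - q x t) *m (X - (l - zb) *: a) *m q x t.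
    by rewrite /X !shifted_potential.
  clearbody N X.
  exact: (dressed_ode_algebra qq N0 h1 h2 h3).
- move=> x t l lz lzb; have [r1 r2] := frame_proj_rel x t.
  have qq := mul_hproj (frame_proj x t).
  have e1 : (l - zb) *: ((1%:M - p) *m Dy x t l *m q x t) = (1%:M - p) *m E x t l *m q x t.
    rewrite (Dy1 x t l); apply: column_quotient.
    by rewrite mulmxBl mul1mx mulmxBl r2 subrr.
  have e2 : (l - z) *: (p *m Dz x t l *m (1%:M - q x t)) = p *m E x t l *m (1%:M - q x t).
    rewrite (Dz1 x t l); apply: column_quotient.
    by rewrite mulmxBr mulmx1 r1 subrr.
  set k := (l - z) / (l - zb).
  have lzb' : l - zb != 0 by rewrite subr_eq0.
  have kE : k * (l - zb) = l - z by rewrite /k divfK.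
  exact: (dressed_factor qq kE e1 e2).
Qed.

(** Unitarity holds off the poles, and everywhere by continuity in l. *)
Lemma dressed_unitary (Ex F g gt : C -> M) : (forall l, dom l -> Ex l *m (Ex (l^*)%R)^t* = 1%:M) ->
  (forall l, dom l -> hol_at F l) ->
  almost_all (fun l => (g (l^*)%R)^t* *m g l = 1%:M) ->
  almost_all (fun l => (gt (l^*)%R)^t* *m gt l = 1%:M) ->
  almost_all (fun l => g l *m Ex l = F l *m gt l) ->
  forall l, dom l -> (F (l^*)%R)^t* *m F l = 1%:M.
Proof.
move=> hE hF hg hgt hfac l dl.
apply: (@mcont_eq _ _ (fun s => (F (s^*)%R)^t* *m F s) (fun=> 1%:M)).
- apply: mcontM; last exact/hol_mcont/hF.
  by apply: mcont_adj; apply/hol_mcont/hF/(frame_conj fr).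
- exact: mcont_cst.
have := aa_and (aa_and hg hgt) (aa_and (aa_and hfac (aa_conj hfac)) (frame_aa fr)).
apply: aaW => s [[e1 e2] [[e3 e4] ds]].
have e5 : (Ex (s^*)%R)^t* *m Ex s = 1%:M by apply: mulmx1C; exact: hE.
have e6 := mulmx1C e2.
have e7 : (gt (s^*)%R)^t* *m ((F (s^*)%R)^t* *m F s) *m gt s = 1%:M.
  rewrite mulmxA -(adjM (F (s^*)%R)) -e4 -mulmxA -e3 (adjM (g (s^*)%R)).
  by rewrite mulmxA -(mulmxA _ _ (g s)) e1 mulmx1 e5.
have := congr1 (fun A : M => gt s *m A *m (gt (s^*)%R)^t*) e7.
by rewrite mulmx1 e6 !mulmxA e6 mul1mx -!mulmxA e6 mulmx1.
Qed.

End SingleDressing.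
(** * Dressing by two simple elements *)

Section DoubleAlgebra.
Variables (K : comPzRingType) (n : nat).
Implicit Types (a u q dq t A B E P Q X Y L : 'M[K]_n) (l z y c : K).

Lemma degree_one_ode a u q dq l z y : q *m q = q ->
  dq = q *m (z *: a + u) *m (1%:M - q) - (1%:M - q) *m (y *: a + u) *m q ->
  ((l - z) *: 1%:M + (z - y) *: q) *m (l *: a + u) - (z - y) *: dq =
  (l *: a + (u + (z - y) *: (q *m a - a *m q))) *m ((l - z) *: 1%:M + (z - y) *: q).
Proof.
move=> qq ->; have qqA A : A *m q *m q = A *m q by rewrite -mulmxA qq.
mx_expand; rewrite ?(qq, qqA); mx_entries; ring.
Qed.

Lemma degree_one_defect a u t dt l z c :
  ((l - z) *: 1%:M + c *: t) *m (l *: a + u) - c *: dt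
  - (l *: a + (u + c *: (t *m a - a *m t))) *m ((l - z) *: 1%:M + c *: t)
  = (c *: t - z *: 1%:M) *m u - c *: dt - (u + c *: (t *m a - a *m t)) *m (c *: t - z *: 1%:M).
Proof. mx_ring. Qed.

Lemma defect_mul A L X X1 X3 dA dL : L *m X - dL = X1 *m L ->
  (A *m X1 - dA - X3 *m A) *m L = (A *m L) *m X - (dA *m L + A *m dL) - X3 *m (A *m L).
Proof.
move=> h; have e : A *m X1 *m L = A *m L *m X - A *m dL by rewrite -mulmxA -h mulmxBr mulmxA.
by rewrite !mulmxBl e mulmxA; mx_entries; ring.
Qed.

(** Compare the coefficients of l in two equal pencils. *)
Lemma linear_pencil_eq0 Y Y' P P' z z' :
  (forall l, Y *m ((l - z) *: 1%:M + P) = Y' *m ((l - z') *: 1%:M + P')) ->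
  Y = Y' /\ Y *m ((z' - z) *: 1%:M + P - P') = 0.
Proof.
move=> h; have e0 := h 0; have e1 := h 1.
have YY : Y = Y'.
  have -> : Y = Y *m ((1 - z) *: 1%:M + P) - Y *m ((0 - z) *: 1%:M + P) by mx_ring.
  by rewrite e0 e1; mx_ring.
split=> //; have -> : Y *m ((z' - z) *: 1%:M + P - P') =
    Y *m ((0 - z) *: 1%:M + P) - Y *m ((0 - z') *: 1%:M + P') by mx_ring.
by rewrite e0 YY subrr.
Qed.

(** The quadratic dressing matrix has two factorizations. The failure Y of the equation of the
    left factor does not depend on l (degree_one_defect), and Y times the right factor is the
    failure of the equation of the product, so it is the same for both factorizations; then
    linear_pencil_eq0 gives Y phi = 0. *)
Lemma left_factor_ode a u u1 u2 u3 q1 q2 t1 t2 dq1 dq2 dt1 dt2 z1 z2 c1 c2 :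
  let L z c q l := (l - z) *: 1%:M + c *: q in
  (forall l, L z2 c2 t2 l *m L z1 c1 q1 l = L z1 c1 t1 l *m L z2 c2 q2 l) ->
  (forall l, (c2 *: dt2) *m L z1 c1 q1 l + L z2 c2 t2 l *m (c1 *: dq1) =
             (c1 *: dt1) *m L z2 c2 q2 l + L z1 c1 t1 l *m (c2 *: dq2)) ->
  (forall l, L z1 c1 q1 l *m (l *: a + u) - c1 *: dq1 = (l *: a + u1) *m L z1 c1 q1 l) ->
  (forall l, L z2 c2 q2 l *m (l *: a + u) - c2 *: dq2 = (l *: a + u2) *m L z2 c2 q2 l) ->
  u3 = u1 + c2 *: (t2 *m a - a *m t2) -> u3 = u2 + c1 *: (t1 *m a - a *m t1) ->
  (forall Y, Y *m ((z2 - z1) *: 1%:M + c1 *: q1 - c2 *: q2) = 0 -> Y = 0) ->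
  (forall l, L z2 c2 t2 l *m (l *: a + u1) - c2 *: dt2 = (l *: a + u3) *m L z2 c2 t2 l) /\
  (forall l, L z1 c1 t1 l *m (l *: a + u2) - c1 *: dt1 = (l *: a + u3) *m L z1 c1 t1 l).
Proof.
move=> L fac dfac ode1 ode2 e3 e3' inj.
pose Y := (c2 *: t2 - z2 *: 1%:M) *m u1 - c2 *: dt2 - u3 *m (c2 *: t2 - z2 *: 1%:M).
pose Y' := (c1 *: t1 - z1 *: 1%:M) *m u2 - c1 *: dt1 - u3 *m (c1 *: t1 - z1 *: 1%:M).
have YE l : L z2 c2 t2 l *m (l *: a + u1) - c2 *: dt2 - (l *: a + u3) *m L z2 c2 t2 l = Y.
  by rewrite /Y e3; exact: degree_one_defect.
have YE' l : L z1 c1 t1 l *m (l *: a + u2) - c1 *: dt1 - (l *: a + u3) *m L z1 c1 t1 l = Y'.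
  by rewrite /Y' e3'; exact: degree_one_defect.
have pencil l : Y *m L z1 c1 q1 l = Y' *m L z2 c2 q2 l.
  rewrite -(YE l) -(YE' l) (defect_mul _ _ _ (ode1 l)) (defect_mul _ _ _ (ode2 l)).
  by rewrite fac dfac.
have [YY /inj Y0] := linear_pencil_eq0 pencil.
split=> l; apply/eqP; rewrite -subr_eq0; apply/eqP; first by rewrite YE.
by rewrite YE' -YY.
Qed.

Lemma lie_exchange a u (A B A' B' : 'M[K]_n) c d :
  c *: A' = d *: B' + c *: A - d *: B ->
  u + c *: lie A a + d *: lie B' a = u + c *: lie A' a + d *: lie B a.
Proof.
move=> e; have d1 k (P : 'M[K]_n) : k *: lie P a = (k *: P) *m a - a *m (k *: P).
  by rewrite /lie; mx_ring.
rewrite !d1 e; mx_ring.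
Qed.

Lemma conjugate_exchange A B A' B' E P Q P' Q' : A *m B = A' *m B' ->
  P *m Q = P' *m Q' -> A *m (B *m E *m P) *m Q = A' *m (B' *m E *m P') *m Q'.
Proof.
move=> h k; rewrite -!mulmxA k !mulmxA h //.
Qed.

Lemma mulmx_cancel_mid A B Q P X : P *m X = 1%:M ->
  A *m B *m P *m (X *m Q) = A *m (B *m Q).
Proof. by move=> h; rewrite -!mulmxA (mulmxA P) h mul1mx. Qed.

End DoubleAlgebra.

Lemma inverse_exchange (K : comUnitRingType) n (A B A' B' P Q P' Q' : 'M[K]_n) :
  A *m B = A' *m B' -> A *m P = 1%:M -> B *m Q = 1%:M -> A' *m P' = 1%:M ->
  B' *m Q' = 1%:M -> Q *m P = Q' *m P'.
Proof.
move=> h hA hB hA' hB'.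
have e : (A *m B) *m (Q *m P) = 1%:M by rewrite -mulmxA (mulmxA B) hB mul1mx.
have e' : (A' *m B') *m (Q' *m P') = 1%:M by rewrite -mulmxA (mulmxA B') hB' mul1mx.
by rewrite -[LHS]mulmx1 -e' -h mulmxA (mulmx1C e) mul1mx.
Qed.


Section DoubleDressing.
Variable R : realType.
Local Notation C := R[i].
Variable n : nat.
Local Notation M := 'M[C]_n.

Lemma mder_simple (P : R -> M) x dP z l : mder P x dP ->
  mder (fun s => simple_element z (P s) l) x (dP + ((l - z) / (l - (z^*)%R)) *: (- dP)).
Proof.
move=> h; apply: mder_ext (mderD h (mderZ _ (mderB (mder_cst 1%:M x) h))) _ _ => //.
by rewrite sub0r.
Qed.

(** The inverse of g_{z,P} is g_{conj z,P}; the hypothesis says that g_{z,P} is a gauge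
    transformation from X1 to X3. *)
Lemma redress_mder (F P : R -> M) (g dP X1 X3 : M) x z l :
  (forall s, herm_projection (P s)) -> l != z -> l != (z^*)%R ->
  mder F x (F x *m X1) -> mder P x dP ->
  ((l - z) *: 1%:M + (z - (z^*)%R) *: P x) *m X1 - (z - (z^*)%R) *: dP =
  X3 *m ((l - z) *: 1%:M + (z - (z^*)%R) *: P x) ->
  mder (fun s => g *m F s *m simple_element (z^*)%R (P s) l) x
    (g *m F x *m simple_element (z^*)%R (P x) l *m X3).
Proof.
move=> hP lz lzb hF hdP rel.
pose S s := simple_element z (P s) l; pose T s := simple_element (z^*)%R (P s) l.
have ST s : S s *m T s = 1%:M by exact: simple_elementV.
have TS s : T s *m S s = 1%:M by exact: mulmx1C.
have [dS hS] : exists D, mder S x D by eexists; exact: mder_simple.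
have [dT hT] : exists D, mder T x D by eexists; exact: mder_simple.
have dSE : dS = (l - (z^*)%R)^-1 *: ((z - (z^*)%R) *: dP).
  apply: mder_unique hS _.
  have h1 := mderZ (l - (z^*)%R)^-1 (mderD (mder_cst ((l - z) *: 1%:M) x) (mderZ (z - (z^*)%R) hdP)).
  by apply: mder_ext h1 _ _ => [s|]; rewrite ?add0r // /S simple_element_lin.
have relS : S x *m X1 - dS = X3 *m S x.
  rewrite dSE /S (simple_element_lin _ lzb) scalemx_l scalemx_r -scalerBr.
  by rewrite rel.
have dTS : dT = - (T x *m dS *m T x).
  have e : dT *m S x + T x *m dS = 0.
    apply: mder_unique (mderM hT hS) _.
    by apply: mder_ext (mder_cst 1%:M x) _ erefl => s; rewrite TS.
  have : dT *m S x = - (T x *m dS) by apply/eqP; rewrite -addr_eq0 e.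
  by move=> /(congr1 (mulmx^~ (T x))); rewrite -mulmxA ST mulmx1 mulNmx.
have key : X1 *m T x + dT *m 1%:M = T x *m X3.
  have := congr1 (fun A : M => T x *m A *m T x) relS.
  rewrite mulmxBr mulmxBl !mulmxA TS mul1mx -(mulmxA _ (S x)) ST mulmx1 => <-.
  by rewrite mulmx1 dTS.
rewrite mulmx1 in key.
apply: mder_ext (mderM (mderMl g hF) hT) _ _ => //.
by rewrite -!mulmxA -!mulmxDr key.
Qed.

Variables (dom : C -> Prop) (a : M) (u : R -> R -> M) (E : R -> R -> C -> M).
Hypothesis fr : extended_frame dom a u E.
Variables (z1 z2 : C) (p1 p2 : M) (q1 q2 : R -> R -> M).
Hypotheses (nr1 : z1 \isn't Num.real) (nr2 : z2 \isn't Num.real).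
Hypotheses (z12 : z1 != z2) (z12b : z1 != (z2^*)%R).
Hypotheses (hp1 : herm_projection p1) (hp2 : herm_projection p2).
Hypothesis hq1 : forall x t,
  is_herm_projection_onto [set (E x t z1)^t* *m v | v in mximage p1] (q1 x t).
Hypothesis hq2 : forall x t,
  is_herm_projection_onto [set (E x t z2)^t* *m v | v in mximage p2] (q2 x t).

Let y1 := (z1^*)%R.
Let y2 := (z2^*)%R.
Let c1 := z1 - y1.
Let c2 := z2 - y2.
Let phi := bianchi_phi z1 z2 p1 p2.
Let phit x t := bianchi_phi z1 z2 (q1 x t) (q2 x t).
Let t1 x t := phit x t *m q1 x t *m invmx (phit x t).
Let t2 x t := phit x t *m q2 x t *m invmx (phit x t).
Let r1 := phi *m p1 *m invmx phi.
Let r2 := phi *m p2 *m invmx phi.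

Let Q1 x t : herm_projection (q1 x t). Proof. exact: frame_proj hq1 x t. Qed.
Let Q2 x t : herm_projection (q2 x t). Proof. exact: frame_proj hq2 x t. Qed.

Let T1 x t : herm_projection (t1 x t).
Proof. exact: (tau1_hproj (Q1 x t) (Q2 x t) z12 z12b). Qed.
Let T2 x t : herm_projection (t2 x t).
Proof. exact: (tau2_hproj (Q1 x t) (Q2 x t) z12 z12b). Qed.

Let phit_unit x t : phit x t \in unitmx.
Proof. exact: (phi_unit (Q1 x t) (Q2 x t) z12 z12b). Qed.

Let phitE x t : phit x t = (z2 - z1) *: 1%:M + c1 *: q1 x t - c2 *: q2 x t.
Proof. by rewrite /phit /bianchi_phi scalemx1. Qed.

Let dq1 x t := frame_proj_mder fr nr1 hp1 hq1 x t.
Let dq2 x t := frame_proj_mder fr nr2 hp2 hq2 x t.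

Let dt_ex (q : R -> R -> M) x t D : mder (q^~ t) x D ->
  exists D, mder (fun s => phit s t *m q s t *m invmx (phit s t)) x D.
Proof.
move=> h; have dphi : exists D, mder (phit^~ t) x D.
  have k := mderB (mderD (mder_cst ((z2 - z1) *: 1%:M) x) (mderZ c1 (dq1 x t))) (mderZ c2 (dq2 x t)).
  by eexists; apply: mder_ext k _ erefl => s; rewrite phitE.
have [D' hD'] := dphi; have k := mder_invmx hD' (fun s => phit_unit s t).
by eexists; exact: (mderM (mderM hD' h) k).
Qed.

Definition double_potential x t := u x t + c1 *: lie (q1 x t) a + c2 *: lie (t2 x t) a.

Lemma double_potential_sym x t :
  double_potential x t = u x t + c1 *: lie (t1 x t) a + c2 *: lie (q2 x t) a.
Proof.
have := tau_sum (Q1 x t) (Q2 x t) z12 z12b; rewrite -/y1 -/y2 -/c1 -/c2 -/(phit x t) -/(t1 x t) -/(t2 x t).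
rewrite /double_potential; move: (q1 x t) (q2 x t) (t1 x t) (t2 x t) (u x t) => A B A' B' W.
exact: lie_exchange.
Qed.

Lemma double_left_ode x t : exists dt1 dt2,
  [/\ mder (t1^~ t) x dt1, mder (t2^~ t) x dt2,
   forall l, ((l - z2) *: 1%:M + c2 *: t2 x t) *m (l *: a + (u x t + c1 *: lie (q1 x t) a)) - c2 *: dt2 =
      (l *: a + double_potential x t) *m ((l - z2) *: 1%:M + c2 *: t2 x t) &
   forall l, ((l - z1) *: 1%:M + c1 *: t1 x t) *m (l *: a + (u x t + c2 *: lie (q2 x t) a)) - c1 *: dt1 =
      (l *: a + double_potential x t) *m ((l - z1) *: 1%:M + c1 *: t1 x t)].
Proof.
have [dt1 hdt1] := dt_ex (dq1 x t); have [dt2 hdt2] := dt_ex (dq2 x t).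
exists dt1, dt2; have lin z c (q : R -> M) D l : mder q x D ->
    mder (fun s => (l - z) *: 1%:M + c *: q s) x (c *: D).
  move=> h; apply: mder_ext (mderD (mder_cst ((l - z) *: 1%:M) x) (mderZ c h)) _ _ => //.
  by rewrite add0r.
have fac s l := tau_factor (Q1 s t) (Q2 s t) z12 z12b l.
have dfac l := mder_unique
  (mderM (lin z2 c2 _ _ l hdt2) (lin z1 c1 _ _ l (dq1 x t)))
  (mder_ext (mderM (lin z1 c1 _ _ l hdt1) (lin z2 c2 _ _ l (dq2 x t)))
    (fun s => esym (fac s l)) erefl).
have [] := left_factor_ode (fac x) dfac
  (fun l => degree_one_ode l (mul_hproj (Q1 x t)) (erefl _))
  (fun l => degree_one_ode l (mul_hproj (Q2 x t)) (erefl _))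
  (erefl (double_potential x t)).
- rewrite double_potential_sym; exact: addrAC.
- move=> Y; rewrite -phitE => h.
  by rewrite -[Y](mulmxK (phit_unit x t)) h mul0mx.
move=> h2 h1; exact: And4 hdt1 hdt2 h2 h1.
Qed.

(** The frame dressed through z1 is regular except at z2 and conj z2, where the frame dressed
    through z2 takes over; both agree elsewhere by simple_element_exchange. *)
Lemma double_dressing : exists F : R -> R -> C -> M,
  [/\ forall x t l, dom l -> hol_at (F x t) l,
      forall x t l, dom l -> mder (fun s => F s t l) x
        (F x t l *m (l *: a + double_potential x t))
    & forall x t l, l != z1 -> l != y1 -> l != z2 -> l != y2 ->
        F x t l *m (simple_element z2 (t2 x t) l *m simple_element z1 (q1 x t) l) =
        simple_element z2 r2 l *m simple_element z1 p1 l *m E x t l].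
Proof.
have [F1 [hol1 ode1 fac1]] := single_dressing fr nr1 hp1 hq1.
have [F2 [hol2 ode2 fac2]] := single_dressing fr nr2 hp2 hq2.
have ne1 := nonreal_neq nr1; have ne2 := nonreal_neq nr2.
have z1y2 : z1 != y2 by [].
have y1z2 : y1 != z2 by apply: contra z12b => /eqP <-; rewrite /y1 conjCK.
have y1y2 : y1 != y2.
  by apply: contra z12 => /eqP e; rewrite -(conjCK z1) -/y1 e /y2 conjCK.
have y1c : (y1^*)%R = z1 by exact: conjCK.
have y2c : (y2^*)%R = z2 by exact: conjCK.
pose A x t l := simple_element z2 r2 l *m F1 x t l *m simple_element y2 (t2 x t) l.
pose B x t l := simple_element z1 r1 l *m F2 x t l *m simple_element y1 (t1 x t) l.
have solve (F G S S' : M) : F *m S = G -> S *m S' = 1%:M -> F = G *m S'.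
  by move=> <- e; rewrite -mulmxA e mulmx1.
have AB x t l : l != z1 -> l != y1 -> l != z2 -> l != y2 -> A x t l = B x t l.
  move=> lz1 ly1 lz2 ly2.
  have e1 := solve _ _ _ _ (fac1 x t l lz1 ly1) (simple_elementV (Q1 x t) lz1 ly1).
  have e2 := solve _ _ _ _ (fac2 x t l lz2 ly2) (simple_elementV (Q2 x t) lz2 ly2).
  have ex := simple_element_exchange hp1 hp2 z12 z12b ly1 ly2.
  have ext := simple_element_exchange (Q1 x t) (Q2 x t) z12 z12b ly1 ly2.
  have exi := inverse_exchange ext (simple_elementV (T2 x t) lz2 ly2)
    (simple_elementV (Q1 x t) lz1 ly1) (simple_elementV (T1 x t) lz1 ly1)
    (simple_elementV (Q2 x t) lz2 ly2).
  rewrite /A /B e1 e2; exact: conjugate_exchange.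
pose F x t l := if (l == z2) || (l == y2) then B x t l else A x t l.
exists F; split=> x t l.
- move=> dl; have [sp|gen] := boolP ((l == z2) || (l == y2)).
    apply: (@hol_near _ _ (B x t)).
      exists (Num.min (cn (l - z1)) (cn (l - y1))).
        rewrite lt_min !cn_gt0 !subr_eq0.
        by case/orP: sp => /eqP ->; rewrite ![_ == z1]eq_sym ![_ == y1]eq_sym ?z12 ?y1z2 ?z1y2 ?y1y2.
      move=> s; rewrite lt_min => /andP[s1 s2].
      have far (w : C) : cn (s - l) < cn (l - w) -> s != w.
        by apply: contraTneq => ->; rewrite -cnN opprB ltxx.
      rewrite /F; have [_|/norP[sz2 sy2]] := boolP ((s == z2) || (s == y2)); first exact: erefl.
      exact: esym (AB x t s (far _ s1) (far _ s2) sz2 sy2).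
    have l1 : l != y1 by case/orP: sp => /eqP ->; rewrite eq_sym.
    have l1' : l != (y1^*)%R by rewrite y1c; case/orP: sp => /eqP ->; rewrite eq_sym.
    exact: (holM (holM (hol_simple (P := r1) l1) (hol2 x t l dl)) (hol_simple (P := t1 x t) l1')).
  have [lz2 ly2] := norP gen.
  apply: (@hol_near _ _ (A x t)).
    exists (Num.min (cn (l - z2)) (cn (l - y2))).
      by rewrite lt_min !cn_gt0 !subr_eq0 lz2.
    move=> s; rewrite lt_min => /andP[s1 s2].
    have far (w : C) : cn (s - l) < cn (l - w) -> s != w.
      by apply: contraTneq => ->; rewrite -cnN opprB ltxx.
    by rewrite /F (negPf (far _ s1)) (negPf (far _ s2)).
  have l2' : l != (y2^*)%R by rewrite y2c.
  exact: (holM (holM (hol_simple (P := r2) ly2) (hol1 x t l dl)) (hol_simple (P := t2 x t) l2')).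
- move=> dl; have [dt1 [dt2 [hdt1 hdt2 rel2 rel1]]] := double_left_ode x t.
  have [sp|gen] := boolP ((l == z2) || (l == y2)).
    have l1 : l != z1 by case/orP: sp => /eqP ->; rewrite eq_sym.
    have l1' : l != y1 by case/orP: sp => /eqP ->; rewrite eq_sym.
    have FB s : F s t l = B s t l by rewrite /F sp.
    have h := redress_mder (simple_element z1 r1 l) (fun s => T1 s t) l1 l1' (ode2 x t l dl) hdt1 (rel1 l).
    by rewrite FB; apply: (mder_ext h (fun s => esym (FB s)) erefl).
  have [lz2 ly2] := norP gen.
  have FA s : F s t l = A s t l by rewrite /F (negPf gen).
  have h := redress_mder (simple_element z2 r2 l) (fun s => T2 s t) lz2 ly2 (ode1 x t l dl) hdt2 (rel2 l).
  by rewrite FA; apply: (mder_ext h (fun s => esym (FA s)) erefl).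
- move=> lz1 ly1 lz2 ly2; rewrite /F (negPf lz2) (negPf ly2) /=.
  have e : simple_element y2 (t2 x t) l *m simple_element z2 (t2 x t) l = 1%:M.
    by apply: mulmx1C; exact: simple_elementV.
  have k := mulmx_cancel_mid (simple_element z2 r2 l) (F1 x t l) (simple_element z1 (q1 x t) l) e.
  apply: etrans k _; rewrite (fac1 x t l lz1 ly1); exact: mulmxA.
Qed.

End DoubleDressing.
(** * Rational functions without poles *)

Section Liouville.
Variable R : realType.
Local Notation C := R[i].
Implicit Types (f : C -> C) (p q : {poly C}) (l : C).

Lemma poly_locally_lipschitz p l0 : exists2 K : R, 0 <= K &
  forall l, cn (l - l0) < 1 -> cn (p.[l] - p.[l0]) <= K * cn (l - l0).
Proof.
elim/poly_ind: p => [|p c [K K0 hK]].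
  by exists 0 => // l _; rewrite !horner0 subrr cn0 mul0r.
exists (K * (1 + cn l0) + cn p.[l0]); first by rewrite addr_ge0 ?mulr_ge0 ?addr_ge0 ?cn_ge0.
move=> l l1; rewrite !hornerMXaddC.
have -> : p.[l] * l + c - (p.[l0] * l0 + c) = (p.[l] - p.[l0]) * l + p.[l0] * (l - l0) by ring.
apply: le_trans (cnD _ _) _; rewrite (mulrDl (K * (1 + cn l0))); apply: lerD; last by apply: cnM.
apply: le_trans (cnM _ _) _; rewrite [leRHS]mulrAC; apply: ler_pM; rewrite ?cn_ge0 ?hK //.
rewrite -[l in leLHS](subrK l0); apply: le_trans (cnD _ _) _.
by rewrite lerD2r ltW.
Qed.

Lemma poly_bounded p (r : R) : 0 <= r -> exists2 K : R, 0 <= K &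
  forall l, cn l <= r -> cn p.[l] <= K.
Proof.
move=> r0; elim/poly_ind: p => [|p c [K K0 hK]].
  by exists 0 => // l _; rewrite horner0 cn0.
exists (K * r + cn c); first by rewrite addr_ge0 ?mulr_ge0 ?cn_ge0.
move=> l lr; rewrite hornerMXaddC; apply: le_trans (cnD _ _) _; rewrite lerD2r.
by apply: le_trans (cnM _ _) _; apply: ler_pM; rewrite ?cn_ge0 ?hK.
Qed.

Lemma finite_cn_bounded (S : set C) : finite_set S ->
  exists2 r : R, 0 <= r & forall l, r < cn l -> ~ S l.
Proof.
move=> /finite_seqP[s ->]; elim: s => [|x s [r r0 IH]]; first by exists 0.
exists (Num.max r (cn x)); first by rewrite le_max r0.
move=> l; rewrite gt_max => /andP[lr lx]; rewrite /= inE => /orP[/eqP e|]; last exact: IH.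
by rewrite e ltxx in lx.
Qed.

(** The exceptional set S is arbitrary: values of f at finitely many points say nothing. *)
Definition approachable f l0 := exists K : R, forall (d : R) (S : set C), 0 < d ->
  finite_set S -> exists l, [/\ ~ S l, cn (l - l0) < d & cn (f l) <= K].

(** A root of the denominator where f stays bounded is a root of the numerator; cancel it. *)
Lemma rational_bounded_poly f p q : p != 0 ->
  almost_all (fun l => f l * p.[l] = q.[l]) -> (forall l0, approachable f l0) ->
  exists r, almost_all (fun l => f l = r.[l]).
Proof.
move=> p0 fS bd; move: {2}(size p) (leqnn (size p)) => m.
elim: m p q p0 fS => [|m IH] p q p0 fS sz.
  by move: p0; rewrite -size_poly_eq0 -leqn0 sz.
have [/eqP s1|s1] := boolP (size p == 1)%N.
  have /size_poly1P[c c0 pc] : (size p == 1)%N by apply/eqP.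
  exists (c^-1 *: q); apply: aaW fS => l; rewrite pc hornerC hornerZ => <-.
  by rewrite mulrC mulfK.
have /closed_rootP[l0 rl0] := s1.
have q0 : q.[l0] = 0.
  have [K hK] := bd l0; have [Kp Kp0 hp] := poly_locally_lipschitz p l0.
  have [Kq Kq0 hq] := poly_locally_lipschitz q l0.
  apply/eqP; rewrite -cn_eq0 eq_le cn_ge0 andbT.
  apply: (@le_of_le_addeps _ _ _ (Kq + `|K| * Kp) 1) => // e e0 e1.
  have [l [lS ld lK]] := hK e _ e0 fS.
  have fl : f l * p.[l] = q.[l] by apply: contrapT.
  have l1 := lt_trans ld e1; have k1 := hp l l1; have k2 := hq l l1.
  have pl0 : p.[l0] = 0 by exact/eqP.
  rewrite pl0 subr0 in k1.
  have -> : q.[l0] = f l * p.[l] - (q.[l] - q.[l0]) by rewrite fl; ring.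
  apply: le_trans (cnB _ _) _; rewrite add0r [leLHS]addrC (mulrDl Kq); apply: lerD.
    by apply: le_trans k2 _; rewrite ler_wpM2l // ltW.
  apply: le_trans (cnM _ _) _; rewrite -[leRHS]mulrA; apply: ler_pM; rewrite ?cn_ge0 //.
    exact: le_trans lK (ler_norm _).
  by apply: le_trans k1 _; rewrite ler_wpM2l // ltW.
have /factor_theorem[p1 pE] := rl0.
have /factor_theorem[q1 qE] : root q l0 by apply/eqP.
have p10 : p1 != 0 by apply: contraNneq p0 => p10; rewrite pE p10 mul0r.
apply: (IH p1 q1) => //.
  apply: aaW (aa_and fS (aa_neq l0)) => l [e ll0].
  move: e; rewrite pE qE !hornerM !hornerXsubC mulrA; apply: mulIf.
  by rewrite subr_eq0.
by move: sz; rewrite pE size_Mmonic ?monicXsubC // size_XsubC addn2 /= ltnS.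
Qed.

(** A nonconstant polynomial over an algebraically closed field is surjective, so it cannot
    be bounded. *)
Lemma bounded_poly_const p (r K : R) :
  (forall l, r < cn l -> cn p.[l] <= K) -> exists c, p = c%:P.
Proof.
move=> bd; have [s1|s1] := leqP (size p) 1; first by exists p`_0; exact: size1_polyC.
have r0 : 0 <= Num.max 0 r by rewrite le_max lexx.
have [B B0 hB] := poly_bounded p r0.
pose w : R := `|K| + B + 1; have w0 : 0 <= w by rewrite !addr_ge0.
have /closed_rootP[l] : size (p - w%:C%:P) != 1%N.
  rewrite size_polyDl ?gtn_eqF // size_polyN size_polyC.
  by apply: leq_ltn_trans s1; case: (_ != 0).
rewrite /root hornerD hornerN hornerC subr_eq0 => /eqP e.
have : cn p.[l] <= `|K| + B.
  have [rl|lr] := ltP r (cn l).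
    by apply: le_trans (bd l rl) _; rewrite (le_trans (ler_norm K)) // lerDl.
  by apply: le_trans (hB l _) _; [rewrite le_max lr orbT | rewrite lerDr].
by rewrite e cn_real // /w gerDl ler10.
Qed.

End Liouville.

Lemma mul_minus_one (K : comPzRingType) n (A B : 'M[K]_n) :
  A *m B - 1%:M = (A - 1%:M) *m (B - 1%:M) + (A - 1%:M) + (B - 1%:M).
Proof. by mx_ring. Qed.

(** * The dressing group and uniqueness of factorizations *)

Section GroupElements.
Variable R : realType.
Local Notation C := R[i].
Variable n : nat.
Local Notation M := 'M[C]_n.
Implicit Types (g h : C -> M) (z l : C).

Lemma aa_forall (T : finType) (P : T -> C -> Prop) :
  (forall i, almost_all (P i)) -> almost_all (fun l => forall i, P i l).
Proof.
move=> h; apply: (@sub_finite_set _ _ (\bigcup_(i in [set: T]) [set l | ~ P i l])).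
  by move=> l /= /existsNP[i hi]; exists i.
by apply: bigcup_finite => [|i _]; [exact: finite_finset | exact: h].
Qed.

Definition tends_to_1 g := forall e : R, 0 < e ->
  exists r : R, forall l, r < cn l -> mn (g l - 1%:M) < e.

Lemma limit1P g : limit_at_infinity_1 g <-> tends_to_1 g.
Proof.
split=> h e e0; last first.
  have [r hr] := h e e0; exists r => l lr i j.
  apply: le_lt_trans (norm_le_cn _) _; rewrite ltcR.
  have rl : r < cn l by rewrite -ltcR; apply: lt_le_trans lr (norm_le_cn _).
  by apply: le_lt_trans (hr l rl); have := cn_le_mn (g l - 1%:M) i j; rewrite mxD_ij mxN_ij.
pose m : R := (n * n)%:R * 2 + 1.
have m0 : 0 < m by rewrite ltr_wpDl // mulr_ge0.
have [r hr] := h (e / m) (divr_gt0 e0 m0); exists (2 * r) => l lr.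
have rl : r%:C < `|l|.
  have : (2 * r)%:C < `|l| *+ 2 by apply: lt_le_trans (cn_le_norm l); rewrite ltcR.
  by rewrite rmorphM rmorph_nat mulr_natl ltrMn2r.
apply: (@le_lt_trans _ _ ((n * n)%:R * (2 * (e / m)))).
  apply: mn_le => i j; rewrite mxD_ij mxN_ij -lecR; apply: le_trans (cn_le_norm _) _.
  by rewrite rmorphM rmorph_nat mulr_natl lerMn2r /= ltW // hr.
by rewrite mulrA mulrCA -[ltRHS]mulr1 ltr_pM2l // ltr_pdivrMr // mul1r ltrDl.
Qed.

Lemma tends_to_1M g h : tends_to_1 g -> tends_to_1 h -> tends_to_1 (fun l => g l *m h l).
Proof.
move=> hg hh e e0; pose d := Num.min 1 (e / 4).
have d0 : 0 < d by rewrite lt_min ltr01 divr_gt0.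
have [r1 h1] := hg d d0; have [r2 h2] := hh d d0; exists (Num.max r1 r2) => l.
rewrite gt_max => /andP[/h1 k1 /h2 k2].
have -> : g l *m h l - 1%:M = (g l - 1%:M) *m (h l - 1%:M) + (g l - 1%:M) + (h l - 1%:M).
  exact: mul_minus_one.
apply: le_lt_trans (mnD _ _) _; apply: le_lt_trans (lerD (mnD _ _) (lexx _)) _.
apply: le_lt_trans (lerD (lerD (mnM _ _) (lexx _)) (lexx _)) _.
have p1 := mn_ge0 (g l - 1%:M); have p2 := mn_ge0 (h l - 1%:M).
have d1 : d <= 1 by rewrite ge_min lexx.
have d4 : d <= e / 4 by rewrite ge_min lexx orbT.
have : mn (g l - 1%:M) * mn (h l - 1%:M) <= d * 1.
  by apply: ler_pM => //; [exact: ltW | exact: le_trans (ltW k2) d1].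
lra.
Qed.

Lemma tends_to_1_adj g : tends_to_1 g -> tends_to_1 (fun l => (g (l^*)%R)^t*).
Proof.
move=> h e e0; have [r hr] := h e e0; exists r => l lr.
have -> : (g (l^*)%R)^t* - 1%:M = (g (l^*)%R - 1%:M)^t* by rewrite (adjD (g (l^*)%R)) adjN adj1.
by rewrite mnJ; apply: hr; rewrite cnJ.
Qed.

Lemma tends_to_1_simple z P : tends_to_1 (simple_element z P).
Proof.
move=> e e0; pose c := cn (z - (z^*)%R) * mn (1%:M - P : M).
have c0 : 0 <= c by rewrite mulr_ge0 ?cn_ge0 ?mn_ge0.
exists (cn z + 2 * (c + 1) / e) => l lr.
have e2 : 0 < 2 * (c + 1) / e by rewrite divr_gt0 // mulr_gt0 // ltr_wpDl.
have far : 2 * (c + 1) / e < cn (l - (z^*)%R).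
  have : cn l <= cn (l - (z^*)%R) + cn z.
    by rewrite -{1}[l](subrK (z^*)%R) -[cn z]cnJ; exact: cnD.
  lra.
have lz : l - (z^*)%R != 0 by rewrite -cn_gt0; apply: lt_trans e2 far.
have -> : simple_element z P l - 1%:M = (- (z - (z^*)%R) * (l - (z^*)%R)^-1) *: (1%:M - P).
  rewrite /simple_element; have -> : (l - z) / (l - (z^*)%R) = 1 - (z - (z^*)%R) * (l - (z^*)%R)^-1 :> C.
    by rewrite -{1}(divff lz) -mulrBl; congr (_ / _); ring.
  move: ((l - (z^*)%R)^-1) (z - (z^*)%R) => k k'.
  by mx_entries; ring.
apply: le_lt_trans (mnZ _ _) _.
have w0 : 0 < cn (l - (z^*)%R) by rewrite cn_gt0.
have k1 : cn (l - (z^*)%R)^-1 < e / (c + 1).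
  apply: (@le_lt_trans _ _ (2 / cn (l - (z^*)%R))); first by rewrite ler_pdivlMr // cnV.
  have c1 : 0 < c + 1 by rewrite ltr_wpDl.
  by rewrite ltr_pdivrMr // mulrAC ltr_pdivlMr // -ltr_pdivrMl // mulrC.
apply: (@le_lt_trans _ _ (c * cn (l - (z^*)%R)^-1)).
  rewrite /c [leRHS]mulrAC ler_wpM2r ?mn_ge0 // -[cn (z - _)]cnN; exact: cnM.
apply: (@le_lt_trans _ _ (c * (e / (c + 1)))); first by rewrite ler_wpM2l // ltW.
have c1 : 0 < c + 1 by rewrite ltr_wpDl.
by rewrite mulrCA gtr_pMr // ltr_pdivrMr // mul1r ltrDl.
Qed.

Lemma rational_entries g : rational g -> exists (p : {poly C}) (P : 'M[{poly C}]_n),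
  p != 0 /\ almost_all (fun l => forall i j, g l i j * p.[l] = (P i j).[l]).
Proof.
move=> [p [P [p0 h]]]; exists p, P; split=> //.
have roots_fin : almost_all (fun l => p.[l] != 0).
  apply: (@sub_finite_set _ _ [set` (sval (closed_field_poly_normal p))]); last exact: finite_seq.
  move=> l /= /negP; rewrite negbK => /eqP pl.
  case: (closed_field_poly_normal p) => s /= pE.
  by move: pl; rewrite pE => /eqP; rewrite -/(root _ l) rootZ ?lead_coef_eq0 // root_prod_XsubC.
by apply: aaW (aa_and h roots_fin) => l [-> pl] i j; rewrite !mxE mulrAC mulVf // mul1r.
Qed.

Lemma rational_simple z (P : M) : rational (simple_element z P).
Proof.
pose y := (z^*)%R.
exists ('X - y%:P), (\matrix_(i, j) (('X - y%:P) * (P i j)%:P + ('X - z%:P) * ((1%:M - P : M) i j)%:P)).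
split; first by rewrite polyXsubC_eq0.
apply: aaW (aa_neq y) => l ly; have ly0 : l - y != 0 by rewrite subr_eq0.
apply/matrixP => i j; rewrite hornerXsubC !mxZ_ij /simple_element mxD_ij mxZ_ij.
move: (1%:M - P) => P'; rewrite !mxE !hornerE -/y.
by field.
Qed.

Lemma rationalM g h : rational g -> rational h -> rational (fun l => g l *m h l).
Proof.
move=> [p [P [p0 hp]]] [q [Q [q0 hq]]]; exists (p * q), (P *m Q); split; first by rewrite mulf_neq0.
apply: aaW (aa_and hp hq) => l [-> ->]; rewrite scalemx_l scalemx_r scalerA hornerM invfM.
congr (_ *: _); apply/matrixP => i j; rewrite !mxE horner_sum.
by apply: eq_bigr => k _; rewrite !mxE hornerM.
Qed.

Lemma Gm_simple z (P : M) : herm_projection P -> Gm (simple_element z P).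
Proof.
move=> hP; split; [exact: rational_simple | exact/limit1P/tends_to_1_simple |].
apply: aaW (aa_and (aa_neq z) (aa_neq (z^*)%R)) => l [lz lzb].
have e := simple_element_adj z l hP; apply: mulmx1C.
by apply: etrans (simple_elementV hP lz lzb); congr (_ *m _).
Qed.

Lemma unitary_mul (A A' B B' : M) : A'^t* *m A = 1%:M -> B'^t* *m B = 1%:M ->
  (A' *m B')^t* *m (A *m B) = 1%:M.
Proof. by move=> h k; rewrite (adjM A') -mulmxA (mulmxA (A'^t*)) h mul1mx. Qed.

Lemma GmM g h : Gm g -> Gm h -> Gm (fun l => g l *m h l).
Proof.
move=> [g1 /limit1P g2 g3] [h1 /limit1P h2 h3]; split.
- exact: rationalM.
- by apply/limit1P; exact: tends_to_1M.
- by apply: aaW (aa_and g3 h3) => l [e1 e2]; exact: unitary_mul.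
Qed.

Lemma rational_entries_adj g : rational g -> exists (p : {poly C}) (P : 'M[{poly C}]_n),
  p != 0 /\ almost_all (fun l => forall i j, (g (l^*)%R)^t* i j * p.[l] = (P i j).[l]).
Proof.
move=> /rational_entries[p [P [p0 h]]].
pose cj : {rmorphism C -> C} := (Num.conj : C -> C).
exists (map_poly cj p), (\matrix_(i, j) map_poly cj (P j i)); split.
  by rewrite map_poly_eq0.
have ev (r : {poly C}) l : (map_poly cj r).[l] = (r.[(l^*)%R]^*)%R.
  by rewrite -[l in LHS]conjCK -[((l^*)^*)%R]/(cj (l^*)%R) horner_map.
apply: aaW (aa_conj h) => l e i j; rewrite [in RHS]mxE !ev -e rmorphM; congr (_ * _).
by rewrite !mxE.
Qed.

Variable dom : C -> Prop.
Hypotheses (dom_aa : almost_all dom) (dom_conj : forall l, dom l -> dom (l^*)%R).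
Hypothesis dom_nonreal : forall l, l \isn't Num.real -> dom l.

(** The quotient H of two factorizations of the same matrix is at once a quotient of frames,
    hence regular on the domain, and a quotient of group elements, hence rational, equal to 1
    at infinity and unitary on the real axis. The last property excludes a pole at the
    real points that are missing from the domain. So H is a constant polynomial, equal to 1. *)
Lemma factorization_unique (A g gt gt' F F' : C -> M) : Gm gt -> Gm gt' ->
  (forall l, dom l -> hol_at F l) -> (forall l, dom l -> hol_at F' l) ->
  (forall l, dom l -> (F (l^*)%R)^t* *m F l = 1%:M) ->
  almost_all (fun l => g l *m A l = F l *m gt l) ->
  almost_all (fun l => g l *m A l = F' l *m gt' l) ->
  forall l, dom l -> F l = F' l.
Proof.
move=> [rg /limit1P lg ug] [rg' /limit1P lg' ug'] hF hF' uF e e'.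
pose H l := (F (l^*)%R)^t* *m F' l; pose G l := gt l *m (gt' (l^*)%R)^t*.
have HG : almost_all (fun l => H l = G l).
  apply: aaW (aa_and (aa_and (aa_and ug' e) e') dom_aa) => l [[[u1 e1] e2] dl].
  have h : H l *m gt' l = gt l.
    by rewrite /H -mulmxA -e2 e1 mulmxA uF // mul1mx.
  by rewrite /G -h -mulmxA (mulmx1C u1) mulmx1.
have Hc l : dom l -> mcont H l.
  move=> dl; apply: mcontM; last exact/hol_mcont/hF'.
  by apply: mcont_adj; apply/hol_mcont/hF/dom_conj.
have H1 : almost_all (fun l => H l = 1%:M).
  (* inside the domain H is continuous; a point outside is real, and H is a product of
     unitary matrices at almost all real points *)
  have appr i j l0 : approachable (fun l => H l i j) l0.
    have [dl0|ndl0] := pselect (dom l0).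
      exists (mn (H l0) + 1) => d S d0 fS; have [r r0 hr] := Hc l0 dl0 1 ltr01.
      have rm : 0 < Num.min r d by rewrite lt_min r0.
      have [x [x0 xr xS]] := near_point l0 fS rm.
      have cx : cn (l0 + x%:C - l0) = x by rewrite addrC addKr cn_real // ltW.
      move: xr; rewrite lt_min => /andP[xr xd].
      exists (l0 + x%:C); rewrite cx; split=> //.
      apply: le_trans (cn_le_mn _ i j) _; rewrite -[H _](subrK (H l0)) addrC.
      by apply: le_trans (mnD _ _) _; rewrite lerD2l ltW // hr ?cx.
    have rl0 : l0 \is Num.real by apply: contrapT => /negP/dom_nonreal.
    exists (n%:R * 4) => d S d0 fS.
    have fS' : finite_set (S `|` [set l | ~ (H l = G l /\
         ((gt (l^*)%R)^t* *m gt l = 1%:M /\ (gt' (l^*)%R)^t* *m gt' l = 1%:M))]).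
      rewrite finite_setU; split=> //; exact: (aa_and HG (aa_and ug ug')).
    have [x [x0 xd xS]] := near_point l0 fS' d0.
    have lr : ((l0 + x%:C)^*)%R = l0 + x%:C.
      by apply/CrealP; rewrite rpredD //; apply/complex_realP; exists x.
    exists (l0 + x%:C); split.
    - by move=> h; apply: xS; left.
    - by rewrite addrC addKr cn_real // ltW.
    have [hg [u u']] : H (l0 + x%:C) = G (l0 + x%:C) /\ (((gt ((l0 + x%:C)^*)%R)^t* *m gt (l0 + x%:C) = 1%:M /\
        (gt' ((l0 + x%:C)^*)%R)^t* *m gt' (l0 + x%:C) = 1%:M)).
      by apply: contrapT => h; apply: xS; right.
    rewrite hg /G lr mxE; rewrite lr in u u'.
    apply: le_trans (cn_sum _ _) _.
    apply: (@le_trans _ _ (\sum_(k < n) (4 : R))).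
      apply: ler_sum => k _; apply: le_trans (cnM _ _) _.
      have -> : 4 = 2 * 2 :> R by ring.
      apply: ler_pM; rewrite ?cn_ge0 //; first exact: unitary_cn.
      by rewrite !mxE; have := unitary_cn j k u'; rewrite -cnJ.
    by rewrite sumr_const card_ord mulr_natl.
  have [p [P [p0 hp]]] := rational_entries rg.
  have [p' [P' [p'0 hp']]] := rational_entries_adj rg'.
  have tG : tends_to_1 G by apply: tends_to_1M => //; exact: tends_to_1_adj.
  suff Hij (ij : 'I_n * 'I_n) : almost_all (fun l => H l ij.1 ij.2 = (1%:M : M) ij.1 ij.2).
    by apply: aaW (aa_forall Hij) => l h; apply/matrixP => i j; exact: (h (i, j)).
  case: ij => i j /=.
  have frac : almost_all (fun l => H l i j * (p * p').[l] = (\sum_k P i k * P' k j).[l]).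
    apply: aaW (aa_and HG (aa_and hp hp')) => l [-> [e1 e2]].
    rewrite /G mxE mulr_suml horner_sum; apply: eq_bigr => k _.
    by rewrite !hornerM -e1 -e2 mulrACA.
  have [r hr] := rational_bounded_poly (mulf_neq0 p0 p'0) frac (appr i j).
  have [rad _ hrad] := finite_cn_bounded (aa_and hr HG).
  have rG l : rad < cn l -> r.[l] = G l i j.
    by move=> /hrad/contrapT[<- <-].
  have [r1 h1] := tG 1 ltr01.
  have [c cE] : exists c, r = c%:P.
    apply: (@bounded_poly_const _ r (Num.max rad r1) (1 + cn ((1%:M : M) i j))) => l.
    rewrite gt_max => /andP[lr /h1 l1]; rewrite rG // -[G l i j](subrK ((1%:M : M) i j)).
    apply: le_trans (cnD _ _) _; rewrite lerD2r; apply: ltW; apply: le_lt_trans l1.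
    by have := cn_le_mn (G l - 1%:M) i j; rewrite mxD_ij mxN_ij.
  suff -> : (1%:M : M) i j = c by apply: aaW hr => l ->; rewrite cE hornerC.
  apply/eqP; rewrite eq_sym -subr_eq0 -cn_eq0 eq_le cn_ge0 andbT.
  apply: (@le_of_le_addeps _ _ _ 1 1) => // d d0 _; rewrite add0r mul1r.
  have [r2 h2] := tG d d0; pose x := `|rad| + `|r2| + 1.
  have x0 : 0 <= x by rewrite !addr_ge0.
  have cx : cn (x%:C : C) = x by exact: cn_real.
  have xr : rad < cn (x%:C : C).
    by rewrite cx /x; have := ler_norm rad; have := normr_ge0 r2; lra.
  have xr2 : r2 < cn (x%:C : C).
    by rewrite cx /x; have := ler_norm r2; have := normr_ge0 rad; lra.
  have := rG _ xr; rewrite cE hornerC => ->; apply: ltW; apply: le_lt_trans (h2 _ xr2).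
  by have := cn_le_mn (G x%:C - 1%:M) i j; rewrite mxD_ij mxN_ij.
move=> l dl; have h : H l = 1%:M by apply: (mcont_eq (Hc l dl) (@mcont_cst R n 1%:M l) H1).
have uF' := mulmx1C (uF l dl).
by rewrite -[LHS]mulmx1 -h /H mulmxA uF' mul1mx.
Qed.

End GroupElements.
(** * The action on solutions and Bianchi's permutability theorem *)

Section Action.
Variable R : realType.
Local Notation C := R[i].
Variable n : nat.
Local Notation M := 'M[C]_n.
Variables (a b : M) (Q : nat -> mxdpoly R n) (j : int) (u0 : R -> R -> M).
Hypotheses (da : is_diag_mx a) (ua : u_n a) (ub : u_n b).
Hypothesis HQ : is_Qfamily a b Q.
Hypothesis Hsol : solutions a b Q j u0.

Local Notation dom := (spectral_domain (R := R) j).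

Lemma domain_aa : almost_all dom.
Proof.
by apply: aaW (aa_neq 0) => l l0; rewrite /spectral_domain /=; case: ifP => // _; exact/eqP.
Qed.

Lemma domain_nonreal l : l \isn't Num.real -> dom l.
Proof.
move=> nr; rewrite /spectral_domain /=; case: ifP => // _ l0.
by move: nr; rewrite l0 real0.
Qed.

Lemma triv_frame E : is_trivialization a b Q j u0 E -> extended_frame dom a u0 E.
Proof.
move=> HE; split.
- exact: domain_aa.
- exact: domain_conj.
- exact: domain_nonreal.
- exact: ua.
- exact: sol_u_n Hsol.
- by move=> x t l dl; apply: triv_ode HE dl.
- by move=> x t l dl; apply: (triv_pairing da ua ub HQ Hsol HE HE).
- by move=> l0 t dl; apply: (triv_jet Hsol t HE dl).
Qed.

(** The factorization is unique at every (x, t), and the trivialization is unique on the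
    spectral domain; the potential is read off at l = i, which is in every domain. *)
Lemma dresses_unique g ut ut' : dresses a b Q j g u0 ut -> dresses a b Q j g u0 ut' -> ut = ut'.
Proof.
move=> [E [F [gt [HE hF dF]]]] [E' [F' [gt' [HE' hF' dF']]]].
have FF x t l : dom l -> F x t l = F' x t l.
  have [e gm hol _ uni] := hF x t; have [e' gm' hol' _ _] := hF' x t.
  apply: (factorization_unique domain_aa (@domain_conj R j) domain_nonreal (A := E x t) gm gm' hol hol' uni e).
  apply: aaW (aa_and e' domain_aa) => s [k ds].
  by rewrite -k (triv_unique da ua ub HQ Hsol x t HE HE' ds).
(* any nonreal value of l is in the domain *)
pose l : C := 'i.
have dl : dom l.
  by apply: domain_nonreal; rewrite complex_real oner_eq0.
apply/funext => x; apply/funext => t.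
have [_ e] := dF l dl x t; have [_ e'] := dF' l dl x t.
have ff : (fun s => F s t l) = (fun s => F' s t l) by apply/funext => s; rewrite FF.
by move: e; rewrite ff FF // e' => /addrI.
Qed.

Lemma acts_to_intro E g F (gt : R -> R -> C -> M) ut :
  is_trivialization a b Q j u0 E -> Gm g -> (forall x t, Gm (gt x t)) ->
  (forall x t l, dom l -> hol_at (F x t) l) ->
  (forall x t l, dom l -> mder (fun s => F s t l) x (F x t l *m (l *: a + ut x t))) ->
  (forall x t, almost_all (fun l => g l *m E x t l = F x t l *m gt x t l)) ->
  acts_to a b Q j g u0 ut.
Proof.
move=> HE gG gtG hol ode fac; have fr := triv_frame HE.
have uni x t l : dom l -> (F x t (l^*)%R)^t* *m F x t l = 1%:M.
  move=> dl; have [_ _ g3] := gG; have [_ _ gt3] := gtG x t.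
  exact: (dressed_unitary fr (fun l dl => frame_unit fr x t dl) (hol x t) g3 gt3 (fac x t) dl).
have unit_F x t l : dom l -> F x t l \in unitmx.
  by move=> dl; case: (mulmx1_unit (uni x t l dl)).
have dr : dresses a b Q j g u0 ut.
  exists E, F, gt; split=> // [x t|l dl x t].
    split; [exact: fac | exact: gtG | exact: hol | exact: unit_F | exact: uni].
  have /mderP[d1 d2] := ode x t l dl; split=> //.
  by rewrite d2 mulKmx // unit_F.
split=> // ut' dr'; exact: dresses_unique dr' dr.
Qed.

Variables (E : R -> R -> C -> M).
Hypothesis HE : is_trivialization a b Q j u0 E.

Lemma single_acts z p (q : R -> R -> M) : z \isn't Num.real -> herm_projection p ->
  (forall x t, is_herm_projection_onto [set (E x t z)^t* *m v | v in mximage p] (q x t)) ->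
  acts_to a b Q j (simple_element z p) u0
    (fun x t => u0 x t + (z - (z^*)%R) *: lie (q x t) a).
Proof.
move=> nz hp hq; have [F [hol ode fac]] := single_dressing (triv_frame HE) nz hp hq.
apply: (acts_to_intro (gt := fun x t => simple_element z (q x t)) HE _ _ hol ode).
- exact: Gm_simple.
- by move=> x t; apply: Gm_simple; exact: frame_proj hq x t.
move=> x t; apply: aaW (aa_and (aa_neq z) (aa_neq (z^*)%R)) => l [l1 l2].
exact: esym (fac x t l l1 l2).
Qed.

Variables (z1 z2 : C) (p1 p2 : M) (q1 q2 : R -> R -> M).
Hypotheses (nr1 : z1 \isn't Num.real) (nr2 : z2 \isn't Num.real).
Hypotheses (z12 : z1 != z2) (z12b : z1 != (z2^*)%R).
Hypotheses (hp1 : herm_projection p1) (hp2 : herm_projection p2).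
Hypothesis hq1 : forall x t,
  is_herm_projection_onto [set (E x t z1)^t* *m v | v in mximage p1] (q1 x t).
Hypothesis hq2 : forall x t,
  is_herm_projection_onto [set (E x t z2)^t* *m v | v in mximage p2] (q2 x t).

Let phi := bianchi_phi z1 z2 p1 p2.
Let r1 := phi *m p1 *m invmx phi.
Let r2 := phi *m p2 *m invmx phi.

(** The element g is one of the two products of simple elements, which agree off the poles. *)
Lemma double_acts_of g : Gm g ->
  (forall l, l != (z1^*)%R -> l != (z2^*)%R ->
    g l = simple_element z2 r2 l *m simple_element z1 p1 l) ->
  acts_to a b Q j g u0 (double_potential a u0 z1 z2 q1 q2).
Proof.
move=> gG gE; have [F [hol ode fac]] :=
  double_dressing (triv_frame HE) nr1 nr2 z12 z12b hp1 hp2 hq1 hq2.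
have Q1 x t := frame_proj hq1 x t; have Q2 x t := frame_proj hq2 x t.
pose phit x t := bianchi_phi z1 z2 (q1 x t) (q2 x t).
pose gt x t l := simple_element z2 (phit x t *m q2 x t *m invmx (phit x t)) l *m
  simple_element z1 (q1 x t) l.
apply: (acts_to_intro (gt := gt) HE gG _ hol ode).
  by move=> x t; apply: GmM; apply: Gm_simple; [exact: (tau2_hproj (Q1 x t) (Q2 x t) z12 z12b) | exact: Q1].
move=> x t; apply: aaW (aa_and (aa_and (aa_neq z1) (aa_neq (z1^*)%R)) (aa_and (aa_neq z2) (aa_neq (z2^*)%R))).
move=> l [[l1 l2] [l3 l4]]; rewrite (gE l l2 l4).
exact: esym (fac x t l l1 l2 l3 l4).
Qed.

End Action.

Theorem mainTheorem11 (R : realType) (n : nat) (a b : 'M[R[i]]_n)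
    (Q : nat -> mxdpoly R n) (j : int) (z1 z2 : R[i]) (pi1 pi2 : 'M[R[i]]_n)
    (u0 : R -> R -> 'M[R[i]]_n) (E : R -> R -> R[i] -> 'M[R[i]]_n)
    (pit1 pit2 : R -> R -> 'M[R[i]]_n) :
  is_diag_mx a -> u_n a -> u_n b -> polynomial_in a b ->
  is_Qfamily a b Q ->
  j = -1 \/ 1 <= j ->
  z1 \isn't Num.real -> z2 \isn't Num.real -> z1 != z2 -> z1 != (z2^*)%R ->
  herm_projection pi1 -> herm_projection pi2 ->
  solutions a b Q j u0 ->
  is_trivialization a b Q j u0 E ->
  (forall x t, is_herm_projection_onto
     [set (E x t z1)^t* *m v | v in mximage pi1] (pit1 x t)) ->
  (forall x t, is_herm_projection_onto
     [set (E x t z2)^t* *m v | v in mximage pi2] (pit2 x t)) ->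
  let phi := bianchi_phi z1 z2 pi1 pi2 in
  let phit x t := bianchi_phi z1 z2 (pit1 x t) (pit2 x t) in
  let tau1 := phi *m pi1 *m invmx phi in
  let tau2 := phi *m pi2 *m invmx phi in
  let taut1 x t := phit x t *m pit1 x t *m invmx (phit x t) in
  let taut2 x t := phit x t *m pit2 x t *m invmx (phit x t) in
  let c1 := z1 - (z1^*)%R in
  let c2 := z2 - (z2^*)%R in
  [/\ acts_to a b Q j (simple_element z1 pi1) u0
        (fun x t => u0 x t + c1 *: lie (pit1 x t) a),
      acts_to a b Q j (simple_element z2 pi2) u0
        (fun x t => u0 x t + c2 *: lie (pit2 x t) a),
      phi \in unitmx /\ (forall x t, phit x t \in unitmx),
      herm_projection tau1 /\ herm_projection tau2
    & exists u3 : R -> R -> 'M[R[i]]_n,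
      [/\ acts_to a b Q j
            (fun l => simple_element z2 tau2 l *m simple_element z1 pi1 l)
            u0 u3,
          forall x t, u3 x t =
            u0 x t + c1 *: lie (pit1 x t) a + c2 *: lie (taut2 x t) a,
          acts_to a b Q j
            (fun l => simple_element z1 tau1 l *m simple_element z2 pi2 l)
            u0 u3
        & forall x t, u3 x t =
            u0 x t + c1 *: lie (taut1 x t) a + c2 *: lie (pit2 x t) a]].
Proof.
move=> da ua ub _ HQ _ nr1 nr2 z12 z12b hp1 hp2 Hsol HE hq1 hq2 phi phit tau1 tau2 taut1 taut2 c1 c2.
have Q1 x t := frame_proj hq1 x t; have Q2 x t := frame_proj hq2 x t.
have ht1 : herm_projection tau1 := tau1_hproj hp1 hp2 z12 z12b.
have ht2 : herm_projection tau2 := tau2_hproj hp1 hp2 z12 z12b.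
split.
- exact: (single_acts da ua ub HQ Hsol HE nr1 hp1 hq1).
- exact: (single_acts da ua ub HQ Hsol HE nr2 hp2 hq2).
- split; first exact: (phi_unit hp1 hp2 z12 z12b).
  by move=> x t; exact: (phi_unit (Q1 x t) (Q2 x t) z12 z12b).
- by split.
have act := double_acts_of da ua ub HQ Hsol HE nr1 nr2 z12 z12b hp1 hp2 hq1 hq2.
exists (double_potential a u0 z1 z2 pit1 pit2); split.
- by apply: act => //; apply: GmM; apply: Gm_simple.
- by [].
- apply: act; first by apply: GmM; apply: Gm_simple.
  move=> l l1 l2; exact: esym (simple_element_exchange hp1 hp2 z12 z12b l1 l2).
- move=> x t; exact: (double_potential_sym a u0 z12 z12b hq1 hq2 x t).
Qed.
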